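(* Let $\alpha\ge -0.272$ be real and let $$\mathcal{I}_\alpha:=\inf_{F\in X_\alpha}\|j_{\alpha+1}-F\|_{L^\infty([0,\infty))}.$$ Then $$\mathcal{I}_\alpha={}_{1}F_{2}\Bigl(\alpha+1;\alpha+2,\alpha+2;-\frac{q_{\alpha+1,1}^{2}}{4}\Bigr)=\frac{\int_{0}^{q_{\alpha+1,1}}j_{\alpha+1}(t)\,t^{2\alpha+1}\,dt}{\int_{0}^{q_{\alpha+1,1}}t^{2\alpha+1}\,dt}.$$
   Context: The normalized Bessel function is $j_\alpha(z)=2^\alpha\Gamma(\alpha+1)J_\alpha(z)/z^\alpha$ (so $j_\alpha(0)=1$), where $J_\alpha$ is the Bessel function of the first kind. $\{q_{\alpha,k}\}_{k=1}^\infty$ denotes the strictly increasing sequence of all positive zeros of $j_\alpha$. For $\alpha>-\frac12$, put $r_{\alpha+1,k}=q_{\alpha+1,k}/q_{\alpha+1,1}$, $k\in\mathbb{N}$. $X_\alpha$ is the set of all functions $F\in L^\infty[0,\infty)$ that can be represented as $$F(t)=\sum_{k=1}^\infty a_k\, j_\alpha(r_{\alpha+1,k}t),\qquad a_k\in\mathbb{R},$$ where the series converges absolutely to $F$ almost everywhere on $[0,\infty)$. ${}_1F_2(a;b,c;x)=\sum_{k\ge0}\frac{(a)_k}{(b)_k(c)_k}\frac{x^k}{k!}$ is the hypergeometric function, with $(a)_k=a(a+1)\cdots(a+k-1)$. *)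

(* Defs.v *)
From mathcomp Require Import all_boot all_order all_algebra.
From mathcomp Require Import all_classical all_reals all_analysis.
Set Implicit Arguments.
Unset Strict Implicit.
Unset Printing Implicit Defensive.
Import Order.TTheory GRing.Theory Num.Theory.
Import numFieldNormedType.Exports.
Local Open Scope classical_set_scope.
Local Open Scope ring_scope.

(* Euler's integral; meaningful for [0 < x]. *)
Definition euler_gamma (R : realType) (x : R) : R :=
  \int[@lebesgue_measure R]_(t in `]0, +oo[) (t `^ (x - 1) * expR (- t)).

(* [J_alpha(z)] for [-1 < alpha] and [0 < z]: on this range every argument of
   [euler_gamma] and the base of the real power are positive. *)
Definition bessel_J (R : realType) (alpha z : R) : R :=
  limn (series (fun k : nat =>
    (-1) ^+ k / (k`!%:R * euler_gamma (k%:R + alpha + 1))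
      * (z / 2) `^ (2 * k%:R + alpha))).

(* Meaningful for [-1 < alpha] and [0 <= z]; the value at [0] is the
   continuous extension. *)
Definition bessel_j (R : realType) (alpha z : R) : R :=
  if z == 0 then 1
  else 2 `^ alpha * euler_gamma (alpha + 1) * bessel_J alpha z / z `^ alpha.

Definition enumerates_positive_zeros (R : realType) (f : R -> R)
    (q : nat -> R) : Prop :=
  increasing_seq q /\ range q = [set z : R | 0 < z /\ f z = 0].

(* At most one sequence enumerates the positive zeros, so the choice made by
   [xget] is immaterial.  Indices start at [0]: [bessel_zero alpha k] is
   q_(alpha, k+1), and [bessel_zero alpha 0] is the smallest positive zero. *)
Definition bessel_zero (R : realType) (alpha : R) : nat -> R :=
  xget (fun=> 0) [set q : nat -> R |
    enumerates_positive_zeros (bessel_j alpha) q].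

(* [bessel_ratio alpha k] is r_(alpha+1, k+1). *)
Definition bessel_ratio (R : realType) (alpha : R) (k : nat) : R :=
  bessel_zero (alpha + 1) k / bessel_zero (alpha + 1) 0.

(* Lebesgue measure on [0, +oo[, seen as a measure on the whole line.  An
   element of L^oo[0, +oo[ is represented by a function [F : R -> R] whose
   values on the negative half-line are irrelevant up to measurability. *)
Definition lebesgue_half (R : realType) : {measure set (measurableTypeR R) -> \bar R} :=
  mrestr (@lebesgue_measure R) (@measurable_itv R `[0, +oo[).

Definition bessel_space (R : realType) (alpha : R) : set (R -> R) :=
  [set F | F \in Lfun (lebesgue_half R) +oo%E /\
    exists a : nat -> R, {ae lebesgue_half R, forall t : R,
      let u := fun k : nat => a k * bessel_j alpha (bessel_ratio alpha k * t) in
      cvgn [normed series u] /\ series u @ \oo --> F t}].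

Definition bessel_best_approx (R : realType) (alpha : R) : \bar R :=
  ereal_inf [set Lnorm (lebesgue_half R) +oo%E
                   (fun t : R => (bessel_j (alpha + 1) t - F t)%:E)
            | F in bessel_space alpha].

Definition pochhammer (R : realType) (a : R) (k : nat) : R :=
  \prod_(i < k) (a + i%:R).

Definition hypergeometric_1F2 (R : realType) (a b c x : R) : R :=
  limn (series (fun k : nat =>
    pochhammer a k / (pochhammer b k * pochhammer c k) * (x ^+ k / k`!%:R))).

(* Main.v *)
(** Write v = j_alpha, h = j_(alpha+1), q = q_(alpha+1,1), c = 2 alpha + 1 and
    phi_k(t) = v(r_k t).  The functions 1, phi_1, phi_2, ... are orthogonal on
    [0, q] for the weight t^c, since q r_k runs over the zeros of h, that is of v'.

    Lower bound: every F in the space satisfies int_0^q t^c F = 0.  Almost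
    everywhere absolute convergence forces sum |a_k v(q_k)| < oo (a Denjoy-Luzin
    argument), which dominates the series.  Hence the distance from h to F is at
    least the mean H of h for the weight t^c.

    Upper bound: let a_k be the Fourier-Bessel coefficients of h.  By Rayleigh's
    principle, obtained from Jacobi's identity at the nodes of phi_n, the system
    is complete, so sum a_k phi_k = h - H on (0, q].  All a_k v(q_k) are <= 0, and
    evaluating at q gives sum |a_k v(q_k)| = H.  For t >= q, |phi_k(t)| <= |v(q_k)|
    because v^2 + v'^2 decreases, so |h - F| <= H reduces to the inequality
    - a_1 (|v(q)| - v) <= h <= a_1 (|v(q)| + v) on [q, oo) involving only the
    first coefficient.  It follows from a monotone quadratic form in v, v' and t,
    combined with lower bounds for a_1; for large alpha the exponential decay of
    v^2 + v v' + v'^2 is needed as well. *)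

(* The obstacle at the left end is that phi_k(0) = 1 while v(q_k) tends to 0: the numbers |a_k
   v(q_k)| dominate the series only away from 0, or after multiplication by t^(c/2). Hence the
   pointwise statements are made for t > 0 and the integral estimates carry that power of t. No
   asymptotic expansion of Bessel functions enters; sizes and zeros come from the first-order system
   for v and h and from monotone quantities built on it. With nu = alpha + 1, the inequality on [q,
   oo) follows from (c+1)^2 (t^2 - q^2) <= 16 c a_1^2 t^2. For moderate nu the term q^2 is dropped,
   which leaves nu^2 <= 4 c a_1^2. As nu tends to 1/2, c tends to 0 and this fails; the lower bound
   proved for a_1 still meets it at nu = 0.728, that is alpha = -0.272. For large nu the left side
   grows like nu^2 and the right side, with a_1 bounded below by about 3/2, only like nu. The
   condition is then used up to q + 5 only, where t^2 - q^2 is small against t^2; beyond that the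
   damping c/t has already made v and v' small. *)
Require Import Defs.
From mathcomp Require Import all_boot all_order all_algebra.
From mathcomp Require Import all_classical all_reals all_analysis.
From mathcomp Require Import measurable_realfun ess_sup_inf.
From mathcomp Require Import ring lra.
Set Implicit Arguments.
Unset Strict Implicit.
Unset Printing Implicit Defensive.
Import Order.TTheory GRing.Theory Num.Theory.
Import numFieldNormedType.Exports.
Local Open Scope classical_set_scope.
Local Open Scope ring_scope.

(** * Differential calculus for functions written as lambda terms *)

(* Made opaque below: unifying two instances up to conversion would unfold the
   filter structure and diverge. *)
Definition cont (R : realType) (f : R -> R) (x : R) : Prop :=
  {for x, continuous f}.

Section calculus.
Context (R : realType).
Implicit Types (f g : R -> R) (x a b d e p : R).

Lemma der_cst a x : is_derive x 1 (fun _ : R => a) 0.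
Proof. exact: is_derive_cst. Qed.

Lemma der_id x : is_derive x 1 (fun t : R => t) 1.
Proof. exact: is_derive_id. Qed.

Lemma derD f g x d e : is_derive x 1 f d -> is_derive x 1 g e ->
  is_derive x 1 (fun t => f t + g t) (d + e).
Proof. exact: is_deriveD. Qed.

Lemma derN f x d : is_derive x 1 f d -> is_derive x 1 (fun t => - f t) (- d).
Proof. exact: is_deriveN. Qed.

Lemma derM f g x d e : is_derive x 1 f d -> is_derive x 1 g e ->
  is_derive x 1 (fun t => f t * g t) (f x * e + g x * d).
Proof. exact: is_deriveM. Qed.

Lemma derX f n x d : is_derive x 1 f d ->
  is_derive x 1 (fun t => f t ^+ n.+1) ((n.+1%:R * f x ^+ n) * d).
Proof.
move=> h; elim: n => [|n ih]; first by rewrite expr0 mulr1 mul1r.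
under eq_fun do rewrite exprS.
apply: (is_derive_eq (derM h ih)); rewrite -[in RHS]natr1 exprS; ring.
Qed.

Lemma der_comp f g x d e : is_derive (g x) 1 f d -> is_derive x 1 g e ->
  is_derive x 1 (fun t => f (g t)) (d * e).
Proof. by move=> hf hg; have := @is_derive1_comp R f g x d e hf hg. Qed.

Lemma der_scale f r x d : is_derive (r * x) 1 f d ->
  is_derive x 1 (fun t => f (r * t)) (r * d).
Proof.
move=> h; rewrite mulrC; apply: (der_comp (g := fun t => r * t)) => //.
apply: is_derive_eq (derM (der_cst r x) (der_id x)) _; ring.
Qed.

Lemma der_exp f x d : is_derive x 1 f d ->
  is_derive x 1 (fun t => expR (f t)) (expR (f x) * d).
Proof. by move=> h; apply: (der_comp (f := expR)). Qed.

Lemma der_eq f x d e : is_derive x 1 f d -> d = e -> is_derive x 1 f e.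
Proof. by move=> h <-. Qed.

Lemma powR_split p x : 0 < x -> x `^ p = x * x `^ (p - 1).
Proof.
move=> x0; rewrite -[X in X * _](powRr1 (ltW x0)) -powRD; last by rewrite (gt_eqF x0) implybT.
by rewrite addrC subrK.
Qed.

Lemma der_apow p x : 0 < x ->
  is_derive x 1 (fun t : R => `|t| `^ p) (p * x `^ (p - 1)).
Proof.
move=> x0; have := is_derive1_powR p x0; apply: near_eq_is_derive.
near=> t; rewrite ger0_norm//; apply: ltW; near: t; exact: lt_nbhsr.
Unshelve. all: by end_near.
Qed.

Lemma der_cont f x d : is_derive x 1 f d -> cont f x.
Proof.
move=> h; have : derivable f x 1 by [].
by move=> /derivable1_diffP/differentiable_continuous.
Qed.

Lemma apow_cont p x : 0 < p -> cont (fun t : R => `|t| `^ p) x.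
Proof.
move=> p0; have [x0|x0|x0] := ltgtP 0 x; last rewrite -x0.
- exact: der_cont (der_apow p x0).
- have nx : 0 < - x by rewrite oppr_gt0.
  have : cont ((fun t : R => `|t| `^ p) \o -%R) x.
    apply: continuous_comp; first exact: opp_continuous.
    exact: der_cont (der_apow p nx).
  by rewrite (_ : _ \o _ = (fun t : R => `|t| `^ p))//; apply/funext => t /=; rewrite normrN.
- rewrite /cont /prop_for /continuous_at normr0 powR0 ?gt_eqF//.
  apply/cvgrPdist_lt => e e0.
  have := @powR_cvg0 R p p0 => /cvgrPdist_lt /(_ e e0).
  rewrite near_withinE => H; near=> t.
  have H1 : 0 < t -> `|0 - t `^ p| < e by near: t.
  have H2 : 0 < - t -> `|0 - (- t) `^ p| < e.
    near: t; move: H => /nbhs_ballP [d /= d0 H]; apply/nbhs_ballP; exists d => // t /= bt t0.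
    by apply: H => //=; move: bt; rewrite /ball/= !sub0r opprK normrN.
  have [t0|t0|t0] := ltgtP 0 t; last by rewrite -t0 normr0 powR0 ?gt_eqF// subrr normr0.
  + by rewrite (gtr0_norm t0); exact: H1.
  + by rewrite (ltr0_norm t0); apply: H2; rewrite oppr_gt0.
Unshelve. all: by end_near.
Qed.

Lemma cont_within f (A : set R) :
  (forall x, A x -> cont f x) -> {within A, continuous f}.
Proof.
move=> h; apply: continuous_in_subspaceT => x /set_mem; exact: h.
Qed.

Lemma der_mvt f (df : R -> R) a b : a < b ->
  (forall x, a <= x <= b -> cont f x) ->
  (forall x, a < x < b -> is_derive x 1 f (df x)) ->
  exists2 c, a < c < b & f b - f a = df c * (b - a).
Proof.
move=> ab cf fd.
have cf' : {within `[a, b], continuous f}.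
  by apply: cont_within => x /=; rewrite in_itv/=; exact: cf.
have fd' x : x \in `]a, b[%R -> is_derive x 1 f (df x).
  by rewrite in_itv/=; exact: fd.
have [c' c'ab E'] := MVT ab fd' cf'.
by exists c' => //; move: c'ab; rewrite in_itv.
Qed.

Lemma der_mono f (df : R -> R) a b : a <= b ->
  (forall x, a <= x <= b -> cont f x) ->
  (forall x, a < x < b -> is_derive x 1 f (df x)) ->
  (forall x, a < x < b -> 0 <= df x) -> f a <= f b.
Proof.
rewrite le_eqVlt => /predU1P[->//|ab] cf fd d0.
have [c cab E] := der_mvt ab cf fd.
by rewrite -subr_ge0 E mulr_ge0 ?subr_ge0 ?(ltW ab)// d0.
Qed.

Lemma der_smono f (df : R -> R) a b : a < b ->
  (forall x, a <= x <= b -> cont f x) ->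
  (forall x, a < x < b -> is_derive x 1 f (df x)) ->
  (forall x, a < x < b -> 0 < df x) -> f a < f b.
Proof.
move=> ab cf fd d0.
have [c cab E] := der_mvt ab cf fd.
by rewrite -subr_gt0 E mulr_gt0 ?subr_gt0// d0.
Qed.

Lemma cont_ivt f a b : a <= b -> (forall x, a <= x <= b -> cont f x) ->
  f a * f b <= 0 -> exists2 c, a <= c <= b & f c = 0.
Proof.
move=> ab cf fab.
have [||c] := @IVT R f a b 0 ab.
- by apply: cont_within => x /=; rewrite in_itv/=; exact: cf.
- rewrite ge_min le_max; have [fa|fa] := leP (f a) 0; have [fb|fb] := leP (f b) 0 => //=.
  + have : 0 <= f a * f b by rewrite mulr_le0.
    move=> H; have /eqP : f a * f b = 0 by apply/eqP; rewrite eq_le fab H.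
    by rewrite mulf_eq0 => /orP[/eqP ->|/eqP ->]; rewrite lexx ?orbT.
  + by rewrite (ltW fb) orbT.
  + by rewrite (ltW fa).
  + by move: fab; rewrite leNgt mulr_gt0.
by rewrite in_itv/= => ? ?; exists c.
Qed.

Lemma cont_cst a x : cont (fun _ : R => a) x.
Proof. exact: cvg_cst. Qed.

Lemma cont_id x : cont (fun t : R => t) x.
Proof. exact: cvg_id. Qed.

Lemma contD f g x : cont f x -> cont g x ->
  cont (fun t => f t + g t) x.
Proof. exact: cvgD. Qed.

Lemma contN f x : cont f x -> cont (fun t => - f t) x.
Proof. exact: cvgN. Qed.

Lemma contM f g x : cont f x -> cont g x ->
  cont (fun t => f t * g t) x.
Proof. exact: cvgM. Qed.

Lemma contP f x : cont f x -> {for x, continuous f}.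
Proof. by []. Qed.

Lemma eq_cont f g x : cont f x -> (forall t, f t = g t) -> cont g x.
Proof. by move=> + /funext fg; rewrite fg. Qed.

Lemma contX f n x : cont f x -> cont (fun t => f t ^+ n) x.
Proof.
move=> cf; elim: n => [|n ih].
  by apply: eq_cont (@cont_cst 1 x) _ => t; rewrite expr0.
by apply: eq_cont (contM cf ih) _ => t; rewrite exprS.
Qed.

Lemma cont_comp f g x : cont g x -> cont f (g x) ->
  cont (fun t => f (g t)) x.
Proof. exact: continuous_comp. Qed.

Lemma cont_sum (F : nat -> R -> R) n x : (forall k, cont (F k) x) ->
  cont (fun t => \sum_(k < n) F k t) x.
Proof.
move=> cF; elim: n => [|n ih].
  by apply: eq_cont (@cont_cst 0 x) _ => t; rewrite big_ord0.
by apply: eq_cont (contD ih (cF n)) _ => t; rewrite big_ord_recr.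
Qed.

Lemma der_sum (F F' : nat -> R -> R) n x :
  (forall k, is_derive x 1 (F k) (F' k x)) ->
  is_derive x 1 (fun t => \sum_(k < n) F k t) (\sum_(k < n) F' k x).
Proof.
move=> cF; elim: n => [|n ih].
  by under eq_fun do rewrite big_ord0; rewrite big_ord0; exact: der_cst.
by under eq_fun do rewrite big_ord_recr /=; rewrite big_ord_recr /=; exact: derD.
Qed.

Lemma squeeze_seq0 (u w : nat -> R) : (forall n, 0 <= u n <= w n) ->
  w @ \oo --> (0 : R) -> u @ \oo --> (0 : R).
Proof.
move=> uw w0; apply: (squeeze_cvgr _ (cvg_cst (0 : R)) w0).
by apply: nearW => n; exact: uw.
Qed.

End calculus.

Definition RI (R : realType) (a b : R) (f : R -> R) : R :=
  \int[@lebesgue_measure R]_(t in `[a, b]) f t.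

(** Syntax-directed differentiation: [leaf] treats the functions not built by arithmetic, and
    [der_with] leaves the equation between the computed and the stated derivative.
    [notypeclasses refine] prevents instance search from choosing other rules. *)
Ltac der_step leaf :=
  lazymatch goal with
  | |- is_derive _ _ (fun _ => ?a) _ => notypeclasses refine (der_cst a _)
  | |- is_derive _ _ (fun t => t) _ => notypeclasses refine (der_id _)
  | |- is_derive _ _ (fun t => @?f t + @?g t) _ => notypeclasses refine (@derD _ f g _ _ _ _ _)
  | |- is_derive _ _ (fun t => - @?f t) _ => notypeclasses refine (@derN _ f _ _ _)
  | |- is_derive _ _ (fun t => @?f t * @?g t) _ => notypeclasses refine (@derM _ f g _ _ _ _ _)
  | |- is_derive _ _ (fun t => @?f t ^+ _) _ => notypeclasses refine (@derX _ f _ _ _ _)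
  | |- is_derive _ _ _ _ => leaf
  end.
Ltac der_with leaf := notypeclasses refine (der_eq _ _); [repeat der_step leaf|cbv beta].

Ltac cont_step leaf :=
  lazymatch goal with
  | |- cont (fun _ => ?a) _ => exact (@cont_cst _ a _)
  | |- cont (fun t => t) _ => exact (@cont_id _ _)
  | |- cont (fun t => @?f t + @?g t) _ => refine (@contD _ f g _ _ _)
  | |- cont (fun t => - @?f t) _ => refine (@contN _ f _ _)
  | |- cont (fun t => @?f t * @?g t) _ => refine (@contM _ f g _ _ _)
  | |- cont (fun t => @?f t ^+ _) _ => refine (@contX _ f _ _ _)
  | |- cont _ _ => leaf
  end.
Ltac cont_with leaf := repeat cont_step leaf.

(** * Integrals of continuous functions over segments *)

Section segment_integral.
Context (R : realType).
Implicit Types (f g : R -> R) (x a b e : R).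
Local Notation mu := (@lebesgue_measure R).

Lemma cont_integrable a b f : (forall x, a <= x <= b -> cont f x) ->
  mu.-integrable `[a, b] (EFin \o f).
Proof.
move=> cf; apply: continuous_compact_integrable; first exact: segment_compact.
by apply: cont_within => x /=; rewrite in_itv/=; exact: cf.
Qed.

Lemma RID a b f g : (forall x, a <= x <= b -> cont f x) ->
  (forall x, a <= x <= b -> cont g x) ->
  RI a b (fun t => f t + g t) = RI a b f + RI a b g.
Proof. by move=> cf cg; apply: RintegralD => //; exact: cont_integrable. Qed.

Lemma RIZ a b f (k : R) : (forall x, a <= x <= b -> cont f x) ->
  RI a b (fun t => k * f t) = k * RI a b f.
Proof. by move=> cf; apply: RintegralZl => //; exact: cont_integrable. Qed.

Lemma eq_RI a b f g : (forall x, a <= x <= b -> f x = g x) -> RI a b f = RI a b g.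
Proof. by move=> fg; apply: eq_Rintegral => x /set_mem/=; rewrite in_itv/=; exact: fg. Qed.

Lemma RI_sum a b (F : nat -> R -> R) n :
  (forall k (x : R), a <= x <= b -> cont (F k) x) ->
  RI a b (fun t => \sum_(k < n) F k t) = \sum_(k < n) RI a b (F k).
Proof.
move=> cF; elim: n => [|n ih].
  rewrite (@eq_RI a b _ (fun=> 0)); last by move=> x _; rewrite big_ord0.
  by rewrite big_ord0 /RI Rintegral_cst// mul0r.
rewrite big_ord_recr /= -ih -RID//; last exact: cF.
  by apply: eq_RI => x _; rewrite big_ord_recr.
by move=> x xab; apply: cont_sum => k; exact: cF.
Qed.

Lemma RI_ge0 a b f : (forall x, a <= x <= b -> 0 <= f x) -> 0 <= RI a b f.
Proof. by move=> f0; apply: Rintegral_ge0 => x /=; rewrite in_itv/=; exact: f0. Qed.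

Lemma RI_le a b f g : (forall x, a <= x <= b -> cont f x) ->
  (forall x, a <= x <= b -> cont g x) ->
  (forall x, a <= x <= b -> f x <= g x) -> RI a b f <= RI a b g.
Proof.
move=> cf cg fg; apply: le_Rintegral => //; exact: cont_integrable.
Qed.

Lemma RI_FTC a b f (F : R -> R) : a < b ->
  (forall x, a <= x <= b -> cont f x) ->
  (forall x, a <= x <= b -> cont F x) ->
  (forall x, a < x < b -> is_derive x 1 F (f x)) ->
  RI a b f = F b - F a.
Proof.
move=> ab cf cF Ff; rewrite /RI /Rintegral (@continuous_FTC2 _ f F)//.
- by apply: cont_within => x /=; rewrite in_itv/=; exact: cf.
- split.
  + by move=> x; rewrite in_itv/= => xab; have := Ff x xab.
  + by apply: cvg_at_right_filter; apply: cF; rewrite lexx ltW.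
  + by apply: cvg_at_left_filter; apply: cF; rewrite lexx ltW.
- by move=> x; rewrite in_itv/= => xab; rewrite derive1E; have [_ ->] := Ff x xab.
Qed.

Lemma RI_ge_sub a b x1 x2 f e : a <= x1 -> x1 <= x2 -> x2 <= b ->
  (forall x, a <= x <= b -> cont f x) ->
  (forall x, a <= x <= b -> 0 <= f x) ->
  (forall x, x1 <= x <= x2 -> e <= f x) -> e * (x2 - x1) <= RI a b f.
Proof.
move=> ax1 x12 x2b cf f0 ef.
have <- : RI x1 x2 (fun=> e) = e * (x2 - x1).
  by rewrite /RI Rintegral_cst//= lebesgue_measure_itv/= lte_fin; case: ltgtP x12 => //= ->; rewrite ?subrr.
have sub : `[x1, x2] `<=` `[a, b].
  by move=> x /=; rewrite !in_itv/= => /andP[h1 h2]; rewrite (le_trans ax1 h1) (le_trans h2 x2b).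
have cf' x : x1 <= x <= x2 -> cont f x.
  by move=> ?; apply: cf; have := sub x; rewrite /= !in_itv/=; exact.
apply: (@le_trans _ _ (RI x1 x2 f)).
  by apply: RI_le => // x _; exact: cont_cst.
have i1 := cont_integrable cf; have i2 := cont_integrable cf'.
rewrite /RI /Rintegral fine_le ?integrable_fin_num//.
apply: ge0_subset_integral => //.
exact/measurable_int/i1.
Qed.

End segment_integral.

#[global] Opaque cont.

(** * The Gamma function *)

Section euler_gamma_theory.
Context (R : realType).
Implicit Types (x y t : R).
Local Notation mu := (@lebesgue_measure R).

Definition gamma_integrand y t : R := t `^ (y - 1) * expR (- t).

Lemma gamma_integrand_ge0 y t : 0 <= gamma_integrand y t.
Proof. by rewrite mulr_ge0 ?powR_ge0 ?expR_ge0. Qed.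

Lemma der_expN t : is_derive t 1 (fun t => expR (- t)) (- expR (- t)).
Proof. by apply: der_eq (der_exp (derN (der_id t))) _; ring. Qed.

Lemma gamma_integrand_cont y t : 0 < t -> cont (gamma_integrand y) t.
Proof.
move=> t0; apply: contM; last exact: der_cont (der_expN t).
exact: der_cont (is_derive1_powR _ t0).
Qed.

Lemma gamma_integrand_der y t : 0 < t -> is_derive t 1 (gamma_integrand (y + 1)) (y * gamma_integrand y t - gamma_integrand (y + 1) t).
Proof.
move=> t0; apply: der_eq (derM (is_derive1_powR (y + 1 - 1) t0) (der_expN t)) _.
by rewrite /gamma_integrand addrK; ring.
Qed.

(** A compact exhaustion of the open half-line that stays away from 0, where t^(y-1) may be
    singular. On each window the integrand is continuous, so the fundamental theorem applies, and
    monotone convergence passes to the improper integral. *)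
Definition gamma_window n : set R := `[n.+1%:R^-1, n.+1%:R].

Lemma gamma_window_gt0 n t : gamma_window n t -> 0 < t.
Proof. by rewrite /gamma_window/= in_itv/= => /andP[h _]; apply: lt_le_trans h; rewrite invr_gt0. Qed.

Lemma cvg_integral_window (f : R -> R) : (forall t, 0 < t -> cont f t) ->
  (forall t, 0 < t -> 0 <= f t) ->
  (fun n => \int[mu]_(t in gamma_window n) (f t)%:E)%E @ \oo -->
  (\int[mu]_(t in `]0%R, +oo[) (f t)%:E)%E.
Proof.
move=> cf f0.
have mf : measurable_fun (`]0, +oo[%classic : set R) f.
  apply: open_continuous_measurable_fun => // t /set_mem/=; rewrite in_itv/= andbT; exact: cf.
have AnS n : gamma_window n `<=` `]0, +oo[ by move=> t /gamma_window_gt0 t0; rewrite /= in_itv/= t0.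
pose g n := ((EFin \o f) \_ (gamma_window n)).
have -> : (fun n => \int[mu]_(t in gamma_window n) (f t)%:E)%E = (fun n => \int[mu]_(t in `]0%R, +oo[) g n t)%E.
  apply/funext => n; rewrite integral_mkcond [RHS]integral_mkcond; apply: eq_integral => t _.
  rewrite /g /patch; case: (boolP (t \in gamma_window n)) => tA; last by case: ifPn.
  by rewrite (mem_set (AnS n t (set_mem tA))).
have lim_g t : 0 < t -> g n t @[n --> \oo] --> (f t)%:E.
  move=> t0; apply: cvg_near_cst.
  near=> n; rewrite /g /patch mem_set//= /gamma_window/= in_itv/=; apply/andP; split.
    rewrite -[leRHS]invrK lef_pV2 ?posrE ?invr_gt0//.
    have : t^-1 <= n%:R by near: n; exact: nbhs_infty_ger.
    by move/le_trans; apply; rewrite ler_nat.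
  have : t <= n%:R by near: n; exact: nbhs_infty_ger.
  by move/le_trans; apply; rewrite ler_nat.
rewrite [X in _ --> X](_ : _ = \int[mu]_(t in `]0%R, +oo[) limn (g ^~ t))%E; last first.
  apply: eq_integral => t /set_mem/=; rewrite in_itv/= andbT => t0.
  by apply/esym/cvg_lim => //; exact: lim_g.
apply: cvg_monotone_convergence => //.
- move=> n; apply/measurable_restrict => //.
    exact: measurable_itv.
  apply/measurable_EFinP; apply: measurable_funS mf => //; exact: subIsetl.
- move=> n t; rewrite /= in_itv/= andbT => t0; rewrite /g /patch; case: ifPn => // _.
  by rewrite lee_fin f0.
- move=> t; rewrite /= in_itv/= andbT => t0 n m nm; rewrite /g /patch.
  case: ifPn => [/set_mem tn|_].
    rewrite mem_set//; move: tn; rewrite /gamma_window/= !in_itv/= => /andP[h1 h2]; apply/andP; split.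
      by apply: le_trans h1; rewrite lef_pV2 ?posrE// ler_nat.
    by apply: le_trans h2 _; rewrite ler_nat.
  by case: ifPn => // _; rewrite lee_fin f0.
Unshelve. all: by end_near.
Qed.

Definition gamma_integral y : \bar R := (\int[mu]_(t in `]0%R, +oo[) (gamma_integrand y t)%:E)%E.

Lemma gamma_window_fin y n : (\int[mu]_(t in gamma_window n) (gamma_integrand y t)%:E)%E = (RI n.+1%:R^-1 n.+1%:R (gamma_integrand y))%:E.
Proof.
rewrite /RI /Rintegral fineK//; apply: integrable_fin_num => //.
apply: cont_integrable => t tA; apply: gamma_integrand_cont; apply: (@gamma_window_gt0 n).
by rewrite /gamma_window/= in_itv.
Qed.

Lemma gamma_integral_cvg y : (RI n.+1%:R^-1 n.+1%:R (gamma_integrand y))%:E @[n --> \oo] --> gamma_integral y.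
Proof.
under eq_fun do rewrite -gamma_window_fin.
by apply: cvg_integral_window => t t0; [exact: gamma_integrand_cont|exact: gamma_integrand_ge0].
Qed.

(** From ln x <= x - 1 at x = t / (2y), the left side being largest at t = 2y; a factor e^(-y) is
    given away. *)
Lemma powR_exp_bound y t : 0 < y -> 0 < t -> t `^ y * expR (- (t / 2)) <= expR (y * ln (2 * y)).
Proof.
move=> y0 t0; rewrite /powR gt_eqF// -expRD ler_expR.
have y20 : 0 < 2 * y by rewrite mulr_gt0.
have : ln (t / (2 * y)) <= t / (2 * y) - 1.
  have := @le_ln1Dx R (t / (2 * y) - 1); rewrite addrCA subrr addr0; apply.
  by rewrite ltrBDr addrC subrr divr_gt0.
rewrite ln_div ?posrE// => h.
have : y * (ln t - ln (2 * y)) <= y * (t / (2 * y) - 1) by rewrite ler_pM2l.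
have -> : y * (t / (2 * y) - 1) = t / 2 - y by field; rewrite gt_eqF.
lra.
Qed.

Lemma gamma_integral_finite y : 0 < y -> (gamma_integral y < +oo)%E.
Proof.
move=> y0; set M := expR (y * ln (2 * y)).
have M0 : 0 < M by exact: expR_gt0.
(* A bounded function whose derivative dominates the integrand: it equals the integrand plus (M
   e^(-t/2) - t^y e^(-t)) / y, which is nonnegative by [powR_exp_bound]. *)
pose B t := y^-1 * gamma_integrand (y + 1) t - (2 * M / y) * expR (- (t / 2)).
have Bd t : 0 < t -> is_derive t 1 B
    (y^-1 * (y * gamma_integrand y t - gamma_integrand (y + 1) t) + (M / y) * expR (- (t / 2))).
  move=> t0; apply: der_eq (derD (derM (der_cst y^-1 t) (gamma_integrand_der y t0))
    (derN (derM (der_cst (2 * M / y) t) (der_exp (derN (derM (der_id t) (der_cst 2^-1 t))))))) _.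
  by field; rewrite gt_eqF.
have g1 t : 0 < t -> gamma_integrand (y + 1) t <= M * expR (- (t / 2)).
  move=> t0; rewrite /gamma_integrand addrK.
  have -> : expR (- t) = expR (- (t / 2)) * expR (- (t / 2)).
    by rewrite -expRD; congr expR; field.
  by rewrite mulrA ler_wpM2r ?expR_ge0// powR_exp_bound.
have e1 t : 0 < t -> expR (- (t / 2)) <= 1.
  by move=> t0; rewrite -[leRHS]expR0 ler_expR oppr_le0 divr_ge0// ltW.
have B1 t : 0 < t -> B t <= M / y.
  move=> t0; rewrite /B lerBlDr; apply: (@le_trans _ _ (y^-1 * M)).
    rewrite ler_pM2l ?invr_gt0//; apply: le_trans (g1 t t0) _.
    by rewrite ler_piMr ?(ltW M0) ?e1.
  by rewrite mulrC lerDl !mulr_ge0 ?expR_ge0 ?invr_ge0 ?(ltW y0) ?(ltW M0).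
have B2 t : 0 < t -> - (2 * M / y) <= B t.
  move=> t0; rewrite /B -[leLHS]add0r; apply: lerD.
    by apply: mulr_ge0; [rewrite invr_ge0 ltW|exact: gamma_integrand_ge0].
  rewrite lerN2 ler_piMr ?e1//; apply: divr_ge0; last exact: ltW.
  by apply: mulr_ge0; last exact: ltW.
have bnd n : RI n.+1%:R^-1 n.+1%:R (gamma_integrand y) <= M / y + 2 * M / y.
  have pos t : n.+1%:R^-1 <= t <= n.+1%:R -> 0 < t.
    by move=> tA; apply: (@gamma_window_gt0 n); rewrite /gamma_window/= in_itv.
  (* The window of index 0 is the single point 1, to which [RI_FTC] does not apply. *)
  have [->|n0] := eqVneq n 0%N.
    rewrite invr1 (_ : RI 1 1 _ = 0); last by rewrite /RI set_itv1 Rintegral_set1.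
    by rewrite addr_ge0// !mulr_ge0 ?invr_ge0 ?(ltW y0) ?(ltW M0).
  have lt : (n.+1%:R^-1 : R) < n.+1%:R.
    by apply: (@lt_trans _ _ 1); rewrite ?invf_lt1 ?ltr1n ?ltnS ?lt0n.
  pose b t := y^-1 * (y * gamma_integrand y t - gamma_integrand (y + 1) t) + (M / y) * expR (- (t / 2)).
  have cb t : n.+1%:R^-1 <= t <= n.+1%:R -> cont b t.
    move=> /pos t0; apply: contD; apply: contM; try exact: cont_cst.
      apply: contD; last exact/contN/gamma_integrand_cont.
      by apply: contM; [exact: cont_cst|exact: gamma_integrand_cont].
    exact: der_cont (der_exp (derN (derM (der_id t) (der_cst 2^-1 t)))).
  apply: (@le_trans _ _ (RI n.+1%:R^-1 n.+1%:R b)).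
    apply: RI_le => // t /pos t0; first exact: gamma_integrand_cont.
    rewrite /b mulrBr mulKf ?gt_eqF//; rewrite -addrA lerDl addrC subr_ge0.
    by rewrite (mulrC M) -mulrA ler_pM2l ?invr_gt0// g1.
  have cB t : n.+1%:R^-1 <= t <= n.+1%:R -> cont B t.
    by move=> /pos t0; exact: der_cont (Bd t t0).
  have dB t : n.+1%:R^-1 < t < n.+1%:R -> is_derive t 1 B (b t).
    by move=> /andP[h1 h2]; apply: Bd; apply: pos; rewrite !ltW.
  rewrite (RI_FTC lt cb cB dB).
  have h1 : B n.+1%:R <= M / y by exact: B1.
  have h2 : - (2 * M / y) <= B n.+1%:R^-1 by apply: B2; rewrite invr_gt0.
  by lra.
apply: (@le_lt_trans _ _ (M / y + 2 * M / y)%:E); last exact: ltry.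
have cE := @gamma_integral_cvg y; rewrite -(cvg_lim _ cE)//.
apply: lime_le; first by apply/cvg_ex; exists (gamma_integral y).
by apply: nearW => n; rewrite lee_fin.
Qed.

Lemma EG_fine y : 0 < y -> gamma_integral y = (euler_gamma y)%:E.
Proof.
move=> y0; rewrite /euler_gamma /Rintegral -/(gamma_integral y) fineK// ge0_fin_numE.
  exact: gamma_integral_finite.
by apply: integral_ge0 => t _; rewrite lee_fin gamma_integrand_ge0.
Qed.

Lemma RI_cvg_gamma y : 0 < y ->
  RI n.+1%:R^-1 n.+1%:R (gamma_integrand y) @[n --> \oo] --> euler_gamma y.
Proof.
move=> y0; have := @gamma_integral_cvg y; rewrite EG_fine// => h.
exact/(fine_cvg h).
Qed.

Lemma euler_gammaS y : 0 < y -> euler_gamma (y + 1) = y * euler_gamma y.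
Proof.
move=> y0; have y1 : 0 < y + 1 by rewrite addr_gt0.
have c1 := RI_cvg_gamma y1; have c2 := RI_cvg_gamma y0.
set M := expR (y * ln (2 * y)).
have c3 : gamma_integrand (y + 1) n.+1%:R @[n --> \oo] --> (0 : R).
  apply: (@squeeze_seq0 _ _ (fun n => M * expR (- (n.+1%:R / 2)))).
  - move=> n; rewrite gamma_integrand_ge0/= /gamma_integrand addrK.
    have -> : expR (- n.+1%:R : R) = expR (- (n.+1%:R / 2)) * expR (- (n.+1%:R / 2)).
      by rewrite -expRD; congr expR; field.
    by rewrite mulrA ler_wpM2r ?expR_ge0// powR_exp_bound.
  - rewrite -[X in _ --> X](mulr0 M); apply: cvgMr.
    have : (fun n : nat => n.+1%:R / 2 : R) @ \oo --> +oo.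
      apply/cvgryPge => A; near=> n.
      have : 2 * A <= n%:R by near: n; exact: nbhs_infty_ger.
      have : (n%:R + 1 : R) = n.+1%:R by rewrite natr1.
      lra.
    move=> h; exact: (cvg_comp _ _ h (@cvgr_expR R)).
have c4 : gamma_integrand (y + 1) n.+1%:R^-1 @[n --> \oo] --> (0 : R).
  apply: (@squeeze_seq0 _ _ (fun n => n.+1%:R^-1 `^ y)).
  - move=> n; rewrite gamma_integrand_ge0/= /gamma_integrand addrK ler_piMr ?powR_ge0//.
  - have h : (fun n : nat => n.+1%:R^-1 : R) @ \oo --> (0:R)^'+.
      move=> A; rewrite /at_right /within/= => hA.
      have := @cvg_harmonic R; rewrite /harmonic => /(_ _ hA) H.
      have {}H : \forall n \near \oo, 0 < (n.+1%:R^-1 : R) -> A (n.+1%:R^-1) by exact: H.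
      suff : \forall n \near \oo, A (n.+1%:R^-1) by [].
      by apply: filterS H => n; apply; rewrite invr_gt0.
    exact: (cvg_comp _ _ h (powR_cvg0 y0)).
(* Integration by parts on the windows from index 1 on, which are nondegenerate; the boundary terms
   vanish by [c3] and [c4]. *)
have id n : RI n.+2%:R^-1 n.+2%:R (gamma_integrand (y + 1)) = y * RI n.+2%:R^-1 n.+2%:R (gamma_integrand y)
    - (gamma_integrand (y + 1) n.+2%:R - gamma_integrand (y + 1) n.+2%:R^-1).
  have pos t : n.+2%:R^-1 <= t <= n.+2%:R -> 0 < t.
    by move=> tA; apply: (@gamma_window_gt0 n.+1); rewrite /gamma_window/= in_itv.
  have lt : (n.+2%:R^-1 : R) < n.+2%:R.
    by apply: (@lt_trans _ _ 1); rewrite ?invf_lt1 ?ltr1n.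
  have cb t : n.+2%:R^-1 <= t <= n.+2%:R -> cont (fun t => y * gamma_integrand y t - gamma_integrand (y + 1) t) t.
    move=> /pos t0; apply: contD; last exact/contN/gamma_integrand_cont.
    by apply: contM; [exact: cont_cst|exact: gamma_integrand_cont].
  have cB t : n.+2%:R^-1 <= t <= n.+2%:R -> cont (gamma_integrand (y + 1)) t.
    by move=> /pos t0; exact: gamma_integrand_cont.
  have dB t : n.+2%:R^-1 < t < n.+2%:R ->
      is_derive t 1 (gamma_integrand (y + 1)) (y * gamma_integrand y t - gamma_integrand (y + 1) t).
    by move=> /andP[h1 h2]; apply: gamma_integrand_der; apply: pos; rewrite !ltW.
  rewrite -(RI_FTC lt cb cB dB).
  rewrite RID; first last.
  - by move=> t /pos t0; apply/contN/gamma_integrand_cont.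
  - by move=> t /pos t0; apply: contM; [exact: cont_cst|exact: gamma_integrand_cont].
  rewrite RIZ; last by move=> t /pos t0; exact: gamma_integrand_cont.
  rewrite (@eq_RI _ _ _ (fun t => - gamma_integrand (y + 1) t) (fun t => -1 * gamma_integrand (y + 1) t)); last first.
    by move=> t _; rewrite mulN1r.
  by rewrite RIZ; [ring|move=> t /pos t0; exact: gamma_integrand_cont].
have sh (u : nat -> R) (l : R) : u @ \oo --> l -> (fun n => u n.+1) @ \oo --> l.
  by move=> h; rewrite -(cvg_shiftS u) in h.
have := sh _ _ c1; rewrite (funext id) => c1'.
have c5 : y * RI n.+2%:R^-1 n.+2%:R (gamma_integrand y) - (gamma_integrand (y + 1) n.+2%:R - gamma_integrand (y + 1) n.+2%:R^-1) @[n --> \oo] -->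
    y * euler_gamma y - (0 - 0).
  apply: cvgB; last by apply: cvgB; [exact: sh _ _ c3|exact: sh _ _ c4].
  by apply: cvgMr; exact: sh _ _ c2.
have := cvg_unique _ c1' c5; rewrite !subr0; exact.
Unshelve. all: by end_near.
Qed.

Lemma euler_gamma_gt0 y : 0 < y -> 0 < euler_gamma y.
Proof.
(* A lower bound for the integrand on [1, 2]: there 0 <= ln t <= 1, so t^(y-1) >= e^(-|y-1|), and
   e^(-t) >= e^(-2). *)
move=> y0; set e := expR (- `|y - 1|) * expR (- 2).
have e0 : 0 < e by rewrite mulr_gt0 ?expR_gt0.
apply: (lt_le_trans e0).
apply: (cvgr_to_ge (RI_cvg_gamma y0)).
near=> n; have n1 : (0 < n)%N by near: n; exact: nbhs_infty_gt.
have pos t : n.+1%:R^-1 <= t <= n.+1%:R -> 0 < t.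
  by move=> tA; apply: (@gamma_window_gt0 n); rewrite /gamma_window/= in_itv.
have -> : e = e * (2 - 1) by ring.
apply: RI_ge_sub.
- by rewrite invf_le1 ?ler1n.
- by rewrite ler1n.
- by rewrite ler_nat ltnS.
- by move=> t /pos; exact: gamma_integrand_cont.
- by move=> t _; exact: gamma_integrand_ge0.
move=> t /andP[t1 t2]; have t0 : 0 < t by exact: lt_le_trans t1.
rewrite /gamma_integrand ler_pM ?expR_ge0// ?ler_expR ?lerN2//.
rewrite /powR gt_eqF// ler_expR.
have l0 : 0 <= ln t by rewrite ln_ge0.
have l1 : ln t <= 1.
  by have := @le_ln1Dx R (t - 1); rewrite addrCA subrr addr0; lra.
apply: (@le_trans _ _ (- (`|y - 1| * ln t))).
  by rewrite lerN2 ler_piMr.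
by rewrite lerNl -mulNr ler_wpM2r// -normrN ler_norm.
Unshelve. all: by end_near.
Qed.

End euler_gamma_theory.

(** * Power series and normalized Bessel functions *)

Section fact_dominated_series.
Context (R : realType).
Implicit Types (c : nat -> R) (x : R).

(** Stable under [pseries_diffs], because the factor k + 1 cancels against the factorial, and
    sufficient for convergence everywhere by comparison with exp. Termwise differentiation thus
    never meets a radius of convergence. *)
Definition fact_dominated c := exists M : R, forall k, `|c k| <= M / k`!%:R.

Definition psum c x : R := limn (pseries c x).

Lemma fact_dominated_cvg c x : fact_dominated c -> cvgn (pseries c x).
Proof.
move=> [M cM]; apply: normed_cvg.
have M0 : 0 <= M by have := le_trans (normr_ge0 _) (cM 0); rewrite fact0 divr1.
apply: (@series_le_cvg _ _ (fun n => M * exp_coeff `|x| n)).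
- by move=> n /=.
- by move=> n; rewrite mulr_ge0// exp_coeff_ge0.
- by move=> n; rewrite /exp_coeff /= normrM normrX mulrCA mulrC ler_pM// ?mulr_ge0// cM.
- have -> : (fun n => M * exp_coeff `|x| n) = M *: exp_coeff `|x| by [].
  exact/is_cvg_seriesZ/is_cvg_series_exp_coeff.
Qed.

Lemma fact_dominated_diffs c : fact_dominated c -> fact_dominated (pseries_diffs c).
Proof.
move=> [M cM]; exists M => k; rewrite /pseries_diffs normrM ger0_norm//.
apply: le_trans (ler_wpM2l _ (cM k.+1)) _ => //.
rewrite factS natrM le_eqVlt; apply/orP; left; apply/eqP.
have k1 : (k.+1%:R : R) != 0 by rewrite pnatr_eq0.
by rewrite invfM mulrCA (mulrA k.+1%:R) divff// mul1r.
Qed.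

Lemma psum_der c x : fact_dominated c ->
  is_derive x 1 (psum c) (psum (pseries_diffs c) x).
Proof.
move=> h; apply: (@pseries_snd_diffs _ _ (`|x| + 1)).
- exact: fact_dominated_cvg.
- exact/fact_dominated_cvg/fact_dominated_diffs.
- exact/fact_dominated_cvg/fact_dominated_diffs/fact_dominated_diffs.
- by rewrite [ltRHS]ger0_norm ?addr_ge0// ltrDl.
Qed.

Lemma psumZ a c x : fact_dominated c -> psum (fun k => a * c k) x = a * psum c x.
Proof.
move=> h; rewrite /psum /pseries.
rewrite (_ : (fun i => a * c i * x ^+ i) = a *: (fun i => c i * x ^+ i)); last first.
  by apply/funext => i; rewrite -mulrA.
by rewrite lim_seriesZ//; exact: fact_dominated_cvg.
Qed.

Lemma psum0 c : psum c 0 = c 0%N.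
Proof.
apply: cvg_lim => //; rewrite -(cvg_shiftS (pseries c 0)).
rewrite (_ : (fun n => pseries c 0 n.+1) = fun=> c 0%N); first exact: cvg_cst.
apply/funext => n; rewrite /pseries /series /= big_nat_recl// expr0 mulr1.
by rewrite big1 ?addr0// => i _; rewrite expr0n mulr0.
Qed.

(** The Euler operator x d/dx + a multiplies the coefficient of x^k by k + a. It yields both the
    contiguity relation and the antiderivative behind the hypergeometric value. *)
Lemma psum_euler c c' a x : fact_dominated c ->
  (forall k, (k%:R + a) * c k = c' k) ->
  psum c' x = x * psum (pseries_diffs c) x + a * psum c x.
Proof.
move=> h E; apply: cvg_lim => //.
have hc := @fact_dominated_cvg c x h.
have hd := @fact_dominated_cvg _ x (fact_dominated_diffs h).
rewrite (_ : pseries c' x = (fun n =>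
   x * series (fun i => i%:R * c i * x ^+ i.-1) n + a * pseries c x n)); last first.
  apply/funext => n; rewrite /pseries /series /= !mulr_sumr -big_split /=.
  apply: eq_bigr => -[|k] _; rewrite -E; first by rewrite expr0; ring.
  by rewrite /= exprS; ring.
apply: cvgD; apply: cvgMr; last exact: hc.
exact: (pseries_diffs_equiv hd).
Qed.

End fact_dominated_series.

(** * The entire series of j_alpha, its derivative and its contiguity relation *)

Section bessel_series.
Context (R : realType).
Implicit Types (a s z : R).

Definition bcoef a (k : nat) : R := (-1) ^+ k / (k`!%:R * pochhammer (a + 1) k).

(* Power series form of [bessel_j a z], entire in [z]; [bessel_jE] relates the two. *)
Definition bj a z : R := psum (bcoef a) (z ^+ 2 / 4).

Lemma pochhammerS a k : pochhammer a k.+1 = a * pochhammer (a + 1) k.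
Proof.
rewrite /pochhammer big_ord_recl /= addr0; congr (_ * _); apply: eq_bigr => i _.
by rewrite /bump /= natrD; ring.
Qed.

Lemma pochhammer_recr a k : pochhammer a k.+1 = pochhammer a k * (a + k%:R).
Proof. by rewrite /pochhammer big_ord_recr. Qed.

Lemma pochhammer_gt0 a k : 0 < a -> 0 < pochhammer a k.
Proof. by move=> a0; apply: prodr_gt0 => i _; rewrite ltr_wpDr. Qed.

(** Only the first factor can be below 1. *)
Lemma pochhammer_ge a k : 0 < a -> Num.min 1 a <= pochhammer a k.
Proof.
move=> a0; elim: k => [|k ih]; first by rewrite /pochhammer big_ord0 ge_min lexx.
rewrite pochhammerS; have : 1 <= pochhammer (a + 1) k.
  by rewrite /pochhammer; elim/big_ind : _ => // [x y x1 y1|i _]; [rewrite -[1]mulr1 ler_pM|rewrite -addrA addrC -addrA lerDl addr_ge0 // ltW].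
by move=> h; rewrite ge_min ler_peMr ?(ltW a0)// orbT.
Qed.

Lemma bcoef_dom a : -1 < a -> fact_dominated (bcoef a).
Proof.
move=> a1; have a0 : 0 < a + 1 by lra.
have m0 : 0 < Num.min 1 (a + 1) by rewrite lt_min ltr01.
exists (Num.min 1 (a + 1))^-1 => k; rewrite /bcoef normrM normrX normrN1 expr1n mul1r.
rewrite ger0_norm ?invr_ge0 ?mulr_ge0 ?(ltW (pochhammer_gt0 _ _))//.
by rewrite invfM mulrC ler_pM2r ?invr_gt0 ?ltr0n ?fact_gt0// lef_pV2 ?posrE ?pochhammer_gt0// pochhammer_ge.
Qed.

Lemma bcoef_diffs a k : -1 < a -> pseries_diffs (bcoef a) k = - (a + 1)^-1 * bcoef (a + 1) k.
Proof.
move=> a1; have a0 : 0 < a + 1 by lra.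
have p0 : pochhammer (a + 1 + 1) k != 0 by rewrite gt_eqF// pochhammer_gt0//; lra.
rewrite /pseries_diffs /bcoef pochhammerS factS natrM exprS.
have k0 : (k`!%:R : R) != 0 by rewrite pnatr_eq0 -lt0n fact_gt0.
by field; rewrite k0 p0 gt_eqF//= pnatr_eq0.
Qed.

Lemma bj0 a : bj a 0 = 1.
Proof.
by rewrite /bj expr0n mul0r psum0 /bcoef expr0 fact0 /pochhammer big_ord0 mulr1 divr1.
Qed.

Lemma psum_bcoef_der a s : -1 < a ->
  psum (pseries_diffs (bcoef a)) s = - (a + 1)^-1 * psum (bcoef (a + 1)) s.
Proof.
move=> a1; rewrite -psumZ; last by apply: bcoef_dom; lra.
by rewrite (_ : pseries_diffs _ = fun k => - (a + 1)^-1 * bcoef (a + 1) k)//; apply/funext => k; rewrite bcoef_diffs.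
Qed.

Lemma der_sqr4 z : is_derive z 1 (fun z => z ^+ 2 / 4) (z / 2).
Proof.
apply: der_eq (derM (derX 1 (der_id z)) (der_cst 4^-1 z)) _.
by rewrite expr1; field.
Qed.

Lemma bj_der a z : -1 < a ->
  is_derive z 1 (bj a) (- (z / (2 * (a + 1))) * bj (a + 1) z).
Proof.
move=> a1; have h := psum_der (z ^+ 2 / 4) (bcoef_dom a1).
apply: der_eq (@der_comp _ _ (fun z => z ^+ 2 / 4) z _ _ h (der_sqr4 z)) _.
by rewrite psum_bcoef_der// /bj; field; rewrite gt_eqF//; lra.
Qed.

(** The recurrence J_a + J_(a+2) = (2 (a+1) / z) J_(a+1) in the normalization j. On coefficients, x
    d/dx + (a + 1) sends the series of j_(a+1) to a + 1 times that of j_a. *)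
Lemma bj_contig a z : -1 < a ->
  (a + 1) * (bj a z - bj (a + 1) z) = - (z ^+ 2 / (4 * (a + 2))) * bj (a + 2) z.
Proof.
move=> a1; have a0 : a + 1 != 0 by rewrite gt_eqF//; lra.
rewrite /bj mulrBr -psumZ; last exact: bcoef_dom.
have a11 : -1 < a + 1 by lra.
rewrite (psum_euler (z ^+ 2 / 4) (bcoef_dom a11) (a := a + 1)).
  rewrite psum_bcoef_der// (_ : a + 1 + 1 = a + 2); last by ring.
  by field; rewrite gt_eqF//; lra.
move=> k; rewrite /bcoef.
have k0 : (k`!%:R : R) != 0 by rewrite pnatr_eq0 -lt0n fact_gt0.
have p0 : pochhammer (a + 1 + 1) k != 0 by rewrite gt_eqF// pochhammer_gt0//; lra.
have p1 : pochhammer (a + 1) k != 0 by rewrite gt_eqF// pochhammer_gt0//; lra.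
have E : pochhammer (a + 1) k * (a + 1 + k%:R) = (a + 1) * pochhammer (a + 1 + 1) k.
  by rewrite -pochhammer_recr pochhammerS.
apply: (@mulfI _ (k`!%:R * pochhammer (a + 1) k * pochhammer (a + 1 + 1) k)).
  by rewrite !mulf_neq0.
transitivity ((-1) ^+ k * (pochhammer (a + 1) k * (a + 1 + k%:R))).
  by field; rewrite k0 p0.
by rewrite E; field; rewrite k0 p1.
Qed.

Lemma euler_gamma_pochhammer a k : 0 < a ->
  euler_gamma (k%:R + a) = pochhammer a k * euler_gamma a.
Proof.
move=> a0; elim: k => [|k ih]; first by rewrite add0r /pochhammer big_ord0 mul1r.
have h : 0 < k%:R + a by rewrite ltr_wpDl.
have -> : k.+1%:R + a = (k%:R + a) + 1 by rewrite -natr1 addrAC.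
rewrite (euler_gammaS h) ih pochhammer_recr.
by move: (euler_gamma a) (pochhammer a k) => g p; ring.
Qed.

Lemma bessel_jE a z : -1 < a -> 0 <= z -> bessel_j a z = bj a z.
Proof.
move=> a1; rewrite le_eqVlt => /predU1P[<-|z0]; first by rewrite bj0 /bessel_j eqxx.
have a0 : 0 < a + 1 by lra.
have g0 : euler_gamma (a + 1) != 0 by rewrite gt_eqF// euler_gamma_gt0.
have z20 : 0 < z / 2 by rewrite divr_gt0.
rewrite /bessel_j gt_eqF// /bessel_J.
have -> : (fun k : nat => (-1) ^+ k / (k`!%:R * euler_gamma (k%:R + a + 1)) *
   (z / 2) `^ (2 * k%:R + a)) =
   (fun k => ((z / 2) `^ a / euler_gamma (a + 1)) * bcoef a k * (z ^+ 2 / 4) ^+ k).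
  apply/funext => k; rewrite -addrA euler_gamma_pochhammer// /bcoef.
  rewrite powRD; last by rewrite (gt_eqF z20) implybT.
  rewrite -(natrM _ 2 k) powR_mulrn ?(ltW z20)// exprM.
  have -> : (z / 2) ^+ 2 = z ^+ 2 / 4 by field.
  have k0 : (k`!%:R : R) != 0 by rewrite pnatr_eq0 -lt0n fact_gt0.
  have p0 : pochhammer (a + 1) k != 0 by rewrite gt_eqF// pochhammer_gt0.
  by field; rewrite k0 p0 g0.
rewrite -/(pseries _ _) -/(psum _ _) psumZ; last exact: bcoef_dom.
rewrite -/(bj a z).
have -> : 2 `^ a * euler_gamma (a + 1) * ((z / 2) `^ a / euler_gamma (a + 1) * bj a z) / z `^ a =
  (2 `^ a * (z / 2) `^ a) / z `^ a * bj a z.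
  by field; rewrite g0 gt_eqF// powR_gt0.
rewrite -powRM ?(ltW z20)// mulrC (_ : 2 * (z / 2) = z); last by field.
by rewrite divff ?mulr1// gt_eqF// powR_gt0.
Qed.

End bessel_series.

#[global] Opaque bj.

(** * The pair v = j_alpha, h = j_(alpha+1) and the zeros of h *)

(* Throughout, c = 2 alpha + 1, so that v' = - t h / (c + 1) and
   t h' = (c + 1) (v - h). *)
Section bessel_pair.
Context (R : realType) (al : R).
Hypothesis c_gt0 : 0 < 2 * al + 1.
Local Notation c := (2 * al + 1).
Local Notation v := (bj al).
Local Notation h := (bj (al + 1)).
Implicit Types (a b t x : R).

Let al1 : -1 < al. Proof. by move: c_gt0; lra. Qed.
Let c1_gt0 : 0 < c + 1. Proof. by rewrite addr_gt0. Qed.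
Let c1_neq0 : c + 1 != 0. Proof. by rewrite gt_eqF. Qed.

Lemma der_v t : is_derive t 1 v (- (t * h t / (c + 1))).
Proof.
apply: der_eq (bj_der t al1) _; rewrite (_ : 2 * (al + 1) = c + 1); last by ring.
by field.
Qed.

Lemma der_h t : 0 < t -> is_derive t 1 h ((c + 1) * (v t - h t) / t).
Proof.
move=> t0; have a1 : -1 < al + 1 by move: al1; lra.
apply: der_eq (bj_der t a1) _.
have := bj_contig t al1; have -> : al + 1 + 1 = al + 2 by ring.
move=> E; have -> : (c + 1) * (v t - h t) / t = 2 / t * ((al + 1) * (v t - h t)).
  by field; rewrite gt_eqF.
by rewrite E; field; rewrite gt_eqF//=; move: al1; lra.
Qed.

Lemma cont_v t : cont v t.
Proof. exact: der_cont (der_v t). Qed.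

Lemma cont_h t : cont h t.
Proof.
by have a1 : -1 < al + 1 by [move: al1; lra]; exact: der_cont (bj_der t a1).
Qed.

(* v^2 + v'^2 *)
Definition energy t := v t ^+ 2 + (t * h t / (c + 1)) ^+ 2.

Lemma der_energy t : 0 < t ->
  is_derive t 1 energy (- (2 * c * t * h t ^+ 2 / (c + 1) ^+ 2)).
Proof.
move=> t0; rewrite /energy; der_with ltac:(idtac; lazymatch goal with |- is_derive _ _ (fun t => bj (_ + 1) t) _ => exact (der_h t0) | _ => exact (@der_v _) end).
by rewrite expr1; field; rewrite c1_neq0 gt_eqF.
Qed.

Lemma cont_energy t : cont energy t.
Proof. by rewrite /energy; cont_with ltac:(idtac; lazymatch goal with |- cont (fun t => bj (_ + 1) t) _ => exact (@cont_h _) | _ => exact (@cont_v _) end). Qed.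

Lemma energy_noninc a b : 0 <= a -> a <= b -> energy b <= energy a.
Proof.
move=> a0 ab; rewrite -lerN2.
apply: (@der_mono R (fun t => - energy t) (fun t => 2 * c * t * h t ^+ 2 / (c + 1) ^+ 2)) => //.
- by move=> t _; apply: contN; exact: cont_energy.
- move=> t /andP[at_ _]; rewrite -[X in is_derive _ _ _ X]opprK.
  by apply: derN; apply: der_energy; exact: le_lt_trans at_.
- move=> t /andP[at_ _]; have t0 : 0 < t by exact: le_lt_trans at_.
  by rewrite divr_ge0 ?exprn_ge0 ?(ltW c1_gt0)// mulr_ge0 ?sqr_ge0// mulr_ge0 ?(ltW t0)// mulr_ge0// ltW.
Qed.

Lemma sqr_v_le_energy t : v t ^+ 2 <= energy t.
Proof. by rewrite lerDl sqr_ge0. Qed.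

Lemma sqr_dv_le_energy t : (t * h t / (c + 1)) ^+ 2 <= energy t.
Proof. by rewrite lerDr sqr_ge0. Qed.

(** Replaces uniqueness for the linear system, which is singular at 0: t^(2c) times the energy has
    derivative 2 c t^(2c-1) v^2, hence is nondecreasing, and it is positive near 0 because v(0) =
    1. *)
Lemma energy_gt0 t : 0 <= t -> 0 < energy t.
Proof.
rewrite le_eqVlt => /predU1P[<-|x0].
  by apply: lt_le_trans (sqr_v_le_energy _); rewrite bj0 expr1n.
have : \forall s \near (0:R), 0 < v s.
  by have := contP (@cont_v 0); rewrite /prop_for /continuous_at bj0 => /cvgr_gt; apply.
move=> /nbhs_ballP[d /= d0 hd].
pose s := Num.min d t / 2.
have m0 : 0 < Num.min d t by rewrite lt_min d0.
have s0 : 0 < s by rewrite divr_gt0.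
have sd : s < d by have : Num.min d t <= d by [rewrite ge_min lexx]; rewrite /s; lra.
have st : s <= t by have : Num.min d t <= t by [rewrite ge_min lexx orbT]; rewrite /s; lra.
have vs : 0 < v s by apply: hd; rewrite /ball/= sub0r normrN gtr0_norm.
have es : 0 < energy s by apply: lt_le_trans (sqr_v_le_energy _); rewrite exprn_gt0.
have pw r : 0 < r -> r `^ (2 * c) = r * r `^ (2 * c - 1).
  exact: powR_split.
have : `|s| `^ (2 * c) * energy s <= `|t| `^ (2 * c) * energy t.
  apply: (@der_mono R (fun t => `|t| `^ (2 * c) * energy t)
     (fun t => 2 * c * t `^ (2 * c - 1) * v t ^+ 2)) => //.
  - move=> x _; apply: contM; last exact: cont_energy.
    by apply: apow_cont; rewrite mulr_gt0.
  - move=> x /andP[sx _]; have x0' : 0 < x by exact: lt_trans sx.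
    apply: der_eq (derM (der_apow _ x0') (der_energy x0')) _.
    by rewrite gtr0_norm// pw// /energy; field; rewrite c1_neq0.
  - by move=> x _; rewrite mulr_ge0 ?sqr_ge0// mulr_ge0 ?powR_ge0// mulr_ge0 ?ltW.
rewrite !gtr0_norm// => le1.
have : 0 < t `^ (2 * c) * energy t by apply: lt_le_trans le1; rewrite mulr_gt0// powR_gt0.
by rewrite pmulr_rgt0// powR_gt0.
Qed.

Lemma v_neq0_at_zero a : 0 < a -> h a = 0 -> v a != 0.
Proof.
move=> a0 ha; have := energy_gt0 (ltW a0).
by rewrite /energy ha mulr0 mul0r expr0n/= addr0 exprn_even_gt0.
Qed.

Lemma energy_at_zero a : h a = 0 -> energy a = v a ^+ 2.
Proof. by move=> ha; rewrite /energy ha mulr0 mul0r expr0n/= addr0. Qed.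

Lemma v_le_after_zero a t : 0 <= a -> h a = 0 -> a <= t -> `|v t| <= `|v a|.
Proof.
move=> a0 ha at_; rewrite -ler_sqr ?nnegrE// !real_normK ?num_real//.
by rewrite -(energy_at_zero ha); apply: le_trans (sqr_v_le_energy _) (energy_noninc a0 at_).
Qed.

Lemma dv_le_after_zero a t : 0 <= a -> h a = 0 -> a <= t ->
  `|t * h t / (c + 1)| <= `|v a|.
Proof.
move=> a0 ha at_; rewrite -ler_sqr ?nnegrE// !real_normK ?num_real//.
by rewrite -(energy_at_zero ha); apply: le_trans (sqr_dv_le_energy _) (energy_noninc a0 at_).
Qed.

Lemma v_le1 t : 0 <= t -> `|v t| <= 1.
Proof.
move=> t0; rewrite -ler_sqr ?nnegrE// !real_normK ?num_real//.
apply: le_trans (sqr_v_le_energy _) _; apply: le_trans (energy_noninc _ t0) _ => //.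
by rewrite /energy mul0r mul0r bj0 !expr1n expr0n/= addr0.
Qed.

Lemma der_powh t : 0 < t ->
  is_derive t 1 (fun t => `|t| `^ (c + 1) * h t) ((c + 1) * (t `^ c * v t)).
Proof.
move=> t0; apply: der_eq (derM (der_apow _ t0) (der_h t0)) _.
rewrite gtr0_norm// addrK -(@mulr_powRB1 _ t (c + 1)) ?(ltW t0)// addrK.
by field; rewrite gt_eqF.
Qed.

(** Rolle's theorem for t^(c+1) h, a multiple of the antiderivative of t^c v. The form [a * h a = 0]
    admits as left end both 0 and a zero of h. *)
Lemma v_zero_between a b : 0 <= a -> a < b -> a * h a = 0 -> h b = 0 ->
  exists2 x, a < x < b & v x = 0.
Proof.
move=> a0 ab ha hb.
have [|||x /andP[ax xb]] := @der_mvt R (fun t => `|t| `^ (c + 1) * h t)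
   (fun t => (c + 1) * (t `^ c * v t)) a b.
- by [].
- by move=> t _; apply: contM; [exact: apow_cont|exact: cont_h].
- by move=> t /andP[at_ _]; apply: der_powh; exact: le_lt_trans at_.
rewrite hb mulr0 sub0r => /eqP.
have -> : `|a| `^ (c + 1) * h a = 0.
  move: ha => /eqP; rewrite mulf_eq0 => /orP[|]/eqP ->; last by rewrite mulr0.
  by rewrite normr0 powR0// mul0r.
rewrite oppr0 eq_sym !mulf_eq0 subr_eq0 (negbTE c1_neq0) (gt_eqF ab) orbF/=.
have x0 : 0 < x by exact: le_lt_trans ax.
by rewrite gt_eqF ?powR_gt0//= => /eqP vx; exists x => //; rewrite ax.
Qed.

Lemma h_zero_between a b : 0 <= a -> a < b -> v a = 0 -> v b = 0 ->
  exists2 x, a < x < b & h x = 0.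
Proof.
move=> a0 ab va vb.
have [|||x /andP[ax xb]] := @der_mvt R v (fun t => - (t * h t / (c + 1))) a b.
- by [].
- by move=> t _; exact: cont_v.
- by move=> t _; exact: der_v.
rewrite va vb subr0 => /eqP.
have x0 : 0 < x by exact: le_lt_trans ax.
rewrite eq_sym !(mulf_eq0, oppr_eq0, invr_eq0) (gt_eqF x0) (negbTE c1_neq0) orbF subr_eq0 (gt_eqF ab) orbF/=.
by move=> /eqP hx; exists x => //; rewrite ax.
Qed.

(** Between a and b the function v vanishes, and beyond a its slope is at most |v(a)| in absolute
    value; descending from v(a) to 0 therefore takes length at least 1. *)
Lemma zero_gap a b : 0 < a -> h a = 0 -> h b = 0 -> a < b -> a + 1 <= b.
Proof.
move=> a0 ha hb ab; have va := v_neq0_at_zero a0 ha.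
have [||x /andP[ax xb] vx] := @v_zero_between a b (ltW a0) ab.
- by rewrite ha mulr0.
- by [].
have [||y /andP[ay yx] E] := @der_mvt R v (fun t => - (t * h t / (c + 1))) a x ax.
- by move=> t _; exact: cont_v.
- by move=> t _; exact: der_v.
rewrite vx sub0r in E.
have : `|v a| <= `|v a| * (x - a).
  rewrite -[leLHS]normrN E normrM normrN (ger0_norm (x := x - a)) ?subr_ge0 ?(ltW ax)//.
  by rewrite ler_wpM2r ?subr_ge0 ?(ltW ax)//; apply: dv_le_after_zero => //; exact: ltW.
rewrite ler_pMr ?normr_gt0//; lra.
Qed.

(* Sturm: U = t^((c+2)/2) h satisfies t^2 U'' = - (t^2 - c (c+2) / 4) U, so U
   would be positive, increasing and uniformly concave at infinity. *)
Lemma not_eventually_pos (s T : R) : ~ (forall t, T < t -> 0 < s * h t).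
Proof.
move=> pos; pose m := (c + 2) / 2.
pose U t := s * (`|t| `^ m * h t).
pose U1 t := s * (`|t| `^ (m - 1) * ((c + 1) * v t - c / 2 * h t)).
(* Beyond c + 2 the factor t^2 - c (c+2) / 4 is at least t^2 / 2, so that U'' <= - U / 2. *)
pose T1 := Num.max T 0 + c + 2.
have mx : T <= Num.max T 0 /\ 0 <= Num.max T 0 by rewrite !le_max !lexx orbT.
have T10 : 0 < T1 by rewrite /T1; move: c_gt0; lra.
have TT1 : T < T1 by rewrite /T1; move: c_gt0; lra.
have pw (p r : R) : 0 < r -> r `^ p = r * r `^ (p - 1).
  exact: powR_split.
have dU t : 0 < t -> is_derive t 1 U (U1 t).
  move=> t0; apply: der_eq (derM (der_cst s t) (derM (der_apow m t0) (der_h t0))) _.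
  by rewrite /U1 gtr0_norm// pw// /m; field; rewrite gt_eqF.
have dU1 t : 0 < t -> is_derive t 1 U1
   (- (s * (t `^ (m - 1 - 1) * h t)) * (t ^+ 2 - c * (c + 2) / 4)).
  move=> t0.
  apply: der_eq (derM (der_cst s t) (derM (der_apow (m - 1) t0)
    (derD (derM (der_cst (c + 1) t) (der_v t)) (derN (derM (der_cst (c / 2) t) (der_h t0)))))) _.
  by rewrite gtr0_norm// (pw (m - 1))// /m; field; rewrite c1_neq0 gt_eqF.
have big t : T1 <= t -> t ^+ 2 / 2 <= t ^+ 2 - c * (c + 2) / 4.
  move=> Tt; have h1 : c + 2 <= t by apply: le_trans Tt; rewrite /T1; lra.
  have : c * (c + 2) <= t * t by rewrite ler_pM//; move: c_gt0; lra.
  have : 0 <= c * (c + 2) by rewrite mulr_ge0//; move: c_gt0; lra.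
  by rewrite expr2; move: (t * t) (c * (c + 2)) => x y; lra.
have U_gt0 t : T1 <= t -> 0 < U t.
  move=> Tt; have t0 : 0 < t by exact: lt_le_trans Tt.
  rewrite /U mulrCA; apply: mulr_gt0; first by rewrite powR_gt0// normr_gt0 gt_eqF.
  by apply: pos; exact: lt_le_trans Tt.
have dU1_le t : T1 <= t ->
    - (s * (t `^ (m - 1 - 1) * h t)) * (t ^+ 2 - c * (c + 2) / 4) <= - (U t / 2).
  move=> Tt; have t0 : 0 < t by exact: lt_le_trans Tt.
  have E : U t = s * (t `^ (m - 1 - 1) * h t) * t ^+ 2.
    by rewrite /U gtr0_norm// (pw m)// (pw (m - 1))//; ring.
  have : 0 <= s * (t `^ (m - 1 - 1) * h t).
    by rewrite mulrCA mulr_ge0 ?powR_ge0//; apply/ltW/pos; exact: lt_le_trans Tt.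
  rewrite E => X0; rewrite mulNr lerN2 -mulrA; apply: ler_wpM2l => //.
  exact: big.
have pos1 t : T1 <= t -> 0 < t by exact: lt_le_trans.
have U1_noninc a b : T1 <= a -> a <= b -> U1 b <= U1 a.
  move=> Ta ab; rewrite -lerN2.
  apply: (@der_mono R (fun t => - U1 t)
    (fun t => - (- (s * (t `^ (m - 1 - 1) * h t)) * (t ^+ 2 - c * (c + 2) / 4))) a b ab).
  - move=> t /andP[at_ _]; apply: contN; apply: der_cont (dU1 t _).
    by apply: pos1; exact: le_trans at_.
  - by move=> t /andP[at_ _]; apply: derN; apply: dU1; apply: pos1; apply: le_trans Ta (ltW at_).
  - move=> t /andP[at_ _]; rewrite oppr_ge0; apply: le_trans (dU1_le t _) _.
      exact: le_trans Ta (ltW at_).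
    by rewrite oppr_le0 divr_ge0// ltW// U_gt0// (le_trans Ta (ltW at_)).
have U1_ge0 a : T1 <= a -> 0 <= U1 a.
  move=> Ta; rewrite leNgt; apply/negP => U1a.
  (* The point where the tangent of the concave function U at a reaches 0, if the slope is
     negative. *)
  pose b := a + U a / (- U1 a).
  have nU : 0 < - U1 a by rewrite oppr_gt0.
  have ab : a <= b by rewrite lerDl divr_ge0 ?(ltW nU)// ltW// U_gt0.
  have : U1 a * a - U a <= U1 a * b - U b.
    apply: (@der_mono R (fun t => U1 a * t - U t) (fun t => U1 a - U1 t) a b ab).
    - move=> t /andP[at_ _]; apply: contD; first by apply: contM; [exact: cont_cst|exact: cont_id].
      by apply: contN; apply: der_cont (dU t _); apply: pos1; exact: le_trans at_.
    - move=> t /andP[at_ _].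
      apply: der_eq (derD (derM (der_cst (U1 a) t) (der_id t)) (derN (dU t _))) _; last by ring.
      by apply: pos1; exact: le_trans (ltW at_).
    - by move=> t /andP[at_ _]; rewrite subr_ge0 U1_noninc// ltW.
  have := U_gt0 b (le_trans Ta ab).
  have -> : U1 a * b = U1 a * a - U a by rewrite /b; field; rewrite lt_eqF.
  lra.
have U_nondec a : T1 <= a -> U T1 <= U a.
  move=> Ta; apply: (@der_mono R U U1 T1 a Ta).
  - by move=> t /andP[at_ _]; apply: der_cont (dU t _); apply: pos1.
  - by move=> t /andP[at_ _]; apply: dU; apply: pos1; exact: ltW.
  - by move=> t /andP[at_ _]; apply: U1_ge0; exact: ltW.
have u0 := U_gt0 _ (lexx T1).
(* The slope decreases at rate at least U(T1) / 2, so over this length it loses U'(T1) + 1 and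
   becomes negative. *)
pose b := T1 + 2 * (U1 T1 + 1) / U T1.
have U1T := U1_ge0 _ (lexx T1).
have Tb : T1 <= b by rewrite lerDl divr_ge0 ?(ltW u0)// mulr_ge0// addr_ge0.
have : - (U T1 / 2 * T1) - U1 T1 <= - (U T1 / 2 * b) - U1 b.
  apply: (@der_mono R (fun t => - (U T1 / 2 * t) - U1 t) (fun t => - (U T1 / 2) -
     (- (s * (t `^ (m - 1 - 1) * h t)) * (t ^+ 2 - c * (c + 2) / 4))) T1 b Tb).
  - move=> t /andP[at_ _]; apply: contD.
      by apply: contN; apply: contM; [exact: cont_cst|exact: cont_id].
    by apply: contN; apply: der_cont (dU1 t _); apply: pos1.
  - move=> t /andP[at_ _]; have t0 : 0 < t by apply: pos1; exact: ltW.
    by apply: der_eq (derD (derN (derM (der_cst (U T1 / 2) t) (der_id t))) (derN (dU1 t t0))) _; ring.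
  - move=> t /andP[at_ _]; have := dU1_le _ (ltW at_); have := U_nondec _ (ltW at_); lra.
have -> : U T1 / 2 * b = U T1 / 2 * T1 + U1 T1 + 1 by rewrite /b; field; rewrite gt_eqF.
have := U1_ge0 _ Tb; lra.
Qed.

Lemma h_zero_unbounded T : exists2 z, T < z & h z = 0.
Proof.
apply: contrapT => nz.
have nz' t : T < t -> h t != 0 by move=> Tt; apply/eqP => ht; apply: nz; exists t.
have [a Ta ha] : exists2 a, T < a & 0 < h a.
  apply: contrapT => H; apply: (@not_eventually_pos (-1) T) => t Tt.
  rewrite mulN1r oppr_gt0 lt_neqAle nz'//= leNgt; apply/negP => ht; apply: H; by exists t.
have [b Tb hb] : exists2 b, T < b & h b < 0.
  apply: contrapT => H; apply: (@not_eventually_pos 1 T) => t Tt.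
  rewrite mul1r lt_neqAle eq_sym nz'//= leNgt; apply/negP => ht; apply: H; by exists t.
have [ab|ba] := leP a b.
  have [||x /andP[ax xb] hx] := @cont_ivt R h a b ab.
  - by move=> x _; exact: cont_h.
  - by rewrite mulr_ge0_le0 ?ltW.
  by apply: nz; exists x => //; exact: lt_le_trans ax.
have [||x /andP[ax xb] hx] := @cont_ivt R h b a (ltW ba).
- by move=> x _; exact: cont_h.
- by rewrite mulr_le0_ge0 ?ltW.
by apply: nz; exists x => //; exact: lt_le_trans ax.
Qed.

End bessel_pair.

(** * Increasing enumeration of an unbounded set of positive reals with gaps at least 1 *)

Section enumeration.
Context (R : realType).
Implicit Types (Z : set R) (x z : R).

(** The infimum is attained: a member within 1/2 of it cannot have a smaller member, which would be
    at distance less than 1. *)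
Lemma gapped_min Z x : (forall T, exists2 z, T < z & Z z) ->
  (forall a b, x < a -> Z a -> Z b -> a < b -> a + 1 <= b) ->
  exists m, [/\ x < m, Z m & forall z, x < z -> Z z -> m <= z].
Proof.
move=> unb gap; have [z0 xz0 Zz0] := unb x.
pose S := [set z | x < z /\ Z z].
have hS : has_inf S by split; [exists z0|exists x => z [xz _]; exact: ltW].
have [m [xm Zm] mlt] : exists2 m, S m & m < inf S + 1 / 2.
  by have [//|m Sm ml] := @inf_adherent _ S (1 / 2) _ hS; exists m.
exists m; split => // z xz Zz; rewrite leNgt; apply/negP => zm.
have := gap z m xz Zz Zm zm; have : inf S <= z by apply: ge_inf => //; case: hS.
lra.
Qed.

(** The sequence iterates the next-element map; the gap gives q_n >= q_0 + n, so every element of Z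
    is passed and hence met. *)
Lemma gapped_enumeration Z : (forall z, Z z -> 0 < z) ->
  (forall T, exists2 z, T < z & Z z) ->
  (forall a b, 0 < a -> Z a -> Z b -> a < b -> a + 1 <= b) ->
  exists q : nat -> R, increasing_seq q /\ range q = Z.
Proof.
move=> pos unb gap.
have nxP x : exists m, 0 <= x -> [/\ x < m, Z m & forall z, x < z -> Z z -> m <= z].
  have [x0|x0] := leP 0 x; last by exists 0.
  have [|m mP] := @gapped_min Z x unb; last by exists m.
  by move=> a b xa; apply: gap; exact: le_lt_trans xa.
have [nx nxE] := choice nxP.
pose q := fix q n := if n is n'.+1 then nx (q n') else nx 0.
have q0 n : 0 < q n.
  elim: n => [|n ih] /=; first by have [] := nxE 0 (lexx 0).
  by have [h _ _] := nxE _ (ltW ih); exact: lt_trans h.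
have qZ n : Z (q n).
  case: n => [|n] /=; first by have [] := nxE 0 (lexx 0).
  by have [] := nxE _ (ltW (q0 n)).
have qS n : q n < q n.+1 by rewrite /=; have [] := nxE _ (ltW (q0 n)).
have q_inc : increasing_seq q by exact/increasing_seqP.
have qn n : q 0%N + n%:R <= q n.
  elim: n => [|n ih]; first by rewrite addr0.
  apply: le_trans (gap _ _ (q0 n) (qZ n) (qZ n.+1) (qS n)).
  by rewrite -natr1 addrA lerD2r.
exists q; split => //; apply/seteqP; split => [_ [n _ <-]//|z Zz].
have z0 := pos z Zz.
have ex : exists n, z < q n.
  exists (Num.bound z); apply: lt_le_trans (qn _).
  apply: lt_le_trans (archi_boundP (ltW z0)) _.
  by rewrite lerDr ltW.
case: (ex_minnP ex) => -[|n] zq qmin.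
  by have [_ _ /(_ z z0 Zz)] := nxE 0 (lexx 0); rewrite leNgt zq.
exists n => //; apply/eqP; rewrite eq_le; apply/andP; split.
  by rewrite leNgt; apply/negP => /qmin; rewrite ltnn.
rewrite leNgt; apply/negP => qz.
have [_ _ /(_ z qz Zz)] := nxE _ (ltW (q0 n)).
by rewrite leNgt zq.
Qed.

End enumeration.

(** * The zeros of h, and bounds for v and v' beyond the first of them *)

Section bessel_zeros.
Context (R : realType) (al : R).
Hypothesis c_gt0 : 0 < 2 * al + 1.
Local Notation c := (2 * al + 1).
Local Notation v := (bj al).
Local Notation h := (bj (al + 1)).
Local Notation q := (bessel_zero (al + 1)).
Implicit Types (a b t x : R).

Let al11 : -1 < al + 1. Proof. by move: c_gt0; lra. Qed.
Let c1_gt0 : 0 < c + 1. Proof. by rewrite addr_gt0. Qed.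
Let c1_neq0 : c + 1 != 0. Proof. by rewrite gt_eqF. Qed.

(** An enumeration exists, by [h_zero_unbounded] and [zero_gap], so the default value of [xget] is
    never taken. *)
Lemma bessel_zeroP : increasing_seq q /\ range q = [set z | 0 < z /\ h z = 0].
Proof.
have E : [set z : R | 0 < z /\ bessel_j (al + 1) z = 0] = [set z | 0 < z /\ h z = 0].
  apply/seteqP; split => z /= [z0]; rewrite bessel_jE ?(ltW z0)// => hz; split => //.
have := xgetPex (fun=> 0) (P := [set q : nat -> R |
    enumerates_positive_zeros (bessel_j (al + 1)) q]).
rewrite -/q /enumerates_positive_zeros /= -E; apply.
rewrite E; apply: gapped_enumeration => [z []//|T|a b a0 [_ ha] [_ hb]].
  have [z Tz hz] := h_zero_unbounded c_gt0 (Num.max T 0).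
  by exists z; [apply: le_lt_trans Tz; rewrite le_max lexx|split => //; apply: le_lt_trans Tz; rewrite le_max lexx orbT].
exact: (zero_gap c_gt0).
Qed.

Lemma q_gt0 k : 0 < q k.
Proof. by have [_ E] := bessel_zeroP; have : range q (q k) by [exists k]; rewrite E => -[]. Qed.

Lemma h_bessel_zero k : h (q k) = 0.
Proof. by have [_ E] := bessel_zeroP; have : range q (q k) by [exists k]; rewrite E => -[]. Qed.

Lemma bessel_zero_surj t : 0 < t -> h t = 0 -> exists k, t = q k.
Proof.
move=> t0 ht; have [_ E] := bessel_zeroP.
have : range q t by rewrite E.
by move=> [k _ <-]; exists k.
Qed.

Lemma bessel_zero_lt m n : (q m < q n) = (m < n)%N.
Proof. by have [/leW_mono-> _] := bessel_zeroP. Qed.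

Lemma bessel_zero_le m n : (q m <= q n) = (m <= n)%N.
Proof. by have [-> _] := bessel_zeroP. Qed.

Lemma bessel_zero_growth k : q 0%N + k%:R <= q k.
Proof.
elim: k => [|k ih]; first by rewrite addr0.
apply: le_trans (zero_gap c_gt0 (q_gt0 k) (h_bessel_zero k) (h_bessel_zero k.+1) _); last by rewrite bessel_zero_lt.
by rewrite -natr1 addrA lerD2r.
Qed.

Lemma h_gt0 t : 0 <= t -> t < q 0%N -> 0 < h t.
Proof.
move=> t0 tq; rewrite ltNge; apply/negP => ht.
have [||x /andP[x0 xt] hx] := @cont_ivt R h 0 t t0.
- by move=> x _; exact: cont_h.
- by rewrite bj0 mul1r.
move: x0; rewrite le_eqVlt => /predU1P[x0|x0].
  by move: hx; rewrite -x0 bj0 => /eqP; rewrite oner_eq0.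
have [k xk] := bessel_zero_surj x0 hx.
have : q 0%N <= x by rewrite xk bessel_zero_le.
by rewrite leNgt (le_lt_trans xt tq).
Qed.

Lemma v_noninc a b : 0 <= a -> a <= b -> (forall t, a < t < b -> 0 <= h t) -> v b <= v a.
Proof.
move=> a0 ab hp; rewrite -lerN2.
apply: (@der_mono R (fun t => - v t) (fun t => t * h t / (c + 1)) a b ab).
- by move=> t _; apply: contN; exact: cont_v.
- by move=> t _; rewrite -[X in is_derive _ _ _ X]opprK; apply: derN; exact: der_v.
- move=> t abt; rewrite divr_ge0 ?(ltW c1_gt0)// mulr_ge0 ?hp//.
  by case/andP: abt => /ltW/(le_trans a0).
Qed.

Lemma v_nondec a b : 0 <= a -> a <= b -> (forall t, a < t < b -> h t <= 0) -> v a <= v b.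
Proof.
move=> a0 ab hp.
apply: (@der_mono R v (fun t => - (t * h t / (c + 1))) a b ab).
- by move=> t _; exact: cont_v.
- by move=> t _; exact: der_v.
- move=> t abt; rewrite oppr_ge0 mulr_le0_ge0 ?invr_ge0 ?(ltW c1_gt0)// mulr_ge0_le0 ?hp//.
  by case/andP: abt => /ltW/(le_trans a0).
Qed.

Lemma v_q0_lt0 : v (q 0%N) < 0.
Proof.
have [||x /andP[x0 xq] vx] := @v_zero_between R al c_gt0 0 (q 0%N) (lexx _) (q_gt0 0).
- by rewrite mul0r.
- exact: h_bessel_zero.
rewrite lt_neqAle (v_neq0_at_zero c_gt0 (q_gt0 0) (h_bessel_zero 0)) -vx.
apply: v_noninc; [exact: ltW|exact: ltW|].
by move=> t /andP[xt tq]; apply/ltW/h_gt0 => //; exact: ltW (lt_trans x0 xt).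
Qed.

(** The sign of h is constant between its first two zeros. If it were positive, v would decrease
    from v(q_0) < 0 and could not vanish in between, as it does by [v_zero_between]. *)
Lemma h_lt0 t : q 0%N < t -> t < q 1%N -> h t < 0.
Proof.
move=> qt tq; rewrite ltNge; apply/negP => ht.
have nz x : q 0%N < x -> x < q 1%N -> h x != 0.
  move=> qx xq; apply/eqP => hx; have x0 : 0 < x by exact: lt_trans (q_gt0 0) qx.
  have [k xk] := bessel_zero_surj x0 hx; move: qx xq; rewrite xk !bessel_zero_lt.
  by case: k {xk} => // k; rewrite ltnS ltn0.
have hp x : q 0%N < x -> x < q 1%N -> 0 <= h x.
  move=> qx xq; rewrite leNgt; apply/negP => hx.
  have [xt|tx] := leP x t.
    have [||y /andP[xy yt] hy] := @cont_ivt R h x t xt.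
    - by move=> y _; exact: cont_h.
    - by rewrite mulr_le0_ge0// ltW.
    by have /eqP := nz y (lt_le_trans qx xy) (le_lt_trans yt tq).
  have [||y /andP[xy yt] hy] := @cont_ivt R h t x (ltW tx).
  - by move=> y _; exact: cont_h.
  - by rewrite mulr_ge0_le0// ltW.
  by have /eqP := nz y (lt_le_trans qt xy) (le_lt_trans yt xq).
have [|||x /andP[qx xq] vx] := @v_zero_between R al c_gt0 (q 0%N) (q 1%N) (ltW (q_gt0 0)).
- by rewrite bessel_zero_lt.
- by rewrite h_bessel_zero mulr0.
- exact: h_bessel_zero.
have := v_q0_lt0; rewrite ltNge -vx; apply/negP; rewrite negbK.
apply: v_noninc; [exact: ltW (q_gt0 0)|exact: ltW|].
by move=> y /andP[qy yx]; apply: hp => //; exact: lt_trans xq.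
Qed.

Lemma v_q1_ge0 : 0 <= v (q 1%N).
Proof.
have [|||x /andP[qx xq] vx] := @v_zero_between R al c_gt0 (q 0%N) (q 1%N) (ltW (q_gt0 0)).
- by rewrite bessel_zero_lt.
- by rewrite h_bessel_zero mulr0.
- exact: h_bessel_zero.
rewrite -vx; apply: v_nondec; [|exact: ltW|].
  exact: ltW (lt_trans (q_gt0 0) qx).
by move=> y /andP[qy yx]; apply/ltW/h_lt0 => //; exact: lt_trans qy.
Qed.

Lemma v_le_q k t : q k <= t -> `|v t| <= `|v (q k)|.
Proof. by move=> qt; exact: (v_le_after_zero c_gt0 (ltW (q_gt0 k)) (h_bessel_zero k) qt). Qed.

Lemma v_q_neq0 k : v (q k) != 0.
Proof. exact: (v_neq0_at_zero c_gt0 (q_gt0 k) (h_bessel_zero k)). Qed.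

Lemma energy_q k : energy al (q k) = v (q k) ^+ 2.
Proof. exact/energy_at_zero/h_bessel_zero. Qed.

(* The free parameter l is tuned at the left end of the interval to turn the
   monotonicity of this function into a bound on v'. *)
Lemma der_Psi (l : R) t : 0 < t ->
  is_derive t 1 (fun t => c * l ^+ 2 * t ^+ 2 - 4 * c * l * v t - energy al t)
   (2 * c * t * (l + h t / (c + 1)) ^+ 2).
Proof.
move=> t0; apply: der_eq (derD (derD (derM (der_cst (c * l ^+ 2) t) (derX 1 (der_id t)))
  (derN (derM (der_cst (4 * c * l) t) (der_v c_gt0 t)))) (derN (der_energy c_gt0 t0))) _.
by rewrite expr1; field.
Qed.

Lemma Psi_nondec (l a b : R) : 0 < a -> a <= b ->
  c * l ^+ 2 * a ^+ 2 - 4 * c * l * v a - energy al a <=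
  c * l ^+ 2 * b ^+ 2 - 4 * c * l * v b - energy al b.
Proof.
move=> a0 ab; apply: (@der_mono R (fun t => c * l ^+ 2 * t ^+ 2 - 4 * c * l * v t - energy al t)
   (fun t => 2 * c * t * (l + h t / (c + 1)) ^+ 2) a b ab).
- move=> t /andP[at_ _]; apply: der_cont (der_Psi l _); exact: lt_le_trans at_.
- by move=> t /andP[at_ _]; apply: der_Psi; exact: lt_trans at_.
- move=> t /andP[at_ _]; rewrite mulr_ge0 ?sqr_ge0// mulr_ge0 ?(ltW (lt_trans a0 at_))//.
  by rewrite mulr_ge0// ltW.
Qed.

Let V := - v (q 0%N).

Lemma V_gt0 : 0 < V. Proof. by rewrite oppr_gt0 v_q0_lt0. Qed.

(** [Psi_nondec] from q to t with l = (V - v(t)) / (4c): this l makes 4 c l (V + v(t)) cancel V^2 -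
    v(t)^2 exactly. *)
Lemma dv_bound_down t : q 0%N <= t -> h t <= 0 ->
  (t * h t / (c + 1)) ^+ 2 <= (V - v t) ^+ 2 * (t ^+ 2 - q 0%N ^+ 2) / (16 * c).
Proof.
move=> qt _; have := Psi_nondec ((V - v t) / (4 * c)) (q_gt0 0) qt.
rewrite energy_q /energy -/V; move: ((t * h t / (c + 1)) ^+ 2) => w2.
have -> : v (q 0%N) = - V by rewrite opprK.
have -> : c * ((V - v t) / (4 * c)) ^+ 2 = (V - v t) ^+ 2 / (16 * c).
  by field; rewrite gt_eqF.
have -> : 4 * c * ((V - v t) / (4 * c)) = V - v t by field; rewrite gt_eqF.
have -> : (V - v t) ^+ 2 * (t ^+ 2 - q 0%N ^+ 2) / (16 * c) =
  (V - v t) ^+ 2 / (16 * c) * t ^+ 2 - (V - v t) ^+ 2 / (16 * c) * q 0%N ^+ 2.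
  by field; rewrite gt_eqF.
lra.
Qed.

(** As h is negative just after q, here t lies beyond the second zero q_1, from which [Psi_nondec]
    is started with l = - (V + v(t)) / (4c). What remains besides the stated bound is - (v(q_1) -
    v(t)) (V - v(q_1)) <= 0. *)
Lemma dv_bound_up t : q 0%N <= t -> 0 < h t ->
  (t * h t / (c + 1)) ^+ 2 <= (V + v t) ^+ 2 * (t ^+ 2 - q 0%N ^+ 2) / (16 * c).
Proof.
move=> qt ht.
have q1t : q 1%N <= t.
  rewrite leNgt; apply/negP => tq; move: qt; rewrite le_eqVlt => /predU1P[E|qt].
    by move: ht; rewrite -E h_bessel_zero ltxx.
  by have := h_lt0 qt tq; rewrite ltNge (ltW ht).
have := Psi_nondec (- ((V + v t) / (4 * c))) (q_gt0 1) q1t.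
rewrite energy_q /energy -/V; move: ((t * h t / (c + 1)) ^+ 2) => w2.
have -> : c * (- ((V + v t) / (4 * c))) ^+ 2 = (V + v t) ^+ 2 / (16 * c).
  by field; rewrite gt_eqF.
have -> : 4 * c * (- ((V + v t) / (4 * c))) = - (V + v t) by field; rewrite gt_eqF.
have -> : (V + v t) ^+ 2 * (t ^+ 2 - q 0%N ^+ 2) / (16 * c) =
  (V + v t) ^+ 2 / (16 * c) * t ^+ 2 - (V + v t) ^+ 2 / (16 * c) * q 0%N ^+ 2.
  by field; rewrite gt_eqF.
have V0 := V_gt0; have v1 := v_q1_ge0.
have : `|v (q 1%N)| <= `|v (q 0%N)| by apply: v_le_q; rewrite bessel_zero_le.
rewrite ger0_norm// ltr0_norm ?v_q0_lt0// -/V => v1V.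
have : `|v t| <= `|v (q 1%N)| by exact: v_le_q.
rewrite (ger0_norm v1) ler_norml => /andP[_ vt].
have P : 0 <= (v (q 1%N) - v t) * (V - v (q 1%N)) by rewrite mulr_ge0 ?subr_ge0.
have Q : (V + v t) ^+ 2 / (16 * c) * q 0%N ^+ 2 <= (V + v t) ^+ 2 / (16 * c) * q 1%N ^+ 2.
  apply: ler_wpM2l; first by rewrite divr_ge0 ?sqr_ge0// mulr_ge0// ltW.
  by rewrite ler_sqr ?nnegrE ?(ltW (q_gt0 _))// bessel_zero_le.
move: ((V + v t) ^+ 2 / (16 * c)) Q => X Q.
move: (X * t ^+ 2) (X * q 0%N ^+ 2) (X * q 1%N ^+ 2) Q => x y z Q.
nra.
Qed.

End bessel_zeros.

(** * Weighted integrals and the first Fourier-Bessel coefficient *)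

(* The absolute value only matters outside [0, q], where it keeps the weight
   continuous. *)
Definition wI (R : realType) (c q : R) (g : R -> R) : R :=
  RI 0 q (fun t => `|t| `^ c * g t).

Section weighted_integral.
Context (R : realType) (c q : R).
Hypothesis c_gt0 : 0 < c.
Hypothesis q_gt0 : 0 < q.
Implicit Types (g f : R -> R) (t x k : R).

Lemma wcont g t : cont g t -> cont (fun t => `|t| `^ c * g t) t.
Proof. by move=> cg; apply: contM cg; exact: apow_cont. Qed.

Lemma wID f g : (forall t, cont f t) -> (forall t, cont g t) ->
  wI c q (fun t => f t + g t) = wI c q f + wI c q g.
Proof.
move=> cf cg; rewrite /wI -RID; try by move=> t _; exact: wcont.
by apply: eq_RI => t _; rewrite mulrDr.
Qed.

Lemma wIZ k f : (forall t, cont f t) -> wI c q (fun t => k * f t) = k * wI c q f.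
Proof.
move=> cf; rewrite /wI -RIZ; try by move=> t _; exact: wcont.
by apply: eq_RI => t _; rewrite mulrCA.
Qed.

Lemma eq_wI f g : (forall t, 0 <= t <= q -> f t = g t) -> wI c q f = wI c q g.
Proof. by move=> fg; apply: eq_RI => t tq; rewrite fg. Qed.

Lemma wI_ge0 f : (forall t, 0 <= t <= q -> 0 <= f t) -> 0 <= wI c q f.
Proof. by move=> f0; apply: RI_ge0 => t tq; rewrite mulr_ge0 ?powR_ge0 ?f0. Qed.

Lemma wI_le f g : (forall t, cont f t) -> (forall t, cont g t) ->
  (forall t, 0 <= t <= q -> f t <= g t) -> wI c q f <= wI c q g.
Proof.
move=> cf cg fg; apply: RI_le; try by move=> t _; exact: wcont.
by move=> t tq; rewrite ler_wpM2l ?powR_ge0 ?fg.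
Qed.

Lemma wI_sum (F : nat -> R -> R) n : (forall j t, cont (F j) t) ->
  wI c q (fun t => \sum_(j < n) F j t) = \sum_(j < n) wI c q (F j).
Proof.
move=> cF; rewrite /wI -(RI_sum _ (F := fun j t => `|t| `^ c * F j t)).
  by apply: eq_RI => t _; rewrite mulr_sumr.
by move=> j t _; exact: wcont.
Qed.

(* t^(c+1) G is the antiderivative of t^c g. *)
Lemma wI_FTC g (G : R -> R) : (forall t, cont g t) -> (forall t, cont G t) ->
  (forall t, 0 < t -> is_derive t 1 G ((g t - (c + 1) * G t) / t)) ->
  wI c q g = q `^ (c + 1) * G q.
Proof.
move=> cg cG dG.
have c1 : 0 < c + 1 by rewrite addr_gt0.
have dF t : 0 < t < q -> is_derive t 1 (fun t => `|t| `^ (c + 1) * G t) (`|t| `^ c * g t).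
  move=> /andP[t0 _]; apply: der_eq (derM (der_apow _ t0) (dG t t0)) _.
  by rewrite gtr0_norm// (powR_split (c + 1) t0) addrK; field; rewrite gt_eqF.
rewrite /wI (RI_FTC q_gt0 _ _ dF); first last.
- by move=> t _; apply: contM (cG t); exact: apow_cont.
- by move=> t _; exact: wcont.
- by rewrite normr0 powR0 ?gt_eqF// mul0r subr0 gtr0_norm.
Qed.

End weighted_integral.

(** * The first coefficient bounded below through moments of h^2 *)

Section coefficient_bounds.
Context (R : realType) (al : R).
Hypothesis c_gt0 : 0 < 2 * al + 1.
Local Notation c := (2 * al + 1).
Local Notation nu := (al + 1).
Local Notation v := (bj al).
Local Notation h := (bj (al + 1)).
Local Notation q := (bessel_zero (al + 1) 0%N).
Implicit Types (t x : R).

Let c1_gt0 : 0 < c + 1. Proof. by rewrite addr_gt0. Qed.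
Let c1_neq0 : c + 1 != 0. Proof. by rewrite gt_eqF. Qed.
Let nu_gt0 : 0 < nu. Proof. by move: c_gt0; lra. Qed.
Let q0 : 0 < q. Proof. exact: q_gt0. Qed.
Let h_Q0 : h q = 0. Proof. exact: h_bessel_zero. Qed.

Let V := - v q.
Let vq : v q = - V. Proof. by rewrite opprK. Qed.
Let V0 : 0 < V. Proof. exact: V_gt0. Qed.

Local Ltac ct := cont_with ltac:(idtac; lazymatch goal with
  | |- cont (fun t => bj (_ + 1) t) _ => exact (@cont_h R al c_gt0 _)
  | _ => exact (@cont_v R al c_gt0 _) end).
Local Ltac dr := der_with ltac:(idtac; lazymatch goal with
  | |- is_derive _ _ (fun t => bj (_ + 1) t) _ => apply: der_h => //
  | _ => exact (@der_v R al c_gt0 _) end).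

Let A0 := wI c q (fun t => h t ^+ 2).
Let A k := wI c q (fun t => t ^+ k * h t ^+ 2).

(** With J = t^nu h, a multiple of J_nu, this is Lommel's integral of t J^2 over [0, q]. *)
Lemma wI_t2h2 : A 2 = (c + 1) ^+ 2 * q `^ (c + 1) * V ^+ 2 / 2.
Proof.
pose G t := (c + 1) ^+ 2 * (v t ^+ 2 - v t * h t) + t ^+ 2 * h t ^+ 2.
have : wI c q (fun t => 2 * (t ^+ 2 * h t ^+ 2)) = q `^ (c + 1) * G q.
  apply: (wI_FTC c_gt0 q0).
  - by move=> t; ct.
  - by move=> t; rewrite /G; ct.
  - by move=> t t0; rewrite /G; dr; rewrite expr1; field; rewrite c1_neq0 gt_eqF.
rewrite wIZ//; last by move=> t; ct.
rewrite -/(A 2) /G h_Q0 vq => E.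
have -> : A 2 = (2 * A 2) / 2 by field.
by rewrite E; field.
Qed.

(** The combination (6 t^4 - 4 (nu^2 - 1) t^2) h^2 has a weighted antiderivative that is quadratic
    in v and h. *)
Lemma wI_t4h2 : 6 * A 4 = q ^+ 2 * (c + 1) ^+ 2 * q `^ (c + 1) * V ^+ 2 + 4 * (nu ^+ 2 - 1) * A 2.
Proof.
pose G t := t ^+ 2 * ((c + 1) ^+ 2 * (v t ^+ 2 - v t * h t) + t ^+ 2 * h t ^+ 2)
   - 2 * t ^+ 2 * (nu * h t * (2 * v t - h t)) + 2 * t ^+ 2 * h t ^+ 2.
pose g t := 6 * (t ^+ 4 * h t ^+ 2) + (- (4 * (nu ^+ 2 - 1))) * (t ^+ 2 * h t ^+ 2).
have : wI c q g = q `^ (c + 1) * G q.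
  apply: (wI_FTC c_gt0 q0).
  - by move=> t; rewrite /g; ct.
  - by move=> t; rewrite /G; ct.
  - by move=> t t0; rewrite /G /g; dr; rewrite expr1; field; rewrite c1_neq0 gt_eqF.
rewrite /g wID//; [|by move=> t; ct|by move=> t; ct].
rewrite !wIZ//; [|by move=> t; ct|by move=> t; ct].
rewrite /G h_Q0 vq -/(A 2) -/(A 4) => E.
have -> : 6 * A 4 = (6 * A 4 + - (4 * (nu ^+ 2 - 1)) * A 2) + 4 * (nu ^+ 2 - 1) * A 2 by ring.
by rewrite E; ring.
Qed.

(** Bessel's equation tested against its solution J = t^nu h: since nu (2v - h) = t h' + nu h, the
    identity [h1] says that t J'^2 + (nu^2 - t^2) J^2 / t has integral 0 over [0, q]. Hence nu^2 -
    t^2 cannot stay positive there. *)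
Lemma nu_le_q : nu <= q.
Proof.
pose G t := nu * h t * (2 * v t - h t).
have h1 : wI c q (fun t => (nu * (2 * v t - h t)) ^+ 2 + (nu ^+ 2 * (h t ^+ 2) + (-1) * (t ^+ 2 * h t ^+ 2))) = q `^ (c + 1) * G q.
  apply: (wI_FTC c_gt0 q0).
  - by move=> t; ct.
  - by move=> t; rewrite /G; ct.
  - by move=> t t0; rewrite /G; dr; field; rewrite c1_neq0 gt_eqF.
rewrite /G h_Q0 mulr0 mul0r mulr0 in h1.
rewrite wID// in h1; [|by move=> t; ct|by move=> t; ct].
rewrite wID// in h1; [|by move=> t; ct|by move=> t; ct].
rewrite !wIZ// in h1; [|by move=> t; ct|by move=> t; ct].
rewrite -/(A0) -/(A 2) in h1.
have h2 : 0 <= wI c q (fun t => (nu * (2 * v t - h t)) ^+ 2).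
  by apply: wI_ge0 => t _; exact: sqr_ge0.
have h3 : A 2 <= q ^+ 2 * A0.
  rewrite /A -wIZ//; last by move=> t; ct.
  apply: wI_le => //; [by move=> t; ct|by move=> t; ct|].
  move=> t /andP[t0 tq]; rewrite ler_wpM2r ?sqr_ge0// ler_sqr ?nnegrE//.
  exact: ltW.
have A20 : 0 < A 2.
  by rewrite wI_t2h2 divr_gt0// !mulr_gt0 ?exprn_gt0// powR_gt0.
have A0_gt : 0 < A0.
  rewrite -(pmulr_rgt0 _ (_ : 0 < q ^+ 2)) ?exprn_gt0//; exact: lt_le_trans h3.
rewrite -ler_sqr ?nnegrE ?(ltW nu_gt0) ?(ltW q0)// -(ler_pM2r A0_gt); lra.
Qed.

Lemma wI_h2_gt0 : 0 < A0.
Proof.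
have A20 : 0 < A 2.
  by rewrite wI_t2h2 divr_gt0// !mulr_gt0 ?exprn_gt0// powR_gt0.
rewrite -(pmulr_rgt0 _ (_ : 0 < q ^+ 2)) ?exprn_gt0//; apply: lt_le_trans A20 _.
rewrite /A -wIZ//; last by move=> t; ct.
apply: wI_le => //; [by move=> t; ct|by move=> t; ct|].
move=> t /andP[t0 tq]; rewrite ler_wpM2r ?sqr_ge0// ler_sqr ?nnegrE//.
exact: ltW.
Qed.

(* The coefficient of v in the expansion of h; see [a0_acoef]. *)
Definition acoef := wI c q (fun t => h t ^+ 2) / (q `^ (c + 1) * v q ^+ 2).

Lemma acoef_gt0 : 0 < acoef.
Proof.
by rewrite /acoef -/A0 divr_gt0 ?wI_h2_gt0// mulr_gt0 ?powR_gt0// vq sqrrN exprn_gt0.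
Qed.

(** Cauchy-Schwarz between the moments of h^2 against 1, t^2 and t^4; the last two are explicit and
    the first is the coefficient up to normalization. *)
Lemma acoef_ge : 6 * nu ^+ 2 <= acoef * (q ^+ 2 + 2 * nu ^+ 2 - 2).
Proof.
have A00 := wI_h2_gt0.
have CS : A 2 ^+ 2 <= A0 * A 4.
  pose m := A 2 / A0.
  have : 0 <= wI c q (fun t => m ^+ 2 * (h t ^+ 2) + ((- (2 * m)) * (t ^+ 2 * h t ^+ 2) + t ^+ 4 * h t ^+ 2)).
    apply: wI_ge0 => t _.
    have -> : m ^+ 2 * (h t ^+ 2) + ((- (2 * m)) * (t ^+ 2 * h t ^+ 2) + t ^+ 4 * h t ^+ 2) = ((m - t ^+ 2) * h t) ^+ 2 by ring.
    exact: sqr_ge0.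
  rewrite wID//; [|by move=> t; ct|by move=> t; ct].
  rewrite wID//; [|by move=> t; ct|by move=> t; ct].
  rewrite !wIZ//; try by move=> t; ct.
  rewrite -/(A0) -/(A 2) -/(A 4) => H.
  have : 0 <= A0 * (m ^+ 2 * A0 + (- (2 * m) * A 2 + A 4)) by rewrite mulr_ge0// ltW.
  have -> : A0 * (m ^+ 2 * A0 + (- (2 * m) * A 2 + A 4)) = A0 * A 4 - A 2 ^+ 2.
    by rewrite /m; field; rewrite gt_eqF.
  by rewrite subr_ge0.
pose X := q `^ (c + 1) * V ^+ 2.
have X0 : 0 < X by rewrite mulr_gt0 ?powR_gt0 ?exprn_gt0.
have EA : A0 = acoef * X.
  by rewrite /acoef vq sqrrN -/A0 /X; field; rewrite !gt_eqF ?powR_gt0.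
have E2 : A 2 = 2 * nu ^+ 2 * X by rewrite wI_t2h2 /X; field.
have E4 : A 4 = 2 / 3 * nu ^+ 2 * X * (q ^+ 2 + 2 * nu ^+ 2 - 2).
  have -> : A 4 = (6 * A 4) / 6 by field.
  by rewrite wI_t4h2 E2 /X; field.
move: CS; rewrite EA; move: acoef X X0 E2 E4 {EA} => a X X0 E2 E4.
rewrite E2 E4 => CS.
rewrite -(ler_pM2l (_ : 0 < 2 / 3 * nu ^+ 2 * X ^+ 2)); last first.
  by rewrite !mulr_gt0 ?exprn_gt0 ?invr_gt0.
apply: le_trans (_ : (2 * nu ^+ 2 * X) ^+ 2 <= _).
  by rewrite le_eqVlt; apply/orP; left; apply/eqP; field.
apply: le_trans CS _; rewrite le_eqVlt; apply/orP; left; apply/eqP; ring.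
Qed.

End coefficient_bounds.

(** * An upper bound for q, and a sharper coefficient bound from a Taylor minorant of h *)

Section first_zero_estimates.
Context (R : realType) (al : R).
Hypothesis c_gt0 : 0 < 2 * al + 1.
Local Notation c := (2 * al + 1).
Local Notation nu := (al + 1).
Local Notation v := (bj al).
Local Notation h := (bj (al + 1)).
Local Notation q := (bessel_zero (al + 1) 0%N).
Local Notation a1 := (acoef al).
Implicit Types (t x m a z r : R).

Let c1_gt0 : 0 < c + 1. Proof. by rewrite addr_gt0. Qed.
Let nu_gt0 : 0 < nu. Proof. by move: c_gt0; lra. Qed.
Let q0 : 0 < q. Proof. exact: q_gt0. Qed.
Let h_Q0 : h q = 0. Proof. exact: h_bessel_zero. Qed.
Let V := - v q.
Let vq : v q = - V. Proof. by rewrite opprK. Qed.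
Let V0 : 0 < V. Proof. exact: V_gt0. Qed.

(** t^(2m+2) j_(m+1) vanishes at 0 and increases as long as j_m is positive. Starting from h > 0 on
    [0, q), this climbs to all the higher orders. *)
Lemma bj_pos_up m r : 0 < 2 * m + 1 -> 0 < r -> (forall t, 0 <= t < r -> 0 < bj m t) ->
  forall t, 0 <= t <= r -> 0 < bj (m + 1) t.
Proof.
move=> m0 r0 pos t /andP[]; rewrite le_eqVlt => /predU1P[<- _|t0 tr]; first by rewrite bj0.
have m1 : 0 < 2 * m + 1 + 1 by rewrite addr_gt0.
have : `|0 : R| `^ (2 * m + 1 + 1) * bj (m + 1) 0 < `|t| `^ (2 * m + 1 + 1) * bj (m + 1) t.
  apply: (@der_smono R (fun t => `|t| `^ (2 * m + 1 + 1) * bj (m + 1) t)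
     (fun t => (2 * m + 1 + 1) * (t `^ (2 * m + 1) * bj m t)) 0 t t0).
  - by move=> x _; apply: contM; [exact: apow_cont|exact: cont_h].
  - by move=> x /andP[x0 _]; exact: der_powh.
  - move=> x /andP[x0 xt]; rewrite mulr_gt0// mulr_gt0 ?powR_gt0// pos// ltW//=.
    exact: lt_le_trans tr.
by rewrite normr0 powR0 ?gt_eqF// mul0r pmulr_rgt0// powR_gt0// gtr0_norm.
Qed.

Lemma bj_contigS a z : -1 < a ->
  (a + 1) * (bj a z - bj (a + 1) z) = - (z ^+ 2 / 4 / (a + 2)) * bj (a + 1 + 1) z.
Proof.
move=> a1'; rewrite bj_contig//; have -> : a + 1 + 1 = a + 2 by ring.
by congr (- _ * _); field; rewrite gt_eqF//; lra.
Qed.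

Local Ltac nz := do ?[apply/andP; split]; rewrite ?gt_eqF//; move: c_gt0; lra.

Let Q := q ^+ 2 / 4.
Let Q0 : 0 < Q. Proof. by rewrite divr_gt0 ?exprn_gt0. Qed.
Let b1 := bj (nu + 1) q.
Let b2 := bj (nu + 1 + 1) q.
Let b3 := bj (nu + 1 + 1 + 1) q.
Let b4 := bj (nu + 1 + 1 + 1 + 1) q.

Let pos0 t : 0 <= t < q -> 0 < h t.
Proof. by move=> /andP[]; exact: h_gt0. Qed.

Let weaken (f : R -> R) : (forall t, 0 <= t <= q -> 0 < f t) -> forall t, 0 <= t < q -> 0 < f t.
Proof. by move=> H t /andP[h1 h2]; rewrite H// h1 ltW. Qed.

Let pos1 t : 0 <= t <= q -> 0 < bj (nu + 1) t.
Proof. by apply: bj_pos_up => //; move: c_gt0; lra. Qed.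

Let pos2 t : 0 <= t <= q -> 0 < bj (nu + 1 + 1) t.
Proof. by apply: bj_pos_up (weaken pos1) _ => //; move: c_gt0; lra. Qed.

Let pos3 t : 0 <= t <= q -> 0 < bj (nu + 1 + 1 + 1) t.
Proof. by apply: bj_pos_up (weaken pos2) _ => //; move: c_gt0; lra. Qed.

Let pos4 t : 0 <= t <= q -> 0 < bj (nu + 1 + 1 + 1 + 1) t.
Proof. by apply: bj_pos_up (weaken pos3) _ => //; move: c_gt0; lra. Qed.

Let qq : 0 <= q <= q. Proof. by rewrite (ltW q0) lexx. Qed.

Let Qb1 : Q * b1 = nu * (nu + 1) * V.
Proof.
have := @bj_contigS al q ltac:(move: c_gt0; lra); rewrite h_Q0 subr0 vq -/Q -/b1 => E.
have -> : Q * b1 = - (- (Q / (al + 2)) * b1) * (al + 2) by field; rewrite gt_eqF//; move: c_gt0; lra.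
by rewrite -E; ring.
Qed.

Let Qb2 : Q * b2 = (nu + 1) * (nu + 2) * b1.
Proof.
have := @bj_contigS nu q ltac:(move: c_gt0; lra); rewrite h_Q0 sub0r -/Q -/b1 -/b2 => E.
have -> : Q * b2 = - (- (Q / (nu + 2)) * b2) * (nu + 2) by field; rewrite gt_eqF//; move: c_gt0; lra.
by rewrite -E; ring.
Qed.

Let Qb3 : Q * b3 = (nu + 2) * (nu + 3) * (b2 - b1).
Proof.
have := @bj_contigS (nu + 1) q ltac:(move: c_gt0; lra); rewrite -/Q -/b1 -/b2 -/b3 => E.
have -> : Q * b3 = - (- (Q / (nu + 1 + 2)) * b3) * (nu + 1 + 2) by field; rewrite gt_eqF//; move: c_gt0; lra.
by rewrite -E; ring.
Qed.

Let b23 : b2 <= b3.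
Proof.
have := @bj_contigS (nu + 1 + 1) q ltac:(move: c_gt0; lra); rewrite -/Q -/b2 -/b3 -/b4 => E.
have p : 0 < nu + 1 + 1 + 1 by move: c_gt0; lra.
have b40 : 0 < b4 by exact: pos4.
rewrite -subr_le0 -(pmulr_rle0 _ p) E mulNr oppr_le0 mulr_ge0 ?(ltW b40)// divr_ge0 ?(ltW Q0)//.
by move: c_gt0; lra.
Qed.

(* Equivalent to j_(nu+4)(q) >= 0 through the contiguity relations. *)
Lemma q_upper : q ^+ 2 <= 2 * (nu + 1) * (nu + 3).
Proof.
have b10 : 0 < b1 by exact: pos1.
have H : Q * (Q * b2) <= Q * (Q * b3) by rewrite ler_pM2l// ler_pM2l.
have E3 : Q * (Q * b3) = (nu + 2) * (nu + 3) * (Q * b2 - Q * b1) by rewrite Qb3; ring.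
rewrite E3 Qb2 in H.
have H2 : b1 * ((nu + 2) * (2 * Q)) <= b1 * ((nu + 2) * ((nu + 1) * (nu + 3))).
  rewrite -(ler_pM2l (_ : 0 < nu + 1)) 1?addr_gt0//; move: H.
  move: (nu) nu_gt0 Q b1 => n n0 Q' b; nra.
rewrite ler_pM2l// ler_pM2l in H2; last by move: c_gt0; lra.
have -> : q ^+ 2 = 4 * Q by rewrite /Q; field.
lra.
Qed.

(* Since j_a' is a negative multiple of z j_(a+1), a lower bound for j_(a+1) on
   [0, q] integrates from q downwards to one for j_a. *)
Let lower_step a (P p : R -> R) : -1 < a ->
  (forall x, is_derive x 1 P (- (x / (2 * (a + 1))) * p x)) ->
  (forall x, 0 <= x <= q -> p x <= bj (a + 1) x) -> P q <= bj a q ->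
  forall t, 0 <= t <= q -> P t <= bj a t.
Proof.
move=> a1' dP pb Pq t /andP[t0 tq].
have : P t - bj a t <= P q - bj a q; last by lra.
apply: (@der_mono R (fun t => P t - bj a t)
   (fun x => x / (2 * (a + 1)) * (bj (a + 1) x - p x)) t q tq).
- by move=> x _; apply: contD; [exact: der_cont (dP x)|apply: contN; exact: der_cont (bj_der x a1')].
- move=> x _; apply: der_eq (derD (dP x) (derN (bj_der x a1'))) _; ring.
- move=> x /andP[tx xq]; have x0 : 0 <= x by exact: le_trans (ltW tx).
  apply: mulr_ge0; last by rewrite subr_ge0 pb// x0 ltW.
  by rewrite divr_ge0// mulr_ge0//; lra.
Qed.

Let sg t := 1 - t ^+ 2 / q ^+ 2.

Let der_sg t : is_derive t 1 sg (- (2 * t / q ^+ 2)).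
Proof.
apply: der_eq (derD (der_cst 1 t) (derN (derM (derX 1 (der_id t)) (der_cst (q ^+ 2)^-1 t)))) _.
by rewrite expr1; field; rewrite gt_eqF.
Qed.

Let sg_q : sg q = 0.
Proof. by rewrite /sg divff ?subrr// expf_neq0// gt_eqF. Qed.

(** Taylor expansion of h in s = 1 - t^2/q^2 at s = 0. In this variable the derivative of j_a is (Q
    / (a+1)) j_(a+1), so the coefficients are values at q, which contiguity expresses through V;
    stopping at s^3 gives a minorant because j_(nu+4) is positive on [0, q]. *)
Let h_taylor t : 0 <= t <= q ->
  nu * V * (sg t + (nu + 1) / 2 * sg t ^+ 2 + ((nu + 1) * (nu + 2) - Q) / 6 * sg t ^+ 3) <= h t.
Proof.
have n1 : nu + 1 != 0 by rewrite gt_eqF//; move: c_gt0; lra.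
have n2 : nu + 2 != 0 by rewrite gt_eqF//; move: c_gt0; lra.
have n3 : nu + 3 != 0 by rewrite gt_eqF//; move: c_gt0; lra.
have qn0 : q != 0 by rewrite gt_eqF.
have s3 x : 0 <= x <= q -> b3 <= bj (nu + 1 + 1 + 1) x.
  apply: (@lower_step _ (fun=> b3) (fun=> 0)) => //.
  - by move: c_gt0; lra.
  - by move=> y; apply: der_eq (der_cst b3 y) _; rewrite mulr0.
  - by move=> y yq; exact/ltW/pos4.
have s2 x : 0 <= x <= q -> b2 + Q * b3 / (nu + 3) * sg x <= bj (nu + 1 + 1) x.
  apply: (@lower_step _ (fun x => b2 + Q * b3 / (nu + 3) * sg x) (fun=> b3)) => //.
  - by move: c_gt0; lra.
  - move=> y; apply: der_eq (derD (der_cst b2 y) (derM (der_cst (Q * b3 / (nu + 3)) y) (der_sg y))) _.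
    by rewrite /Q; field; nz.
  - by rewrite sg_q mulr0 addr0.
have s1 x : 0 <= x <= q -> b1 + Q * b2 / (nu + 2) * sg x + Q * (Q * b3) / (2 * (nu + 2) * (nu + 3)) * sg x ^+ 2 <= bj (nu + 1) x.
  apply: (@lower_step _ (fun x => b1 + Q * b2 / (nu + 2) * sg x + Q * (Q * b3) / (2 * (nu + 2) * (nu + 3)) * sg x ^+ 2)
     (fun x => b2 + Q * b3 / (nu + 3) * sg x)) => //.
  - by move: c_gt0; lra.
  - move=> y; apply: der_eq (derD (derD (der_cst b1 y) (derM (der_cst (Q * b2 / (nu + 2)) y) (der_sg y)))
      (derM (der_cst (Q * (Q * b3) / (2 * (nu + 2) * (nu + 3))) y) (derX 1 (der_sg y)))) _.
    by rewrite expr1 /Q; field; nz.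
  - by rewrite sg_q mulr0 expr0n mulr0 !addr0.
have s0 x : 0 <= x <= q -> Q * b1 / (nu + 1) * sg x + Q * (Q * b2) / (2 * (nu + 1) * (nu + 2)) * sg x ^+ 2
    + Q * (Q * (Q * b3)) / (6 * (nu + 1) * (nu + 2) * (nu + 3)) * sg x ^+ 3 <= h x.
  apply: (@lower_step _ (fun x => Q * b1 / (nu + 1) * sg x + Q * (Q * b2) / (2 * (nu + 1) * (nu + 2)) * sg x ^+ 2
    + Q * (Q * (Q * b3)) / (6 * (nu + 1) * (nu + 2) * (nu + 3)) * sg x ^+ 3)
     (fun x => b1 + Q * b2 / (nu + 2) * sg x + Q * (Q * b3) / (2 * (nu + 2) * (nu + 3)) * sg x ^+ 2)) => //.
  - by move: c_gt0; lra.
  - move=> y; apply: der_eq (derD (derD (derM (der_cst (Q * b1 / (nu + 1)) y) (der_sg y))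
      (derM (der_cst (Q * (Q * b2) / (2 * (nu + 1) * (nu + 2))) y) (derX 1 (der_sg y))))
      (derM (der_cst (Q * (Q * (Q * b3)) / (6 * (nu + 1) * (nu + 2) * (nu + 3))) y) (derX 2 (der_sg y)))) _.
    by rewrite expr1 /Q; field; nz.
  - by rewrite sg_q mulr0 !expr0n !mulr0 !addr0 h_Q0.
move=> tq; apply: le_trans (s0 t tq).
rewrite Qb3 Qb2 Qb1 le_eqVlt; apply/orP; left; apply/eqP.
have -> : Q * ((nu + 1) * (nu + 2) * b1) = (nu + 1) * (nu + 2) * (Q * b1) by ring.
have -> : Q * (Q * ((nu + 2) * (nu + 3) * (b2 - b1))) = (nu + 2) * (nu + 3) * (Q * (Q * b2) - Q * (Q * b1)) by ring.
rewrite Qb2 Qb1.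
have -> : Q * ((nu + 1) * (nu + 2) * b1) = (nu + 1) * (nu + 2) * (Q * b1) by ring.
by rewrite Qb1; field; nz.
Qed.

Let S k := wI c q (fun t => sg t ^+ k).

Let cont_sg t : cont sg t.
Proof. exact: der_cont (der_sg t). Qed.

Let cont_sgX k t : cont (fun t => sg t ^+ k) t.
Proof. exact/contX/cont_sg. Qed.

Let S0 : S 0 = q `^ (c + 1) / (c + 1).
Proof.
have : wI c q (fun t => (c + 1) * sg t ^+ 0) = q `^ (c + 1) * 1.
  apply: (wI_FTC c_gt0 q0 (G := fun=> 1)).
  - by move=> t; apply: contM; [exact: cont_cst|exact: cont_sgX].
  - by move=> t; exact: cont_cst.
  - by move=> t t0; apply: der_eq (der_cst 1 t) _; rewrite expr0 subrr mul0r.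
rewrite (@wIZ R c q c_gt0 (c + 1) (fun t => sg t ^+ 0) (@cont_sgX 0%N)).
rewrite -/(S 0) mulr1 => E.
by rewrite -E; field; rewrite gt_eqF.
Qed.

(** The recursion of the Beta integral B(nu, k + 1), to which S k is proportional. *)
Let SS k : (nu + k.+1%:R) * S k.+1 = k.+1%:R * S k.
Proof.
have : wI c q (fun t => 2 * (nu + k.+1%:R) * sg t ^+ k.+1 + (- (2 * k.+1%:R)) * sg t ^+ k) = q `^ (c + 1) * sg q ^+ k.+1.
  apply: (wI_FTC c_gt0 q0 (G := fun t => sg t ^+ k.+1)).
  - move=> t; apply: contD; apply: contM; try exact: cont_cst; exact: cont_sgX.
  - by move=> t; exact: cont_sgX.
  - move=> t t0; apply: der_eq (derX k (der_sg t)) _.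
    have E : t ^+ 2 / q ^+ 2 = 1 - sg t by rewrite /sg; ring.
    have -> : k.+1%:R * sg t ^+ k * - (2 * t / q ^+ 2) = - 2 * k.+1%:R * sg t ^+ k * (t ^+ 2 / q ^+ 2) / t.
      by field; rewrite !gt_eqF.
    rewrite E exprS; move: (k.+1%:R : R) (sg t ^+ k) (sg t) => n s u.
    by field; rewrite gt_eqF.
rewrite wID//; try by move=> t; apply: contM; [exact: cont_cst|exact: cont_sgX].
rewrite !wIZ//; try by move=> t; exact: cont_sgX.
rewrite -/(S k) -/(S k.+1) sg_q expr0n /= mulr0 => E.
lra.
Qed.

(* The mean square of s + (n+1)/2 s^2 + (n+1)^2/12 s^3 for s = 1 - t^2/q^2, up
   to normalization. *)
Definition acoef_bound (n : R) : R :=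
  2 / ((n + 1) * (n + 2)) + 6 / ((n + 2) * (n + 3)) + 10 * (n + 1) / ((n + 2) * (n + 3) * (n + 4)) +
  10 * (n + 1) ^+ 2 / ((n + 2) * (n + 3) * (n + 4) * (n + 5)) +
  5 * (n + 1) ^+ 3 / ((n + 2) * (n + 3) * (n + 4) * (n + 5) * (n + 6)).

Lemma acoef_ge_small : nu / 2 * acoef_bound nu <= a1.
Proof.
(* b is what the cubic coefficient ((nu+1)(nu+2) - Q) / 6 becomes when Q is replaced by its bound
   (nu+1)(nu+3) / 2 from [q_upper]. *)
pose a := (nu + 1) / 2; pose b := (nu + 1) ^+ 2 / 12.
have a0 : 0 <= a by rewrite divr_ge0//; move: c_gt0; lra.
have bb0 : 0 <= b by rewrite divr_ge0 ?sqr_ge0.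
have sg0 t : 0 <= t <= q -> 0 <= sg t.
  move=> /andP[t0 tq]; rewrite /sg subr_ge0 ler_pdivrMr ?exprn_gt0// mul1r ler_sqr ?nnegrE//.
  exact: ltW.
have hl t : 0 <= t <= q -> nu * V * (sg t + a * sg t ^+ 2 + b * sg t ^+ 3) <= h t.
  move=> tq; apply: le_trans (h_taylor tq); rewrite ler_pM2l ?mulr_gt0// lerD2l.
  apply: ler_wpM2r; first by rewrite exprn_ge0// sg0.
  have := q_upper; have -> : q ^+ 2 = 4 * Q by rewrite /Q; field.
  rewrite /b; lra.
have P0 t : 0 <= t <= q -> 0 <= nu * V * (sg t + a * sg t ^+ 2 + b * sg t ^+ 3).
  move=> /sg0 s0; apply: mulr_ge0; first by rewrite mulr_ge0// ltW.
  apply: addr_ge0; last by apply: mulr_ge0 => //; exact: exprn_ge0.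
  by apply: addr_ge0 => //; apply: mulr_ge0 => //; exact: exprn_ge0.
have X0 : 0 < q `^ (c + 1) by rewrite powR_gt0.
pose g t := (nu * V) ^+ 2 * (sg t ^+ 2 + (2 * a * sg t ^+ 3 + ((a ^+ 2 + 2 * b) * sg t ^+ 4 +
   (2 * a * b * sg t ^+ 5 + b ^+ 2 * sg t ^+ 6)))).
have gh : wI c q g <= wI c q (fun t => h t ^+ 2).
  apply: wI_le => //.
  - by move=> t; rewrite /g; cont_with ltac:(exact: cont_sg).
  - by move=> t; apply: contX; exact: cont_h.
  move=> t tq; have -> : g t = (nu * V * (sg t + a * sg t ^+ 2 + b * sg t ^+ 3)) ^+ 2 by rewrite /g; ring.
  rewrite ler_sqr ?nnegrE; first exact: hl.
    exact: P0.
  exact: le_trans (P0 t tq) (hl t tq).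
have : wI c q g = (nu * V) ^+ 2 * (S 2 + (2 * a * S 3 + ((a ^+ 2 + 2 * b) * S 4 +
   (2 * a * b * S 5 + b ^+ 2 * S 6)))).
  have cs k t : cont (fun t => sg t ^+ k) t by exact: cont_sgX.
  rewrite /g wIZ//; last by move=> t; cont_with ltac:(exact: cont_sg).
  rewrite wID//; try by move=> t; cont_with ltac:(exact: cont_sg).
  rewrite wID//; try by move=> t; cont_with ltac:(exact: cont_sg).
  rewrite wID//; try by move=> t; cont_with ltac:(exact: cont_sg).
  rewrite wID//; try by move=> t; cont_with ltac:(exact: cont_sg).
  rewrite (@wIZ R c q c_gt0 (2 * a) _ (cs 3%N)) (@wIZ R c q c_gt0 (a ^+ 2 + 2 * b) _ (cs 4%N)).
  by rewrite (@wIZ R c q c_gt0 (2 * a * b) _ (cs 5%N)) (@wIZ R c q c_gt0 (b ^+ 2) _ (cs 6%N)).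
have nzk k : nu + k%:R != 0 by rewrite gt_eqF// ltr_wpDr.
have SE k : S k.+1 = k.+1%:R / (nu + k.+1%:R) * S k.
  by rewrite mulrAC -SS mulrAC divff ?mul1r.
rewrite !SE S0 => E.
have D0 : 0 < q `^ (c + 1) * v q ^+ 2 by rewrite vq sqrrN mulr_gt0// exprn_gt0.
rewrite /acoef (ler_pdivlMr _ _ D0).
apply: le_trans gh; rewrite E vq sqrrN le_eqVlt; apply/orP; left; apply/eqP.
rewrite /acoef_bound /a /b (_ : c + 1 = 2 * nu); last by ring.
have := nzk 1%N; have := nzk 2%N; have := nzk 3%N; have := nzk 4%N; have := nzk 5%N; have := nzk 6%N.
have : nu != 0 by rewrite gt_eqF.
move: (q `^ _) V => X W; move: (al + 1) => n n0 n6 n5 n4 n3 n2 n1.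
by field; rewrite n0 n1 n2 n3 n4 n5 n6.
Qed.

End first_zero_estimates.

(** * The inequality for h beyond the first zero *)

Section numeric.
Context (R : realType).
Implicit Types (n x : R).

(** A linear minorant to square instead of the rational function. After clearing denominators and
    putting n = x + 728/1000, the difference is a polynomial in x with nonnegative coefficients. *)
Lemma acoef_bound_ge n : 728 / 1000 <= n ->
  149 / 100 - 87 / 100 * (n - 728 / 1000) <= acoef_bound n.
Proof.
move=> n0; pose x := n - 728 / 1000; have x0 : 0 <= x by rewrite subr_ge0.
have nE : n = x + 728 / 1000 by rewrite subrK.
rewrite -/x /acoef_bound.
pose D := (n + 1) * ((n + 2) * (n + 3) * (n + 4) * (n + 5) * (n + 6)).
have D0 : 0 < D by rewrite /D !mulr_gt0//; lra.
rewrite -(ler_pM2r D0).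
have -> : (2 / ((n + 1) * (n + 2)) + 6 / ((n + 2) * (n + 3)) + 10 * (n + 1) / ((n + 2) * (n + 3) * (n + 4)) +
  10 * (n + 1) ^+ 2 / ((n + 2) * (n + 3) * (n + 4) * (n + 5)) +
  5 * (n + 1) ^+ 3 / ((n + 2) * (n + 3) * (n + 4) * (n + 5) * (n + 6))) * D =
  2 * (n + 3) * (n + 4) * (n + 5) * (n + 6) + 6 * (n + 1) * (n + 4) * (n + 5) * (n + 6) +
  10 * (n + 1) ^+ 2 * (n + 5) * (n + 6) + 10 * (n + 1) ^+ 3 * (n + 6) + 5 * (n + 1) ^+ 4.
  by rewrite /D; field; do ?[apply/andP; split]; rewrite gt_eqF//; lra.
rewrite /D nE -subr_ge0.
have p1 := x0; have p2 := exprn_ge0 2 x0; have p3 := exprn_ge0 3 x0; have p4 := exprn_ge0 4 x0.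
have p5 := exprn_ge0 5 x0; have p6 := exprn_ge0 6 x0; have p7 := exprn_ge0 7 x0.
move: p1 p2 p3 p4 p5 p6 p7; clearbody x; clear; move=> *; lra.
Qed.

(* With n = alpha + 1, this is where the constant 0.272 comes from. *)
Lemma regime_small n : 728 / 1000 <= n -> n <= 3 / 2 ->
  1 <= (2 * n - 1) * acoef_bound n ^+ 2.
Proof.
move=> n0 n1; have B := acoef_bound_ge n0.
pose L := 149 / 100 - 87 / 100 * (n - 728 / 1000).
have L0 : 0 <= L by rewrite /L; lra.
have n2 : 0 < 2 * n - 1 by lra.
apply: le_trans (_ : (2 * n - 1) * L ^+ 2 <= _); last first.
  by rewrite ler_pM2l// ler_sqr ?nnegrE//; exact: le_trans B.
rewrite /L.
pose x := n - 728 / 1000; have x0 : 0 <= x by rewrite subr_ge0.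
have nE : n = x + 728 / 1000 by rewrite subrK.
have x1 : x <= 772 / 1000 by rewrite /x; lra.
rewrite -/x nE; move: x0 x1; clearbody x; clear; move=> x0 x1.
have y0 : 0 <= 772 / 1000 - x by lra.
(* The cubic is a nonnegative combination of x (x - 7/10)^2, x (772/1000 - x), x and 1. *)
have := mulr_ge0 x0 y0; have := mulr_ge0 x0 (sqr_ge0 (x - 7 / 10)).
lra.
Qed.

(** This is 4 nu^2 <= 16 c a_1^2 with a_1 replaced by 3 nu^2 / (2 (nu+1)^2). The quartic side takes
    over between 12 and 13, whence the bound on n. *)
Lemma regime_mid n : 3 / 2 <= n -> n <= 12 -> (n + 1) ^+ 4 <= 9 * (2 * n - 1) * n ^+ 2.
Proof.
move=> n0 n1; rewrite -subr_ge0.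
have -> : 9 * (2 * n - 1) * n ^+ 2 - (n + 1) ^+ 4 =
  (n - 3 / 2) * (12 - n) * n ^+ 2 + n ^+ 2 * (n - 3 / 2) / 2 + 15 / 4 * n ^+ 2 - 4 * n - 1 by field.
have d1 : 0 <= n - 3 / 2 by rewrite subr_ge0.
have d2 : 0 <= 12 - n by rewrite subr_ge0.
have : 0 <= (n - 3 / 2) * (12 - n) * n ^+ 2.
  by apply: mulr_ge0; [exact: mulr_ge0|exact: sqr_ge0].
have : 0 <= n ^+ 2 * (n - 3 / 2) / 2.
  by apply: divr_ge0 => //; apply: mulr_ge0 => //; exact: sqr_ge0.
have : 0 <= (n - 3 / 2) * n by rewrite mulr_ge0 ?subr_ge0//; lra.
rewrite expr2; lra.
Qed.

End numeric.

(** * Proof of the inequality in three cases: nu <= 12, and nu >= 12 near or far from q *)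

Section key_inequality.
Context (R : realType) (al : R).
Hypothesis hal : - (272 / 1000) <= al.
Local Notation c := (2 * al + 1).
Local Notation nu := (al + 1).
Local Notation v := (bj al).
Local Notation h := (bj (al + 1)).
Local Notation q := (bessel_zero (al + 1) 0%N).
Local Notation a1 := (acoef al).
Implicit Types (t x : R).

Let c_gt0 : 0 < c. Proof. by move: hal; lra. Qed.
Let c1_gt0 : 0 < c + 1. Proof. by rewrite addr_gt0. Qed.
Let c1_neq0 : c + 1 != 0. Proof. by rewrite gt_eqF. Qed.
Let nu_gt0 : 0 < nu. Proof. by move: c_gt0; lra. Qed.
Let q0 : 0 < q. Proof. exact: q_gt0. Qed.
Let h_Q0 : h q = 0. Proof. exact: h_bessel_zero. Qed.
Let a10 : 0 < a1. Proof. exact: acoef_gt0. Qed.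
Let V := - v q.
Let vq : v q = - V. Proof. by rewrite opprK. Qed.
Let V0 : 0 < V. Proof. exact: V_gt0. Qed.

Let v_leV t : q <= t -> - V <= v t <= V.
Proof.
move=> qt; have := v_le_q c_gt0 qt; rewrite vq normrN (ger0_norm (ltW V0)).
by rewrite ler_norml.
Qed.

Let key_at t := - (a1 * (V - v t)) <= h t <= a1 * (V + v t).

(** The bound on v' gives h^2 <= X^2 (c+1)^2 (t^2 - q^2) / (16 c t^2), and the last hypothesis says
    that the factor of X^2 is at most a1^2. *)
Let key_core t (X : R) : q <= t -> 0 <= X ->
  (t * h t / (c + 1)) ^+ 2 <= X ^+ 2 * (t ^+ 2 - q ^+ 2) / (16 * c) ->
  (c + 1) ^+ 2 * (t ^+ 2 - q ^+ 2) <= 16 * c * a1 ^+ 2 * t ^+ 2 ->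
  `|h t| <= a1 * X.
Proof.
move=> qt X0 B C; have t0 : 0 < t by exact: lt_le_trans q0 qt.
have aX0 : 0 <= a1 * X by rewrite mulr_ge0// ltW.
rewrite -ler_sqr ?nnegrE// real_normK ?num_real//.
have P0 : 0 < 16 * c * t ^+ 2 / (c + 1) ^+ 2 by rewrite divr_gt0 ?exprn_gt0// mulr_gt0 ?exprn_gt0// mulr_gt0.
rewrite -(ler_pM2l P0).
apply: le_trans (_ : X ^+ 2 * (t ^+ 2 - q ^+ 2) <= _).
  have -> : 16 * c * t ^+ 2 / (c + 1) ^+ 2 * h t ^+ 2 = 16 * c * (t * h t / (c + 1)) ^+ 2 by field.
  move: B; rewrite ler_pdivlMr ?mulr_gt0//; lra.
have -> : 16 * c * t ^+ 2 / (c + 1) ^+ 2 * (a1 * X) ^+ 2 = X ^+ 2 * ((16 * c * a1 ^+ 2 * t ^+ 2) / (c + 1) ^+ 2) by field.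
apply: ler_wpM2l; first exact: sqr_ge0.
by rewrite ler_pdivlMr ?exprn_gt0// mulrC.
Qed.

Let key_of_cond t : q <= t ->
  (c + 1) ^+ 2 * (t ^+ 2 - q ^+ 2) <= 16 * c * a1 ^+ 2 * t ^+ 2 -> key_at t.
Proof.
move=> qt C; have /andP[v1 v2] := v_leV qt.
have X1 : 0 <= V - v t by rewrite subr_ge0.
have X2 : 0 <= V + v t by lra.
have Y1 : 0 <= a1 * (V - v t) by rewrite mulr_ge0// ltW.
have Y2 : 0 <= a1 * (V + v t) by rewrite mulr_ge0// ltW.
rewrite /key_at; have [ht|ht] := leP (h t) 0.
  have := key_core qt X1 (dv_bound_down c_gt0 qt ht) C.
  by rewrite ler0_norm// => H; apply/andP; split; [lra|exact: le_trans Y2].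
have := key_core qt X2 (dv_bound_up c_gt0 qt ht) C.
by rewrite gtr0_norm// => H; apply/andP; split => //; rewrite (le_trans _ (ltW ht))// oppr_le0.
Qed.

(** [q_upper] turns q^2 + 2 nu^2 - 2 in [acoef_ge] into the perfect square 4 (nu+1)^2. *)
Let acoef_ge' : 6 * nu ^+ 2 <= a1 * (4 * (nu + 1) ^+ 2).
Proof.
apply: le_trans (acoef_ge c_gt0) _; rewrite ler_pM2l//.
have := q_upper c_gt0; rewrite [X in _ -> _ <= X]mulrC.
rewrite (expr2 (nu + 1)); have := @expr2 R nu; lra.
Qed.

(** Dropping q^2 makes the condition independent of t. Up to nu = 3/2 it rests on the Taylor bound
    for a1, above that on the Cauchy-Schwarz bound. *)
Let key_small t : q <= t -> nu <= 12 -> key_at t.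
Proof.
move=> qt n12; apply: key_of_cond => //.
have t0 : 0 < t by exact: lt_le_trans q0 qt.
have : (c + 1) ^+ 2 <= 16 * c * a1 ^+ 2; last first.
  move=> H; apply: le_trans (_ : (c + 1) ^+ 2 * t ^+ 2 <= _).
    by apply: ler_wpM2l; [exact: sqr_ge0|rewrite lerBlDr lerDl sqr_ge0].
  by rewrite ler_pM2r// exprn_gt0.
have n0 : 728 / 1000 <= nu by move: hal; lra.
have cE : c = 2 * nu - 1 by ring.
rewrite (_ : (c + 1) ^+ 2 = 4 * nu ^+ 2); last by ring.
have [n1|n1] := leP nu (3 / 2).
  have := regime_small n0 n1; have := acoef_ge_small c_gt0; rewrite cE.
  have n2 : 0 < 2 * nu - 1 by move: n0; lra.
  have B0 : 0 <= acoef_bound nu.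
    have := acoef_bound_ge n0; apply: le_trans; lra.
  move: (al + 1) a1 (acoef_bound (al + 1)) a10 nu_gt0 B0 n2 => n a B a0 n00 B0 n2 H1 H2.
  have H3 : (n / 2 * B) ^+ 2 <= a ^+ 2.
    by rewrite ler_sqr ?nnegrE ?(ltW a0)// mulr_ge0// divr_ge0// ltW.
  apply: le_trans (_ : 16 * (2 * n - 1) * (n / 2 * B) ^+ 2 <= _); last first.
    by rewrite ler_pM2l// mulr_gt0.
  have -> : 16 * (2 * n - 1) * (n / 2 * B) ^+ 2 = 4 * n ^+ 2 * ((2 * n - 1) * B ^+ 2) by field.
  by rewrite ler_peMr// mulr_ge0// sqr_ge0.
have := regime_mid (ltW n1) n12; have := acoef_ge'; rewrite cE.
have n2 : 0 < 2 * nu - 1 by move: n0; lra.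
move: (al + 1) a1 a10 nu_gt0 n2 => n a a0 n00 n2 H1 H2.
have N0 : 0 < 4 * (n + 1) ^+ 2 by rewrite mulr_gt0// exprn_gt0// addr_gt0.
have H3 : (6 * n ^+ 2) ^+ 2 <= (a * (4 * (n + 1) ^+ 2)) ^+ 2.
  by rewrite ler_sqr ?nnegrE// mulr_ge0 ?sqr_ge0 ?(ltW a0)// ltW.
have N4 : 0 < (n + 1) ^+ 4 by rewrite exprn_gt0// addr_gt0.
rewrite -(ler_pM2r N4).
have -> : 16 * (2 * n - 1) * a ^+ 2 * (n + 1) ^+ 4 = (2 * n - 1) * (a * (4 * (n + 1) ^+ 2)) ^+ 2 by ring.
apply: le_trans (_ : (2 * n - 1) * (6 * n ^+ 2) ^+ 2 <= _); last by rewrite ler_pM2l.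
have -> : (2 * n - 1) * (6 * n ^+ 2) ^+ 2 = 4 * n ^+ 2 * (9 * (2 * n - 1) * n ^+ 2) by ring.
by apply: ler_wpM2l => //; rewrite mulr_ge0 ?sqr_ge0.
Qed.

(** Within distance 5 of q, (t^2 - q^2) / t^2 <= 10 / (q + 5) <= 10 / (nu + 5); this factor
    compensates the extra power of nu on the left of the condition. *)
Let key_large_near t : q <= t -> t <= q + 5 -> 12 <= nu -> key_at t.
Proof.
move=> qt tq n12; apply: key_of_cond => //.
have t0 : 0 < t by exact: lt_le_trans q0 qt.
have nq := nu_le_q c_gt0.
have d0 : 0 <= t - q by rewrite subr_ge0.
have d5 : 0 <= 5 - (t - q) by lra.
have H1 : (t ^+ 2 - q ^+ 2) * (nu + 5) <= 10 * t ^+ 2.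
  apply: le_trans (_ : (t ^+ 2 - q ^+ 2) * (q + 5) <= _).
    by apply: ler_wpM2l; rewrite ?lerD2r// subr_ge0 ler_sqr ?nnegrE ?(ltW t0) ?(ltW q0).
  rewrite -subr_ge0.
  have -> : 10 * t ^+ 2 - (t ^+ 2 - q ^+ 2) * (q + 5) =
     2 * q ^+ 2 * (5 - (t - q)) + q * (t - q) * (5 + (5 - (t - q))) + 5 * (t - q) ^+ 2 by ring.
  apply: addr_ge0; last by rewrite mulr_ge0 ?sqr_ge0.
  apply: addr_ge0; first by apply: mulr_ge0 => //; rewrite mulr_ge0 ?sqr_ge0.
  by apply: mulr_ge0; [apply: mulr_ge0 => //; exact: ltW|apply: addr_ge0].
have n5 : 0 < nu + 5 by rewrite addr_gt0.
have N4 : 0 < (nu + 1) ^+ 4 by rewrite exprn_gt0// addr_gt0.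
have cE : c = 2 * nu - 1 by ring.
have H2 : 40 * nu ^+ 2 <= 16 * c * a1 ^+ 2 * (nu + 5).
  have H3 : (6 * nu ^+ 2) ^+ 2 <= (a1 * (4 * (nu + 1) ^+ 2)) ^+ 2.
    rewrite ler_sqr ?nnegrE; first exact: acoef_ge'.
      by rewrite mulr_ge0// sqr_ge0.
    by apply: mulr_ge0; [exact: ltW|rewrite mulr_ge0// sqr_ge0].
  move: H3 N4 n12; rewrite cE; move: (al + 1) a1 n5 => n a n5 H3 N4 n12.
  rewrite -(ler_pM2r N4).
  have n2 : 0 < 2 * n - 1 by lra.
  have -> : 16 * (2 * n - 1) * a ^+ 2 * (n + 5) * (n + 1) ^+ 4 = (2 * n - 1) * (n + 5) * (a * (4 * (n + 1) ^+ 2)) ^+ 2 by ring.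
  apply: le_trans (_ : (2 * n - 1) * (n + 5) * (6 * n ^+ 2) ^+ 2 <= _); last by rewrite ler_pM2l// mulr_gt0.
  have -> : (2 * n - 1) * (n + 5) * (6 * n ^+ 2) ^+ 2 = 4 * n ^+ 2 * (9 * n ^+ 2 * (2 * n - 1) * (n + 5)) by ring.
  have -> : 40 * n ^+ 2 * (n + 1) ^+ 4 = 4 * n ^+ 2 * (10 * (n + 1) ^+ 4) by ring.
  apply: ler_wpM2l; first by rewrite mulr_ge0// sqr_ge0.
  (* In y = n - 12 the difference has nonnegative coefficients only. *)
  have -> : n = (n - 12) + 12 by ring.
  have y0 : 0 <= n - 12 by rewrite subr_ge0.
  move: (n - 12) y0 => y y0.
  have y2 := exprn_ge0 2 y0; have y3 := exprn_ge0 3 y0; have y4 := exprn_ge0 4 y0; lra.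
rewrite -(ler_pM2l n5) (_ : (c + 1) ^+ 2 = 4 * nu ^+ 2); last by ring.
apply: le_trans (_ : 4 * nu ^+ 2 * (10 * t ^+ 2) <= _).
  have -> : (nu + 5) * (4 * nu ^+ 2 * (t ^+ 2 - q ^+ 2)) = 4 * nu ^+ 2 * ((t ^+ 2 - q ^+ 2) * (nu + 5)) by ring.
  by apply: ler_wpM2l => //; rewrite mulr_ge0// sqr_ge0.
have -> : 4 * nu ^+ 2 * (10 * t ^+ 2) = 40 * nu ^+ 2 * t ^+ 2 by ring.
have -> : (nu + 5) * (16 * c * a1 ^+ 2 * t ^+ 2) = 16 * c * a1 ^+ 2 * (nu + 5) * t ^+ 2 by ring.
by rewrite ler_pM2r// exprn_gt0.
Qed.

Let w t := t * h t / (c + 1).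
(** With w = - v' the system is an oscillator with damping c/t. The energy does not decrease where w
    = 0; the cross term repairs this and gives decay at rate 3/4 as long as c/t lies in
    [9/10, 2]. *)
Let lyap t := v t ^+ 2 - v t * w t + w t ^+ 2.

Let der_w t : 0 < t -> is_derive t 1 w (v t - c / t * w t).
Proof.
move=> t0; rewrite /w; der_with ltac:(idtac; lazymatch goal with
  | |- is_derive _ _ (fun t => bj (_ + 1) t) _ => apply: der_h => //
  | _ => exact (@der_v R al c_gt0 _) end).
by field; rewrite c1_neq0 gt_eqF.
Qed.

Let der_lyap t : 0 < t -> is_derive t 1 (fun t => expR (3 / 4 * t) * lyap t)
  (- (expR (3 / 4 * t) * (v t ^+ 2 / 4 - (c / t - 3 / 4) * (v t * w t) + (2 * (c / t) - 7 / 4) * w t ^+ 2))).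
Proof.
move=> t0; have dv : is_derive t 1 v (- w t) by exact: der_v.
have dw := der_w t0.
apply: der_eq (derM (der_exp (derM (der_cst (3 / 4) t) (der_id t)))
  (derD (derD (derX 1 dv) (derN (derM dv dw))) (derX 1 dw))) _.
by rewrite /lyap !expr1; field; rewrite gt_eqF.
Qed.

Let exp15 : 18 <= expR (3 / 4 * 5 : R).
Proof.
(* Six equal factors: 1 + x <= e^x at x = 5/8 and (13/8)^6 > 18. *)
have -> : 3 / 4 * 5 = 5 / 8 + (5 / 8 + (5 / 8 + (5 / 8 + (5 / 8 + 5 / 8)))) :> R by field.
rewrite !expRD; set e := expR _.
have e1 : 13 / 8 <= e by apply: le_trans (expR_ge1Dx _); lra.
have -> : e * (e * (e * (e * (e * e)))) = e ^+ 6 by rewrite !exprS expr0 mulr1.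
apply: le_trans (_ : (13 / 8) ^+ 6 <= _); first by rewrite !exprS expr0; lra.
by apply: lerXn2r => //; rewrite nnegrE ?expR_ge0//; lra.
Qed.

(** Over [q, q + 5] the form [lyap] drops by a factor 18, and the energy is at most twice [lyap], so
    |v| and |v'| are at most V/3 from there on. Then |h| <= 2 |v'| <= 2V/3 <= V - |v|, and a1 >=
    1. *)
Let key_large_far t : q + 5 <= t -> 12 <= nu -> key_at t.
Proof.
move=> qt n12; have nq := nu_le_q c_gt0; have t0 : 0 < t by lra.
have cE : c = 2 * nu - 1 by ring.
(* Keeps c/t >= 9/10 up to q + 5. *)
have q_up : q + 5 <= (2 * nu - 1) / (9 / 10).
  rewrite -lerBrDr -ler_sqr ?nnegrE ?(ltW q0)//; last by rewrite subr_ge0 ler_pdivlMr//; lra.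
  apply: le_trans (q_upper c_gt0) _; rewrite -subr_ge0.
  have -> : ((2 * nu - 1) / (9 / 10) - 5) ^+ 2 - 2 * (nu + 1) * (nu + 3) =
     (nu - 12) ^+ 2 * (238 / 81) + (nu - 12) * (2864 / 81) + 2635 / 81 by field.
  by have := sqr_ge0 (nu - 12); lra.
have decay : expR (3 / 4 * (q + 5)) * lyap (q + 5) <= expR (3 / 4 * q) * lyap q.
  rewrite -lerN2.
  apply: (@der_mono R (fun t => - (expR (3 / 4 * t) * lyap t))
   (fun t => expR (3 / 4 * t) * (v t ^+ 2 / 4 - (c / t - 3 / 4) * (v t * w t) + (2 * (c / t) - 7 / 4) * w t ^+ 2))
     q (q + 5) _).
  - by rewrite lerDl.
  - by move=> s /andP[qs _]; apply: contN; apply: der_cont (der_lyap _); exact: lt_le_trans qs.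
  - move=> s /andP[qs _]; rewrite -[X in is_derive _ _ _ X]opprK.
    by apply: derN; apply: der_lyap; exact: lt_trans qs.
  - move=> s /andP[qs sq]; rewrite mulr_ge0 ?expR_ge0//.
    have s0 : 0 < s by exact: lt_trans qs.
    have g1 : c / s <= 2 by rewrite ler_pdivrMr// cE; lra.
    have g2 : 9 / 10 <= c / s.
      rewrite ler_pdivlMr// cE; move: q_up; rewrite ler_pdivlMr//; lra.
    move: (c / s) (v s) (w s) g1 g2 => g x y g1 g2.
    (* After completing the square in x, the coefficient of y^2 is positive for g in [9/10, 2]. *)
    have -> : x ^+ 2 / 4 - (g - 3 / 4) * (x * y) + (2 * g - 7 / 4) * y ^+ 2 =
      (x / 2 - (g - 3 / 4) * y) ^+ 2 + ((g - 9 / 10) * (2 - g) + 6 / 10 * g - 41 / 80) * y ^+ 2 by field.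
    have : 0 <= (g - 9 / 10) * (2 - g) by rewrite mulr_ge0// subr_ge0.
    move=> G; rewrite addr_ge0 ?sqr_ge0// mulr_ge0 ?sqr_ge0//; lra.
have wq : w q = 0 by rewrite /w h_Q0 mulr0 mul0r.
have lq : lyap q = V ^+ 2 by rewrite /lyap wq vq sqrrN; ring.
have L18 : 18 * lyap (q + 5) <= V ^+ 2.
  have E : expR (3 / 4 * (q + 5)) = expR (3 / 4 * q) * expR (3 / 4 * 5) by rewrite -expRD -mulrDr.
  move: decay; rewrite E -mulrA ler_pM2l ?expR_gt0// lq => H; apply: le_trans H.
  apply: ler_wpM2r => //; rewrite /lyap.
  have -> : v (q + 5) ^+ 2 - v (q + 5) * w (q + 5) + w (q + 5) ^+ 2 =
    (v (q + 5) - w (q + 5) / 2) ^+ 2 + 3 / 4 * w (q + 5) ^+ 2 by field.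
  by rewrite addr_ge0 ?sqr_ge0// mulr_ge0 ?sqr_ge0.
have e9 : 9 * energy al t <= V ^+ 2.
  apply: le_trans L18; rewrite (_ : 18 = 9 * 2); last by ring.
  rewrite -mulrA ler_pM2l//.
  apply: le_trans (energy_noninc c_gt0 _ qt) _; first by rewrite addr_ge0// ltW.
  rewrite /energy /lyap -/(w (q + 5)) -subr_ge0.
  have -> : 2 * (v (q + 5) ^+ 2 - v (q + 5) * w (q + 5) + w (q + 5) ^+ 2) - (v (q + 5) ^+ 2 + w (q + 5) ^+ 2)
    = (v (q + 5) - w (q + 5)) ^+ 2 by ring.
  exact: sqr_ge0.
have V3 : 0 <= V / 3 by rewrite divr_ge0// ltW.
have vb : `|v t| <= V / 3.
  rewrite -ler_sqr ?nnegrE// real_normK ?num_real//.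
  have := sqr_v_le_energy al t; rewrite expr_div_n; lra.
have wb : `|w t| <= V / 3.
  rewrite -ler_sqr ?nnegrE// real_normK ?num_real//.
  have := sqr_dv_le_energy al t; rewrite -/(w t) expr_div_n; lra.
have a11 : 1 <= a1.
  have N0 : 0 < 4 * (nu + 1) ^+ 2 by rewrite mulr_gt0// exprn_gt0// addr_gt0.
  rewrite -(ler_pM2r N0) mul1r; apply: le_trans acoef_ge'; rewrite -subr_ge0.
  have -> : 6 * nu ^+ 2 - 4 * (nu + 1) ^+ 2 = 2 * (nu - 12) ^+ 2 + 40 * (nu - 12) + 188 by ring.
  by have := sqr_ge0 (nu - 12); lra.
have hb : `|h t| <= 2 * (V / 3).
  have -> : h t = (c + 1) / t * w t by rewrite /w; field; rewrite c1_neq0 gt_eqF.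
  rewrite normrM ler_pM// ger0_norm ?divr_ge0 ?ltW//.
  by rewrite ltr_pdivrMr// cE; lra.
move: vb hb; rewrite !ler_norml => /andP[v1 v2] /andP[h1 h2].
rewrite /key_at; apply/andP; split.
  rewrite lerNl; apply: le_trans (_ : 1 * (V - v t) <= _); first by lra.
  by apply: ler_wpM2r => //; lra.
apply: le_trans (_ : 1 * (V + v t) <= _); first by lra.
by apply: ler_wpM2r => //; lra.
Qed.

Lemma key_inequality t : q <= t ->
  - (a1 * (- v q - v t)) <= h t <= a1 * (- v q + v t).
Proof.
move=> qt; rewrite -/V -/(key_at t).
have [n12|n12] := leP nu 12; first exact: key_small.
have [tq|tq] := leP t (q + 5); first by apply: key_large_near => //; exact: ltW.
by apply: key_large_far; exact: ltW.
Qed.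

End key_inequality.

(** * The Fourier-Bessel system on [0, q] *)

Section fourier_bessel_system.
Context (R : realType) (al : R).
Hypothesis c_gt0 : 0 < 2 * al + 1.
Local Notation c := (2 * al + 1).
Local Notation v := (bj al).
Local Notation h := (bj (al + 1)).
Local Notation q := (bessel_zero (al + 1)).
Local Notation Q := (bessel_zero (al + 1) 0%N).
Local Notation r := (bessel_ratio al).
Implicit Types (a b s t x : R).

Let c1_gt0 : 0 < c + 1. Proof. by rewrite addr_gt0. Qed.
Let c1_neq0 : c + 1 != 0. Proof. by rewrite gt_eqF. Qed.
Let Q0 : 0 < Q. Proof. exact: q_gt0. Qed.

Local Ltac ct := cont_with ltac:(idtac; lazymatch goal with
  | |- cont (fun t => bj (_ + 1) (?s * t)) _ => refine (@cont_comp _ h (fun t => s * t) _ _ _)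
  | |- cont (fun t => bj _ (?s * t)) _ => refine (@cont_comp _ v (fun t => s * t) _ _ _)
  | |- cont (bj (_ + 1)) _ => exact (@cont_h R al c_gt0 _)
  | |- cont (fun t => bj (_ + 1) t) _ => exact (@cont_h R al c_gt0 _)
  | _ => exact (@cont_v R al c_gt0 _)
  end).
Local Ltac dr := der_with ltac:(idtac; lazymatch goal with
  | |- is_derive _ _ (fun t => bj (_ + 1) t) _ => apply: der_h => //
  | |- is_derive _ _ (fun t => bj (_ + 1) (?s * t)) _ =>
      notypeclasses refine (@der_scale _ h s _ _ _); apply: der_h => //; rewrite mulr_gt0//
  | |- is_derive _ _ (fun t => bj _ (?s * t)) _ =>
      notypeclasses refine (@der_scale _ v s _ _ _); exact (@der_v R al c_gt0 _)
  | _ => exact (@der_v R al c_gt0 _) end).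

Lemma wI_v s : 0 < s -> wI c Q (fun t => v (s * t)) = Q `^ (c + 1) * (h (s * Q) / (c + 1)).
Proof.
move=> s0; apply: (@wI_FTC _ _ _ c_gt0 Q0 _ (fun t => h (s * t) / (c + 1))).
- by move=> t; ct.
- by move=> t; ct.
- by move=> t t0; dr; field; rewrite c1_neq0 !gt_eqF// mulr_gt0.
Qed.

(** Green's identity for two solutions of different frequency. It gives orthogonality when both s Q
    and x Q are zeros of h, and the derivative of the dilated coefficient when only one of them
    is. *)
Lemma wI_vv s x : 0 < s -> 0 < x ->
  (x ^+ 2 - s ^+ 2) * wI c Q (fun t => v (s * t) * v (x * t)) =
  Q `^ (c + 1) * ((x ^+ 2 * (v (s * Q) * h (x * Q)) - s ^+ 2 * (v (x * Q) * h (s * Q))) / (c + 1)).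
Proof.
move=> s0 x0.
pose G t := (x ^+ 2 * (v (s * t) * h (x * t)) - s ^+ 2 * (v (x * t) * h (s * t))) / (c + 1).
rewrite -wIZ//; last by move=> t; ct.
apply: (@wI_FTC _ _ _ c_gt0 Q0 _ G).
- by move=> t; ct.
- by move=> t; rewrite /G; ct.
- by move=> t t0; rewrite /G; dr; field; rewrite c1_neq0 !gt_eqF// mulr_gt0.
Qed.

Lemma wI_sqr_v s : 0 < s -> h (s * Q) = 0 ->
  wI c Q (fun t => v (s * t) ^+ 2) = Q `^ (c + 1) * (v (s * Q) ^+ 2 / 2).
Proof.
move=> s0 hs.
pose G t := (v (s * t) ^+ 2 + (s * t * h (s * t) / (c + 1)) ^+ 2
   - (c - 1) / (c + 1) * (v (s * t) * h (s * t))) / 2.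
have -> : v (s * Q) ^+ 2 / 2 = G Q by rewrite /G hs; field.
apply: (@wI_FTC _ _ _ c_gt0 Q0 _ G).
- by move=> t; ct.
- by move=> t; rewrite /G; ct.
- by move=> t t0; rewrite /G; dr; rewrite !expr1; field; rewrite c1_neq0 !gt_eqF// mulr_gt0.
Qed.

(** t^c h (v - h/2) is the derivative of t^(c+1) h^2 / (2 (c+1)), which vanishes at both ends. *)
Lemma wI_hv : wI c Q (fun t => h t * v t) = wI c Q (fun t => h t ^+ 2) / 2.
Proof.
have : wI c Q (fun t => h t * v t + - 2^-1 * h t ^+ 2) = Q `^ (c + 1) * (h Q ^+ 2 / (2 * (c + 1))).
  apply: (@wI_FTC _ _ _ c_gt0 Q0 _ (fun t => h t ^+ 2 / (2 * (c + 1)))).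
  - by move=> t; ct.
  - by move=> t; ct.
  - by move=> t t0; dr; rewrite expr1; field; rewrite c1_neq0 gt_eqF.
rewrite h_bessel_zero// expr0n mul0r mulr0 wID//; [|by move=> t; ct|by move=> t; ct].
rewrite wIZ//; last by move=> t; ct.
by move=> /eqP; rewrite addr_eq0 => /eqP ->; rewrite mulNr opprK mulrC.
Qed.

Lemma bessel_ratio_gt0 k : 0 < r k.
Proof. by rewrite /bessel_ratio divr_gt0// q_gt0. Qed.

Lemma bessel_ratio0 : r 0%N = 1.
Proof. by rewrite /bessel_ratio divff// gt_eqF. Qed.

Lemma bessel_ratioM k : r k * Q = q k.
Proof. by rewrite /bessel_ratio divfK// gt_eqF. Qed.

Lemma bessel_ratio_inj i j : r i = r j -> i = j.
Proof.
move=> E; have : q i = q j by rewrite -(bessel_ratioM i) -(bessel_ratioM j) E.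
move=> qE; apply/eqP; rewrite eqn_leq -!(bessel_zero_le c_gt0) qE lexx//.
Qed.

Lemma wI_phi k : wI c Q (fun t => v (r k * t)) = 0.
Proof. by rewrite wI_v ?bessel_ratio_gt0// bessel_ratioM h_bessel_zero// mul0r mulr0. Qed.

Lemma wI_phi_sqr k : wI c Q (fun t => v (r k * t) ^+ 2) = Q `^ (c + 1) * (v (q k) ^+ 2 / 2).
Proof. by rewrite wI_sqr_v ?bessel_ratio_gt0 ?bessel_ratioM ?h_bessel_zero. Qed.

Lemma wI_phi_orth i j : i != j -> wI c Q (fun t => v (r i * t) * v (r j * t)) = 0.
Proof.
move=> ij; have := wI_vv (bessel_ratio_gt0 i) (bessel_ratio_gt0 j).
rewrite !bessel_ratioM !h_bessel_zero// !mulr0 subr0 mul0r mulr0 => /eqP; rewrite mulf_eq0 => /orP[|/eqP//].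
rewrite subr_sqr mulf_eq0 => /orP[|]; last by rewrite gt_eqF// addr_gt0 ?bessel_ratio_gt0.
by rewrite subr_eq0 => /eqP/bessel_ratio_inj ji; rewrite ji eqxx in ij.
Qed.

(* t^c (v^2 + v'^2 + c v v' / t): its logarithmic derivative is O(1/t^2). *)
Let M t := `|t| `^ c * (energy al t - c / (c + 1) * (v t * h t)).

Let der_M t : 0 < t -> is_derive t 1 M (t `^ (c - 1) * (c / (c + 1) * (v t * h t))).
Proof.
move=> t0; apply: der_eq (derM (der_apow c t0) (derD (der_energy c_gt0 t0)
  (derN (derM (der_cst (c / (c + 1)) t) (derM (der_v c_gt0 t) (der_h c_gt0 t0)))))) _.
rewrite gtr0_norm// (powR_split c t0) /energy.
by field; rewrite c1_neq0 gt_eqF.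
Qed.

Let vh_le t : 2 * c <= t -> `|c / (c + 1) * (v t * h t)| <= energy al t / 4.
Proof.
move=> ct; have t0 : 0 < t by apply: lt_le_trans ct; rewrite mulr_gt0.
have -> : c / (c + 1) * (v t * h t) = c / t * (v t * (t * h t / (c + 1))).
  by field; rewrite c1_neq0 gt_eqF.
rewrite /energy; move: (v t) (t * h t / (c + 1)) => y w.
have c0 : 0 <= c / t <= 1 / 2.
  by rewrite divr_ge0 ?(ltW t0) ?(ltW c_gt0)//= ler_pdivrMr//; lra.
rewrite normrM ger0_norm; last by case/andP: c0.
apply: le_trans (_ : 1 / 2 * `|y * w| <= _); first by rewrite ler_wpM2r//; case/andP: c0.
suff : `|y * w| <= (y ^+ 2 + w ^+ 2) / 2 by lra.
rewrite ler_norml; apply/andP; split.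
  by have := sqr_ge0 (y + w); rewrite sqrrD; lra.
by have := sqr_ge0 (y - w); rewrite sqrrB; lra.
Qed.

Let M_bounds t : 2 * c <= t ->
  3 / 4 * (t `^ c * energy al t) <= M t <= 5 / 4 * (t `^ c * energy al t).
Proof.
move=> ct; have t0 : 0 < t by apply: lt_le_trans ct; rewrite mulr_gt0.
have := vh_le ct; rewrite ler_norml /M gtr0_norm// => /andP[h1 h2].
have p0 : 0 <= t `^ c by exact: powR_ge0.
have := ler_wpM2l p0 h1; have := ler_wpM2l p0 h2; rewrite mulrBr; lra.
Qed.

(** Beyond 2c the bounds on M give |M'| <= (2c/3) M / t^2, so e^(-k/t) M is nondecreasing for k =
    2c/3; there k/t <= 1/3. *)
Let M_growth a b : 2 * c <= a -> a <= b -> M a <= expR (1 / 3) * M b.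
Proof.
move=> ca ab; have a0 : 0 < a by apply: lt_le_trans ca; rewrite mulr_gt0.
have b0 : 0 < b by exact: lt_le_trans ab.
pose k : R := 2 * c / 3.
have k0 : 0 <= k by rewrite divr_ge0// mulr_ge0// ltW.
have der_e t : 0 < t -> is_derive t 1 (fun t => expR (- (k * t^-1))) (expR (- (k * t^-1)) * (k / t ^+ 2)).
  move=> t0; apply: der_exp; apply: der_eq (derN (derM (der_cst k t) (is_deriveV _ _))) _.
    by rewrite gt_eqF.
  by rewrite /GRing.scale /=; field; rewrite gt_eqF.
have : expR (- (k * a^-1)) * M a <= expR (- (k * b^-1)) * M b.
  apply: (@der_mono R (fun t => expR (- (k * t^-1)) * M t)
    (fun t => expR (- (k * t^-1)) * (t `^ (c - 1) * (c / (c + 1) * (v t * h t))) + M t * (expR (- (k * t^-1)) * (k / t ^+ 2))) a b ab).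
  - move=> t /andP[at_ _]; have t0 : 0 < t by exact: lt_le_trans at_.
    exact: der_cont (derM (der_e _ t0) (der_M t0)).
  - move=> t /andP[at_ _]; have t0 : 0 < t by exact: lt_trans at_.
    exact: derM (der_e _ t0) (der_M t0).
  - move=> t /andP[at_ _]; have t0 : 0 < t by exact: lt_trans at_.
    have ct : 2 * c <= t by apply: le_trans ca (ltW at_).
    rewrite [M t * _]mulrCA -mulrDr mulr_ge0 ?expR_ge0//.
    have /andP[m1 _] := M_bounds ct.
    have w2 : `|c / (c + 1) * (v t * h t)| <= c / t * (energy al t / 2).
      have -> : c / (c + 1) * (v t * h t) = c / t * (v t * (t * h t / (c + 1))).
        by field; rewrite c1_neq0 gt_eqF.
      rewrite normrM ger0_norm ?divr_ge0 ?(ltW t0) ?(ltW c_gt0)// ler_wpM2l ?divr_ge0 ?(ltW t0) ?(ltW c_gt0)//.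
      rewrite /energy; move: (v t) (t * h t / (c + 1)) => y w; rewrite ler_norml; apply/andP; split.
        by have := sqr_ge0 (y + w); rewrite sqrrD; lra.
      by have := sqr_ge0 (y - w); rewrite sqrrB; lra.
    move: w2; rewrite ler_norml => /andP[w2 _].
    have p0 : 0 <= t `^ (c - 1) by exact: powR_ge0.
    have := ler_wpM2l p0 w2.
    have : k / t ^+ 2 * (3 / 4 * (t `^ c * energy al t)) <= k / t ^+ 2 * M t.
      by rewrite ler_wpM2l// divr_ge0// exprn_ge0// ltW.
    have -> : k / t ^+ 2 * (3 / 4 * (t `^ c * energy al t)) = t `^ (c - 1) * (c / t * (energy al t / 2)).
      by rewrite (powR_split c t0) /k; field; rewrite gt_eqF.
    rewrite mulrN [M t * _]mulrC; lra.
move=> H; rewrite -(ler_pM2l (expR_gt0 (- (k * a^-1)))); apply: le_trans H _.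
have Mb : 0 <= M b.
  have /andP[m1 _] := M_bounds (le_trans ca ab); apply: le_trans m1.
  by rewrite mulr_ge0// mulr_ge0 ?powR_ge0// ltW// energy_gt0// ltW.
rewrite [leRHS]mulrA ler_wpM2r// -expRD ler_expR.
have ka : k * a^-1 <= 1 / 3 by rewrite ler_pdivrMr// /k; lra.
have kb : 0 <= k * b^-1 by rewrite divr_ge0// ltW.
by lra.
Qed.

(** Uniformity in k is the point: after scaling, t^c phi_k(t)^2 on [0, q] is at most a constant
    times v(q_k)^2, so that |v(q_k)| is the natural size of phi_k. *)
Lemma amplitude_bound : exists2 C : R, 0 < C &
  forall k x, 0 < x -> x <= q k -> x `^ c * v x ^+ 2 <= C * (q k `^ c * v (q k) ^+ 2).
Proof.
pose T := 2 * c; have T0 : 0 < T by rewrite mulr_gt0.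
(* 5/3 is the quotient of the constants 5/4 and 3/4 in [M_bounds], and e^(1/3) comes from
   [M_growth]. Below T = 2c one uses |v| <= 1 and pays the factor 1 / energy(T). *)
pose C' : R := 5 / 3 * expR (1 / 3).
have e1 : 1 <= expR (1 / 3 : R) by apply: le_trans (expR_ge1Dx _); rewrite lerDl.
have C'1 : 1 <= C' by rewrite /C'; lra.
have C'0 : 0 < C' by exact: lt_le_trans C'1.
have eT0 : 0 < energy al T by rewrite energy_gt0// ltW.
have eT1 : energy al T <= 1.
  apply: le_trans (energy_noninc c_gt0 _ (ltW T0)) _ => //.
  by rewrite /energy bj0 mul0r mul0r expr0n addr0 expr1n.
have big x k : T <= x -> x <= q k -> x `^ c * energy al x <= C' * (q k `^ c * v (q k) ^+ 2).
  move=> Tx xq; have /andP[m1 _] := M_bounds Tx.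
  have /andP[_ m2] := M_bounds (le_trans Tx xq).
  have := M_growth Tx xq; rewrite energy_q// in m2.
  have := ler_wpM2l (expR_ge0 (1 / 3 : R)) m2; rewrite /C'; lra.
have X0 k : 0 < q k `^ c * v (q k) ^+ 2.
  by rewrite mulr_gt0 ?powR_gt0 ?q_gt0// exprn_even_gt0//= v_q_neq0.
have le_C k : C' * (q k `^ c * v (q k) ^+ 2) <= C' / energy al T * (q k `^ c * v (q k) ^+ 2).
  by rewrite ler_pM2r// ler_peMr ?(ltW C'0)// invf_ge1.
exists (C' / energy al T); first by rewrite divr_gt0.
move=> k x x0 xq; have [Tx|xT] := leP T x.
  apply: le_trans (le_C k); apply: le_trans (big _ _ Tx xq).
  by rewrite ler_wpM2l ?powR_ge0// sqr_v_le_energy.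
have v1 : v x ^+ 2 <= 1.
  by rewrite -(expr1n R 2) -real_normK ?num_real// lerXn2r ?nnegrE// v_le1// ltW.
have [Tq|qT] := leP T (q k).
  apply: le_trans (_ : T `^ c <= _).
    rewrite -[leRHS]mulr1 ler_pM ?powR_ge0 ?sqr_ge0// ge0_ler_powR ?nnegrE ?(ltW c_gt0) ?(ltW x0) ?(ltW T0) ?(ltW xT)//.
  have := big T k (lexx _) Tq.
  by rewrite [X in _ -> _ <= X]mulrAC ler_pdivlMr.
apply: le_trans (_ : q k `^ c * 1 <= _).
  rewrite ler_pM ?powR_ge0 ?sqr_ge0// ge0_ler_powR ?nnegrE ?(ltW c_gt0) ?(ltW x0) ?(ltW (q_gt0 c_gt0 _))//.
rewrite mulrCA ler_wpM2l ?powR_ge0//.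
rewrite mulrAC ler_pdivlMr// mul1r.
apply: le_trans (_ : 1 * v (q k) ^+ 2 <= _); last by rewrite ler_wpM2r ?sqr_ge0.
by rewrite mul1r -energy_q// energy_noninc ?(ltW (q_gt0 c_gt0 _)) ?(ltW qT).
Qed.

End fourier_bessel_system.

(** * Completeness of the Fourier-Bessel system *)

Section calculus_with_exceptions.
Context (R : realType).
Implicit Types (f g : R -> R) (x a b d e z : R).
Local Notation mu := (@lebesgue_measure R).

Lemma contV f x : cont f x -> f x != 0 -> cont (fun t => (f t)^-1) x.
Proof. by move=> cf f0; exact: cvgV. Qed.

(** The removable singularity of f / (t - z). A quotient of two such slopes continues x/f across a
    common simple zero. *)
Lemma slope_cont f z d : is_derive z 1 f d -> f z = 0 ->
  cont (fun t => if t == z then d else f t / (t - z)) z.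
Proof.
Transparent cont.
move=> [df dE] fz; rewrite /cont /prop_for /continuous_at eqxx.
Opaque cont.
have H : (fun k : R => k^-1 *: (f (k *: (1 : R) + z) - f z)) @ 0^' --> d by rewrite -dE.
move/cvgrPdist_lt : H => H; apply/cvgrPdist_lt => e e0.
have {}H := H e e0.
suff : \forall t \near z, `|d - (if t == z then d else f t / (t - z))| < e by [].
rewrite (near_shift 0 z); move: H; rewrite /dnbhs near_withinE /= => H.
apply: filterS H => k H; rewrite /= subr0.
have [k0|k0] := eqVneq k 0; first by rewrite k0 add0r eqxx subrr normr0.
rewrite -subr_eq0 addrK (negbTE k0); have := H k0; rewrite fz subr0.
by rewrite /GRing.scale /= mulr1 mulrC.
Qed.

(** Allows for the nodes of an eigenfunction, where a logarithmic derivative breaks down but the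
    function remains continuous. *)
Lemma der_mono_fin (s : seq R) f (df : R -> R) a b : a <= b ->
  (forall x, a <= x <= b -> cont f x) ->
  (forall x, a < x < b -> x \notin s -> is_derive x 1 f (df x)) ->
  (forall x, a < x < b -> x \notin s -> 0 <= df x) -> f a <= f b.
Proof.
elim: s a b => [|z s ih] a b ab cf fd d0.
  by apply: (@der_mono R f df a b ab cf) => x xab; [exact: fd|exact: d0].
have ns x : x != z -> x \notin s -> x \notin z :: s by move=> xz xs; rewrite in_cons negb_or xz.
have [az|az] := leP a z; last first.
  by apply: ih => // x /andP[ax xb] xs; [apply: fd|apply: d0]; rewrite ?ax// ns// gt_eqF// (lt_trans az).
have [zb|zb] := leP z b; last first.
  by apply: ih => // x /andP[ax xb] xs; [apply: fd|apply: d0]; rewrite ?ax// ns// lt_eqF// (lt_trans _ zb).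
apply: (@le_trans _ _ (f z)).
  apply: ih => // [x /andP[ax xz]|x /andP[ax xz] xs|x /andP[ax xz] xs].
  - by apply: cf; rewrite ax (le_trans xz).
  - by apply: fd; rewrite ?ax ?(lt_le_trans xz)// ns// lt_eqF.
  - by apply: d0; rewrite ?ax ?(lt_le_trans xz)// ns// lt_eqF.
apply: ih => // [x /andP[zx xb]|x /andP[zx xb] xs|x /andP[zx xb] xs].
- by apply: cf; rewrite xb (le_trans az).
- by apply: fd; rewrite ?xb ?(le_lt_trans az)// ns// gt_eqF.
- by apply: d0; rewrite ?xb ?(le_lt_trans az)// ns// gt_eqF.
Qed.

Lemma RI_der f a x : (forall t, cont f t) -> a < x ->
  is_derive x 1 (fun y => RI a y f) (f x).
Proof.
move=> cf ax.
have xx : x < x + 1 by rewrite ltrDl.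
have [D E] := @continuous_FTC1_closed R f a x (x + 1) xx
  (cont_integrable (fun t _ => cf t)) ax (cf x).
by split; [exact: D|rewrite -derive1E].
Qed.

End calculus_with_exceptions.

(** * Eigenfunctions, their weak equation and finite sums of them *)

Section completeness.
Context (R : realType) (al : R).
Hypothesis c_gt0 : 0 < 2 * al + 1.
Local Notation c := (2 * al + 1).
Local Notation v := (bj al).
Local Notation h := (bj (al + 1)).
Local Notation q := (bessel_zero (al + 1)).
Local Notation Q := (bessel_zero (al + 1) 0%N).
Local Notation r := (bessel_ratio al).
Local Notation W := (wI c Q).
Implicit Types (s t : R) (x y dx dy : R -> R).

Let c1_gt0 : 0 < c + 1. Proof. by rewrite addr_gt0. Qed.
Let c1_neq0 : c + 1 != 0. Proof. by rewrite gt_eqF. Qed.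
Let Q0 : 0 < Q. Proof. exact: q_gt0. Qed.

Let cvs s t : cont (fun t => v (s * t)) t.
Proof.
apply: (@cont_comp _ v (fun t => s * t)); last exact: cont_v.
exact: contM (@cont_cst _ s t) (@cont_id _ t).
Qed.

Let chs s t : cont (fun t => h (s * t)) t.
Proof.
apply: (@cont_comp _ h (fun t => s * t)); last exact: cont_h.
exact: contM (@cont_cst _ s t) (@cont_id _ t).
Qed.

Let dvs s t : is_derive t 1 (fun t => v (s * t)) (- (s ^+ 2 * t * h (s * t) / (c + 1))).
Proof. by apply: der_eq (@der_scale _ v s t _ (der_v c_gt0 _)) _; field. Qed.

Let dhs s t : 0 < s -> 0 < t ->
  is_derive t 1 (fun t => h (s * t)) ((c + 1) * (v (s * t) - h (s * t)) / t).
Proof.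
move=> s0 t0; apply: der_eq (@der_scale _ h s t _ (der_h c_gt0 _)) _; first by rewrite mulr_gt0.
by field; rewrite !gt_eqF.
Qed.

Local Ltac leaf := idtac; lazymatch goal with
  | |- cont (fun t => bj (_ + 1) (_ * t)) _ => exact (chs _ _)
  | |- cont (fun t => bj _ (_ * t)) _ => exact (cvs _ _)
  | _ => match goal with H : forall t, cont _ t |- _ => exact (H _) end end.
Local Ltac ct := cont_with leaf.

(* Index 0 is the constant eigenfunction 1 = v (0 * t). *)
Definition eigenfreq (i : nat) : R := if i is k.+1 then r k else 0.
Definition eigenfun i t : R := v (eigenfreq i * t).
Definition deigenfun i t : R := - (eigenfreq i ^+ 2 * t * h (eigenfreq i * t) / (c + 1)).
Local Notation rho := eigenfreq.
Local Notation psi := eigenfun.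
Local Notation dpsi := deigenfun.

Lemma cont_eigenfun i t : cont (psi i) t. Proof. exact: cvs. Qed.
Lemma der_eigenfun i t : is_derive t 1 (psi i) (dpsi i t). Proof. exact: dvs. Qed.
Lemma cont_deigenfun i t : cont (dpsi i) t.
Proof.
by rewrite /deigenfun; ct.
Qed.

Local Ltac leaf' := idtac; lazymatch goal with
  | |- cont (fun t => eigenfun _ t) _ => exact: cont_eigenfun
  | |- cont (fun t => deigenfun _ t) _ => exact: cont_deigenfun
  | _ => leaf end.
Local Ltac ct' := cont_with leaf'.

Lemma eigenfreq_lt i j : (i < j)%N -> rho i < rho j.
Proof.
case: i j => [|i] [|j]//= ij; first exact: bessel_ratio_gt0.
by rewrite /bessel_ratio ltr_pM2r ?invr_gt0// bessel_zero_lt.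
Qed.

Lemma eigenfreq_ge0 i : 0 <= rho i.
Proof. by case: i => //= i; exact/ltW/bessel_ratio_gt0. Qed.

(** The weak form of (t^c psi')' = - rho^2 t^c psi. The boundary terms vanish through the weight at
    0 and through psi'(Q) = 0, so x is free at both ends. *)
Lemma wI_ibp x dx i : (forall t, is_derive t 1 x (dx t)) -> (forall t, cont dx t) ->
  W (fun t => dx t * dpsi i t) = rho i ^+ 2 * W (fun t => x t * psi i t).
Proof.
move=> x' cdx; have cx t : cont x t := der_cont (x' t).
rewrite -wIZ//; last by move=> t; ct'.
case: i => [|i].
  by apply: eq_wI => t _; rewrite /deigenfun /= expr0n /= !mul0r oppr0 mulr0.
have [s s0 [hs sE]] : exists2 s : R, 0 < s & h (s * Q) = 0 /\ s = rho i.+1.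
  by exists (r i); [exact: bessel_ratio_gt0|rewrite bessel_ratioM// h_bessel_zero].
rewrite /eigenfun /deigenfun -sE; apply/eqP; rewrite -subr_eq0; apply/eqP.
have C1 t : cont (fun t => dx t * - (s ^+ 2 * t * h (s * t) / (c + 1))) t.
  by ct'.
have C2 t : cont (fun t => s ^+ 2 * (x t * v (s * t))) t.
  by ct'.
rewrite -[X in _ - X]mul1r -mulNr -wIZ// -wID//; last by move=> t; ct'.
have -> : 0 = Q `^ (c + 1) * - (s ^+ 2 / (c + 1) * (x Q * h (s * Q))) by rewrite hs !mulr0 oppr0 mulr0.
apply: (@wI_FTC _ _ _ c_gt0 Q0 _ (fun t => - (s ^+ 2 / (c + 1) * (x t * h (s * t))))).
- by move=> t; ct'.
- by move=> t; ct'.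
- move=> t t0; apply: der_eq (derN (derM (der_cst (s ^+ 2 / (c + 1)) t) (derM (x' t) (dhs s0 t0)))) _.
  by field; rewrite c1_neq0 gt_eqF.
Qed.

Let N i := W (fun t => psi i t ^+ 2).

Lemma eigenfun_norm i : N i.+1 = Q `^ (c + 1) * (v (q i) ^+ 2 / 2).
Proof. exact: wI_phi_sqr. Qed.

Lemma eigenfun_norm_gt0 i : 0 < N i.
Proof.
case: i => [|i]; last first.
  by rewrite eigenfun_norm mulr_gt0 ?powR_gt0// divr_gt0// exprn_even_gt0//= v_q_neq0.
have -> : N 0%N = Q `^ (c + 1) * (c + 1)^-1.
  apply: (@wI_FTC _ _ _ c_gt0 Q0 _ (fun t => (c + 1)^-1)).
  - by move=> t; ct'.
  - by move=> t; ct'.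
  - move=> t t0; apply: der_eq (der_cst _ t) _.
    by rewrite /eigenfun /= mul0r bj0 expr1n divff// subrr mul0r.
by rewrite mulr_gt0 ?powR_gt0// invr_gt0.
Qed.

Lemma eigenfun_orth i j : i != j -> W (fun t => psi i t * psi j t) = 0.
Proof.
case: i j => [|i] [|j]//.
- move=> _; rewrite -[RHS](wI_phi c_gt0 j); apply: eq_wI => t _.
  by rewrite /eigenfun /= mul0r bj0 mul1r.
- move=> _; rewrite -[RHS](wI_phi c_gt0 i); apply: eq_wI => t _.
  by rewrite /eigenfun /= mul0r bj0 mulr1.
- by rewrite eqSS => ij; exact: wI_phi_orth.
Qed.

Definition eigensum n (a : nat -> R) t : R := \sum_(i < n) a i * psi i t.
Definition deigensum n (a : nat -> R) t : R := \sum_(i < n) a i * dpsi i t.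
Local Notation Y := eigensum.
Local Notation dY := deigensum.
Implicit Types (a : nat -> R).

Let c_aE a i t : cont (fun t => a i * psi i t) t.
Proof. by ct'. Qed.

Let c_adE a i t : cont (fun t => a i * dpsi i t) t.
Proof. by ct'. Qed.

Lemma cont_eigensum n a t : cont (Y n a) t.
Proof. by apply: (@cont_sum R (fun i t => a i * psi i t)) => i; exact: c_aE. Qed.

Lemma cont_deigensum n a t : cont (dY n a) t.
Proof. by apply: (@cont_sum R (fun i t => a i * dpsi i t)) => i; exact: c_adE. Qed.

Lemma der_eigensum n a t : is_derive t 1 (Y n a) (dY n a t).
Proof.
apply: (@der_sum R (fun i t => a i * psi i t) (fun i t => a i * dpsi i t)) => i.
by apply: der_eq (derM (der_cst (a i) t) (der_eigenfun i t)) _; rewrite mulr0 addr0.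
Qed.

Lemma wI_eigensum x n a : (forall t, cont x t) ->
  W (fun t => x t * Y n a t) = \sum_(i < n) a i * W (fun t => x t * psi i t).
Proof.
move=> cx; transitivity (W (fun t => \sum_(i < n) a i * (x t * psi i t))).
  by apply: eq_wI => t _; rewrite mulr_sumr; apply: eq_bigr => i _; rewrite mulrCA.
rewrite (@wI_sum _ _ _ c_gt0 (fun i t => a i * (x t * psi i t)))//.
  by apply: eq_bigr => i _; rewrite wIZ// => t; ct'.
by move=> j t; ct'.
Qed.

Lemma wI_deigensum x dx n a : (forall t, is_derive t 1 x (dx t)) -> (forall t, cont dx t) ->
  W (fun t => dx t * dY n a t) = \sum_(i < n) a i * (rho i ^+ 2 * W (fun t => x t * psi i t)).
Proof.
move=> x' cdx; transitivity (W (fun t => \sum_(i < n) a i * (dx t * dpsi i t))).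
  by apply: eq_wI => t _; rewrite mulr_sumr; apply: eq_bigr => i _; rewrite mulrCA.
rewrite (@wI_sum _ _ _ c_gt0 (fun i t => a i * (dx t * dpsi i t)))//.
  apply: eq_bigr => i _; rewrite wIZ// ?(wI_ibp _ x')// => t.
  by ct'.
by move=> j s; ct'.
Qed.

Lemma wI_eigensum_eigenfun n a j : (j < n)%N -> W (fun t => Y n a t * psi j t) = a j * N j.
Proof.
move=> jn; transitivity (W (fun t => psi j t * Y n a t)).
  by apply: eq_wI => t _; rewrite mulrC.
rewrite wI_eigensum; last exact: cont_eigenfun.
rewrite (bigD1 (Ordinal jn))//= big1 ?addr0 => [|i ij].
  by congr (_ * _); apply: eq_wI => t _; rewrite expr2.
by rewrite eigenfun_orth ?mulr0//; apply: contra ij => /eqP E; apply/eqP/val_inj.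
Qed.

Lemma wI_eigensum_sqr n a : W (fun t => Y n a t ^+ 2) = \sum_(i < n) a i ^+ 2 * N i.
Proof.
transitivity (W (fun t => Y n a t * Y n a t)); first by apply: eq_wI => t _; rewrite expr2.
rewrite wI_eigensum; last exact: cont_eigensum.
by apply: eq_bigr => i _; rewrite wI_eigensum_eigenfun// mulrA expr2.
Qed.

Lemma wI_deigensum_sqr n a : W (fun t => dY n a t ^+ 2) = \sum_(i < n) a i ^+ 2 * (rho i ^+ 2 * N i).
Proof.
transitivity (W (fun t => dY n a t * dY n a t)); first by apply: eq_wI => t _; rewrite expr2.
rewrite (wI_deigensum _ _ (der_eigensum n a)); last exact: cont_deigensum.
by apply: eq_bigr => i _; rewrite wI_eigensum_eigenfun//; ring.
Qed.

Lemma wI_sqr_lin k x y : (forall t, cont x t) -> (forall t, cont y t) ->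
  W (fun t => (k * x t + y t) ^+ 2) =
  k ^+ 2 * W (fun t => x t ^+ 2) + 2 * k * W (fun t => x t * y t) + W (fun t => y t ^+ 2).
Proof.
move=> cx cy.
transitivity (W (fun t => k ^+ 2 * x t ^+ 2 + 2 * k * (x t * y t) + y t ^+ 2)).
  by apply: eq_wI => t _; ring.
have C1 t : cont (fun t => x t ^+ 2) t by ct'.
have C2 t : cont (fun t => x t * y t) t by ct'.
have C3 t : cont (fun t => y t ^+ 2) t by ct'.
have C4 t : cont (fun t => k ^+ 2 * x t ^+ 2) t by ct'.
have C5 t : cont (fun t => 2 * k * (x t * y t)) t by ct'.
by rewrite !wID// ?wIZ// => t; ct'.
Qed.

End completeness.

(** * Nodes, Rayleigh's principle and the Fourier remainder *)

Section rayleigh.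
Context (R : realType) (al : R).
Hypothesis c_gt0 : 0 < 2 * al + 1.
Local Notation c := (2 * al + 1).
Local Notation v := (bj al).
Local Notation h := (bj (al + 1)).
Local Notation q := (bessel_zero (al + 1)).
Local Notation Q := (bessel_zero (al + 1) 0%N).
Local Notation r := (bessel_ratio al).
Local Notation W := (wI c Q).
Local Notation rho := (eigenfreq al).
Local Notation psi := (eigenfun al).
Local Notation dpsi := (deigenfun al).
Local Notation Y := (eigensum al).
Local Notation dY := (deigensum al).
Local Notation N i := (W (fun t => psi i t ^+ 2)).
Implicit Types (s t : R) (x y dx dy : R -> R) (a : nat -> R).

Let c1_gt0 : 0 < c + 1. Proof. by rewrite addr_gt0. Qed.
Let c1_neq0 : c + 1 != 0. Proof. by rewrite gt_eqF. Qed.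
Let Q0 : 0 < Q. Proof. exact: q_gt0. Qed.
Let cpsi i t : cont (psi i) t. Proof. exact: cont_eigenfun. Qed.
Let cdpsi i t : cont (dpsi i) t. Proof. exact: cont_deigenfun. Qed.

Local Ltac leaf := idtac; lazymatch goal with
  | |- cont (fun t => eigenfun _ _ t) _ => exact (cpsi _ _)
  | |- cont (fun t => deigenfun _ _ t) _ => exact (cdpsi _ _)
  | |- cont (fun t => eigensum _ _ _ t) _ => exact: cont_eigensum
  | |- cont (fun t => deigensum _ _ _ t) _ => exact: cont_deigensum
  | _ => match goal with H : forall t, cont _ t |- _ => exact (H _) end end.
Local Ltac ct := cont_with leaf.

(** Node count: two zeros of v between consecutive zeros of h would enclose a further zero of h.
    Thus each interval (q_(k-1), q_k), the first one starting at 0, has at most one node z_k; where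
    it has none, the default value is harmless. *)
Lemma v_nodes : exists z : nat -> R, forall n t, 0 < t -> t < q n -> v t = 0 ->
  exists2 k, (k <= n)%N & t = z k.
Proof.
pose lo k := if k is k'.+1 then q k' else 0.
pose Z k := [set t | lo k < t < q k /\ v t = 0].
exists (fun k => xget 0 (Z k)) => n t t0 tn vt.
have ex : exists k, t < q k by exists n.
have [k tk kmin] := ex_minnP ex.
exists k; first exact: kmin.
have lok : 0 <= lo k by case: (k) => //= k'; exact: ltW (q_gt0 c_gt0 _).
have tlo : lo k < t.
  case: k tk kmin {lok} => //= k tk kmin; rewrite lt_neqAle; apply/andP; split.
    by apply/eqP => E; have := v_q_neq0 c_gt0 k; rewrite E vt eqxx.
  by rewrite leNgt; apply/negP => /kmin; rewrite ltnn.
have no (a b : R) : lo k < a -> a < b -> b < q k -> v a = 0 -> v b = 0 -> False.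
  move=> la ab bk va vb.
  have [y /andP[ay yb] hy] := h_zero_between c_gt0 (le_trans lok (ltW la)) ab va vb.
  have [j yj] := bessel_zero_surj c_gt0 (le_lt_trans lok (lt_trans la ay)) hy.
  move: (lt_trans yb bk) (lt_trans la ay); rewrite yj bessel_zero_lt//.
  case: (k) => //= k'; rewrite ltnS => jk; rewrite bessel_zero_lt// => kj.
  by have := leq_trans kj jk; rewrite ltnn.
have [/andP[xl xk] vx] : Z k (xget 0 (Z k)).
  by apply: (@xgetPex _ 0 (Z k)); exists t; split => //; rewrite tlo.
have [xt|tx|//] := ltgtP t (xget 0 (Z k)).
  by case: (no _ _ tlo xt xk vt vx).
by case: (no _ _ xl tx tk vx vt).
Qed.

Let wpsi i t : 0 < t -> is_derive t 1 (fun t => `|t| `^ c * dpsi i t)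
   (- (t `^ c * (rho i ^+ 2 * psi i t))).
Proof.
move=> t0; case: i => [|i].
  have -> : (fun t => `|t| `^ c * dpsi 0%N t) = fun=> 0.
    by apply/funext => y; rewrite /deigenfun /= expr0n /= !mul0r oppr0 mulr0.
  by apply: der_eq (der_cst 0 t) _; rewrite /= expr0n /= mul0r mulr0 oppr0.
have s0 := bessel_ratio_gt0 c_gt0 i.
rewrite /deigenfun /eigenfun /=; set s := r i in s0 *.
have st0 : 0 < s * t by rewrite mulr_gt0.
have dh := @der_scale R h s t _ (der_h c_gt0 st0).
apply: der_eq (derM (der_apow c t0) (derN (derM (derM (derM (der_cst (s ^+ 2) t) (der_id t)) dh) (der_cst (c + 1)^-1 t)))) _.
rewrite gtr0_norm// (powR_split c t0).
by field; rewrite c1_neq0 !gt_eqF.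
Qed.

(* Jacobi's identity: (w x^2 f'/f)' = w (x'^2 - r^2 x^2) - w (x' - x f'/f)^2
   for the eigenfunction f with frequency r; the boundary terms vanish. *)
Lemma jacobi i x dx : (forall t, is_derive t 1 x (dx t)) -> (forall t, cont dx t) ->
  (forall t, 0 < t -> t < Q -> psi i.+1 t = 0 -> x t = 0) ->
  rho i.+1 ^+ 2 * W (fun t => x t ^+ 2) <= W (fun t => dx t ^+ 2).
Proof.
move=> x' cdx xnode; have cx t : cont x t := der_cont (x' t).
set s := rho i.+1; set f := psi i.+1; set df := dpsi i.+1.
have s0 : 0 < s by exact: bessel_ratio_gt0.
have sQ : s * Q = q i by exact: bessel_ratioM.
have [z zP] := v_nodes.
pose nodes := [seq z k / s | k <- iota 0 i.+1].
have nodesP t : 0 < t -> t < Q -> f t = 0 -> t \in nodes.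
  move=> t0 tQ ft; have [||//|k kn E] := zP i (s * t).
  - by rewrite mulr_gt0.
  - by rewrite -sQ ltr_pM2l.
  - apply/mapP; exists k; first by rewrite mem_iota add0n ltnS.
    by rewrite -E mulrAC divff ?mul1r// gt_eqF.
have f0 : f 0 != 0 by rewrite /f /eigenfun mulr0 bj0 oner_neq0.
have fQ : f Q != 0 by rewrite /f /eigenfun sQ v_q_neq0.
have dfQ : df Q = 0 by rewrite /df /deigenfun sQ h_bessel_zero// mulr0 mul0r oppr0.
(* The term w x^2 f'/f. At a node x vanishes with f and f' does not, so x/f stays bounded and the
   remaining factor x makes p continuous with value 0, which is also what the convention 1/0 = 0
   gives. *)
pose p t := x t * (x t * (f t)^-1) * (`|t| `^ c * df t).
have cw t : cont (fun t : R => `|t| `^ c) t by exact: apow_cont.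
have f' t : is_derive t 1 f (df t) by exact: der_eigenfun.
have cf t : cont f t by exact: cpsi.
have cdf t : cont df t by exact: cdpsi.
have cp t : 0 <= t <= Q -> cont p t.
  move=> /andP[t0 tQ]; have [ft|ft] := eqVneq (f t) 0; last first.
    apply: contM; last by ct.
    by apply: contM (cx t) _; apply: contM (cx t) _; exact: contV (cf t) ft.
  have {}t0 : 0 < t by rewrite lt_neqAle t0 andbT; apply/eqP => E; move: ft; rewrite -E => /eqP; exact/negP.
  have {}tQ : t < Q by rewrite lt_neqAle tQ andbT; apply/eqP => E; move: fQ; rewrite -E ft eqxx.
  have xt := xnode _ t0 tQ ft.
  have dft : df t != 0.
    have st0 : 0 < s * t by rewrite mulr_gt0.
    have hst : h (s * t) != 0.
      apply/eqP => hz; have := v_neq0_at_zero c_gt0 st0 hz.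
      by rewrite -/(psi i.+1 t) -/f ft eqxx.
    have s1 : s != 0 by rewrite gt_eqF.
    have t1 : t != 0 by rewrite gt_eqF.
    have -> : df t = - (s ^+ 2 * t * h (s * t) / (c + 1)) by [].
    by rewrite oppr_eq0; do 3 ?[apply: mulf_neq0]; rewrite ?invr_neq0 ?expf_neq0.
  pose E u := (if u == t then dx t else x u / (u - t)) * (if u == t then df t else f u / (u - t))^-1.
  have cE : cont E t.
    apply: contM; first exact: slope_cont.
    by apply: contV; [exact: slope_cont|rewrite eqxx].
  have cM : cont (fun u => x u * E u * (`|u| `^ c * df u)) t.
    by apply: contM (contM (cx t) cE) _; ct.
  apply: eq_cont cM _ => u; rewrite /p /E; case: eqVneq => [->|ut]; first by rewrite xt !mul0r.
  congr (_ * _ * _); rewrite invf_div mulrACA mulrA -[_ / _ * _]mulrA.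
  by rewrite mulrA mulfK// subr_eq0.
pose k t := `|t| `^ c * (dx t ^+ 2 - s ^+ 2 * x t ^+ 2).
have ck t : cont k t by rewrite /k; ct.
(* Based at -1 so that J is differentiable at 0 as well. *)
pose J t := RI (- 1) t k.
have J' t : 0 <= t -> is_derive t 1 J (k t) by move=> t0; apply: RI_der => //; lra.
have mono : J 0 - p 0 <= J Q - p Q.
  apply: (@der_mono_fin R nodes (fun t => J t - p t)
    (fun t => t `^ c * (dx t - x t * (df t / f t)) ^+ 2) 0 Q (ltW Q0)).
  - move=> t /andP[t0 tQ]; apply: contD (der_cont (J' t t0)) _.
    by apply: contN; apply: cp; rewrite t0.
  - move=> t /andP[t0 tQ] tn.
    have ft : f t != 0 by apply: contra tn => /eqP; exact: nodesP.
    apply: der_eq (derD (J' t (ltW t0)) (derN (derM (derM (x' t) (derM (x' t) (is_deriveV ft (f' t)))) (wpsi i.+1 t0)))) _.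
    rewrite /k /GRing.scale /= gtr0_norm// -[r i]/s -/f -/df.
    by field.
  - by move=> t /andP[t0 tQ] _; rewrite mulr_ge0 ?powR_ge0 ?sqr_ge0.
have p00 : p 0 = 0 by rewrite /p normr0 powR0 ?gt_eqF// !(mul0r, mulr0).
have pQ0 : p Q = 0 by rewrite /p dfQ !mulr0.
have WJ : W (fun t => dx t ^+ 2 - s ^+ 2 * x t ^+ 2) = J Q - J 0.
  apply: RI_FTC => //.
  - by move=> t /andP[t0 _]; exact: der_cont (J' t t0).
  - by move=> t /andP[t0 _]; exact: J' t (ltW t0).
rewrite p00 pQ0 !subr0 -subr_ge0 -WJ in mono.
have C1 t : cont (fun t => x t ^+ 2) t by ct.
have C2 t : cont (fun t => dx t ^+ 2) t by ct.
have C3 t : cont (fun t => - s ^+ 2 * x t ^+ 2) t by ct.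
rewrite -subr_ge0; apply: le_trans mono _.
rewrite -mulNr -wIZ// -wID//; rewrite le_eqVlt; apply/orP; left; apply/eqP.
by apply: eq_wI => t _; rewrite mulNr.
Qed.

Let sqr_rho_lt i j : (i < j)%N -> rho i ^+ 2 < rho j ^+ 2.
Proof. by move=> ij; rewrite ltr_pXn2r ?nnegrE ?eigenfreq_ge0 ?eigenfreq_lt. Qed.

(* v (r_n t) has at most n + 1 nodes, so some combination of g and the n + 1
   lower eigenfunctions vanishes at all of them and [jacobi] applies. *)
Lemma rayleigh n g dg : (forall t, is_derive t 1 g (dg t)) -> (forall t, cont dg t) ->
  (forall j, (j <= n)%N -> W (fun t => g t * psi j t) = 0) ->
  rho n.+1 ^+ 2 * W (fun t => g t ^+ 2) <= W (fun t => dg t ^+ 2).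
Proof.
move=> g' cdg orth; have cg t : cont g t := der_cont (g' t).
have [z zP] := v_nodes.
pose s := rho n.+1; have s0 : 0 < s by exact: bessel_ratio_gt0.
have sQ : s * Q = q n by exact: bessel_ratioM.
pose y (i : nat) t := if i is k.+1 then psi k t else g t.
pose M : 'M[R]_(n.+2, n.+1) := \matrix_(i, j) y i (z j / s).
have : kermx M != 0.
  rewrite -mxrank_eq0 mxrank_ker subn_eq0 -ltnNge ltnS; exact: rank_leq_col.
move=> /rowV0Pn[u /sub_kermxP uM u0].
pose k := u 0 ord0; pose b (i : nat) := u 0 (inord i.+1).
pose H t := k * g t + Y n.+1 b t.
pose dH t := k * dg t + dY n.+1 b t.
have H' t : is_derive t 1 H (dH t).
  by apply: der_eq (derD (derM (der_cst k t) (g' t)) (der_eigensum c_gt0 n.+1 b t)) _; rewrite mulr0 addr0.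
have cdH t : cont dH t by rewrite /dH; ct.
have Hnode j : (j <= n)%N -> H (z j / s) = 0.
  move=> jn; have := congr1 (fun A : 'rV_n.+1 => A 0 (Ordinal (jn : (j < n.+1)%N))) uM.
  rewrite !mxE big_ord_recl !mxE /= => E; rewrite -[RHS]E /H /eigensum; congr (_ + _).
  apply: eq_bigr => i _; rewrite !mxE /= /b; congr (u 0 _ * _).
  by apply: val_inj; rewrite /= inordK ?lift0// ltnS.
have := jacobi (i := n) H' cdH; rewrite -/s => J.
have {}J : s ^+ 2 * W (fun t => H t ^+ 2) <= W (fun t => dH t ^+ 2).
  apply: J => t t0 tQ ft; have [||//|j jn E] := zP n (s * t).
  - by rewrite mulr_gt0.
  - by rewrite -sQ ltr_pM2l.
  - by rewrite (_ : t = z j / s) ?Hnode// -E mulrAC divff ?mul1r// gt_eqF.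
have cY t : cont (Y n.+1 b) t by exact: cont_eigensum.
have cdY t : cont (dY n.+1 b) t by exact: cont_deigensum.
move: J; rewrite /H /dH (wI_sqr_lin c_gt0 _ cg cY) (wI_sqr_lin c_gt0 _ cdg cdY).
rewrite wI_eigensum// (wI_deigensum c_gt0 _ _ g')// wI_eigensum_sqr// wI_deigensum_sqr//.
have -> : \sum_(i < n.+1) b i * W (fun t => g t * psi i t) = 0.
  by apply: big1 => i _; rewrite orth ?mulr0// -ltnS.
have -> : \sum_(i < n.+1) b i * (rho i ^+ 2 * W (fun t => g t * psi i t)) = 0.
  by apply: big1 => i _; rewrite orth ?mulr0// -ltnS.
rewrite !mulr0 !addr0.
set A := W (fun t => g t ^+ 2); set B := W (fun t => dg t ^+ 2) => J.
(* Orthogonality removes the cross terms, leaving T <= k^2 (B - s^2 A). As T is positive definite in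
   b, the value k = 0 would force u = 0; otherwise divide by k^2. *)
pose T := \sum_(i < n.+1) b i ^+ 2 * ((s ^+ 2 - rho i ^+ 2) * N i).
have TE : s ^+ 2 * (\sum_(i < n.+1) b i ^+ 2 * N i) - \sum_(i < n.+1) b i ^+ 2 * (rho i ^+ 2 * N i) = T.
  by rewrite mulr_sumr -sumrB; apply: eq_bigr => i _; ring.
have {}J : T <= k ^+ 2 * (B - s ^+ 2 * A) by rewrite -TE; move: J; lra.
have gap (i : 'I_n.+1) : 0 < (s ^+ 2 - rho i ^+ 2) * N i.
  by rewrite mulr_gt0 ?eigenfun_norm_gt0// subr_gt0; exact: sqr_rho_lt.
have T0 (i : 'I_n.+1) : true -> 0 <= b i ^+ 2 * ((s ^+ 2 - rho i ^+ 2) * N i).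
  by move=> _; rewrite mulr_ge0 ?sqr_ge0// ltW.
have [k0|k0] := eqVneq k 0.
  have TZ : T = 0 by apply/eqP; rewrite eq_le sumr_ge0// andbT; move: J; rewrite k0 expr0n mul0r.
  case/eqP: u0; apply/rowP => i; rewrite mxE.
  case: (unliftP ord0 i) => [j ->|->]; last exact: k0.
  have /eqP := @psumr_eq0P _ _ _ _ T0 TZ j isT.
  rewrite mulf_eq0 (gt_eqF (gap j)) orbF sqrf_eq0 => /eqP; rewrite /b => <-.
  by congr (u 0 _); apply: val_inj; rewrite /= inordK ?lift0// ltnS.
rewrite -subr_ge0 -(pmulr_rge0 _ (_ : 0 < k ^+ 2)); last by rewrite exprn_even_gt0.
by apply: le_trans J; exact: sumr_ge0.
Qed.

Section fourier.
Context (f df : R -> R).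
Hypotheses (f' : forall t, is_derive t 1 f (df t)) (cdf : forall t, cont df t).

Definition fourier_coef i : R := W (fun t => f t * psi i t) / N i.
Definition fourier_rem n t : R := f t - Y n fourier_coef t.
Local Notation A := fourier_coef.
Local Notation g := fourier_rem.
Let dg n t := df t - dY n A t.

Let cf t : cont f t. Proof. exact: der_cont (f' t). Qed.

Lemma cont_fourier_rem n t : cont (g n) t.
Proof. by rewrite /fourier_rem; ct. Qed.

Let der_rem n t : is_derive t 1 (g n) (dg n t).
Proof. by apply: derD => //; apply: derN; exact: der_eigensum. Qed.

Lemma fourier_rem_orth n j : (j < n)%N -> W (fun t => g n t * psi j t) = 0.
Proof.
move=> jn; transitivity (W (fun t => f t * psi j t + - (Y n A t * psi j t))).
  by apply: eq_wI => t _; rewrite mulrBl.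
have c1 t : cont (fun t => f t * psi j t) t by ct.
have c2 t : cont (fun t => Y n A t * psi j t) t by ct.
have -> : W (fun t => f t * psi j t + - (Y n A t * psi j t)) =
   W (fun t => f t * psi j t + (-1) * (Y n A t * psi j t)).
  by apply: eq_wI => t _; rewrite mulN1r.
have c3 t : cont (fun t => (-1) * (Y n A t * psi j t)) t by ct.
rewrite wID// wIZ// wI_eigensum_eigenfun// /fourier_coef divfK ?gt_eqF ?eigenfun_norm_gt0//.
by rewrite mulN1r subrr.
Qed.

Lemma fourier_parseval n : W (fun t => df t ^+ 2) =
  W (fun t => dg n t ^+ 2) + \sum_(i < n) A i ^+ 2 * (rho i ^+ 2 * N i).
Proof.
have cdg t : cont (dg n) t by rewrite /dg; ct.
transitivity (W (fun t => (1 * dg n t + dY n A t) ^+ 2)).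
  by apply: eq_wI => t _; rewrite mul1r /dg subrK.
rewrite wI_sqr_lin//; last by move=> t; exact: cont_deigensum.
rewrite (wI_deigensum c_gt0 _ _ (der_rem n))// wI_deigensum_sqr//.
rewrite big1 => [|i _]; last by rewrite fourier_rem_orth ?mulr0.
by rewrite expr1n mul1r mulr0 addr0.
Qed.

Lemma fourier_bessel n : \sum_(i < n) A i ^+ 2 * (rho i ^+ 2 * N i) <= W (fun t => df t ^+ 2).
Proof.
rewrite (fourier_parseval n) lerDr wI_ge0// => t _; exact: sqr_ge0.
Qed.

(** Completeness with a rate: Rayleigh's principle for the remainder, whose derivative has norm at
    most that of f' because the sine-like functions psi_i' are orthogonal to it. *)
Lemma fourier_rem_small n : rho n.+1 ^+ 2 * W (fun t => g n.+1 t ^+ 2) <= W (fun t => df t ^+ 2).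
Proof.
apply: le_trans (rayleigh (der_rem n.+1) _ _) _.
- by move=> t; rewrite /dg; ct.
- by move=> j jn; exact: fourier_rem_orth.
rewrite (fourier_parseval n.+1) lerDl sumr_ge0// => i _.
by rewrite mulr_ge0 ?sqr_ge0// mulr_ge0 ?sqr_ge0// ltW ?eigenfun_norm_gt0.
Qed.

End fourier.

End rayleigh.

(** * The extremal function *)

Section coefficient_sign.
Context (R : realType) (al : R).
Hypothesis c_gt0 : 0 < 2 * al + 1.
Local Notation c := (2 * al + 1).
Local Notation v := (bj al).
Local Notation h := (bj (al + 1)).
Local Notation q := (bessel_zero (al + 1)).
Local Notation Q := (bessel_zero (al + 1) 0%N).
Local Notation r := (bessel_ratio al).
Local Notation W := (wI c Q).
Local Notation mu := (@lebesgue_measure R).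
Implicit Types (s t x : R) (k : nat).

Let c1_gt0 : 0 < c + 1. Proof. by rewrite addr_gt0. Qed.
Let c1_neq0 : c + 1 != 0. Proof. by rewrite gt_eqF. Qed.
Let Q0 : 0 < Q. Proof. exact: q_gt0. Qed.

Lemma h_le1 t : 0 <= t -> `|h t| <= 1.
Proof. by move=> t0; apply: v_le1 => //; move: c_gt0; lra. Qed.

Lemma phi_le1 k t : 0 <= t -> `|v (r k * t)| <= 1.
Proof. by move=> t0; apply: v_le1 => //; rewrite mulr_ge0// ltW// bessel_ratio_gt0. Qed.

Lemma bessel_ratio_ge1 k : 1 <= r k.
Proof. by rewrite /bessel_ratio ler_pdivlMr// mul1r bessel_zero_le. Qed.

Let cvs s t : cont (fun t => v (s * t)) t.
Proof.
apply: (@cont_comp _ v (fun t => s * t)); last exact: cont_v.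
exact: contM (@cont_cst _ s t) (@cont_id _ t).
Qed.

Let chs s t : cont (fun t => h (s * t)) t.
Proof.
apply: (@cont_comp _ h (fun t => s * t)); last exact: cont_h.
exact: contM (@cont_cst _ s t) (@cont_id _ t).
Qed.

Local Ltac leaf := idtac; lazymatch goal with
  | |- cont (fun t => bj (_ + 1) (_ * t)) _ => exact (chs _ _)
  | |- cont (fun t => bj _ (_ * t)) _ => exact (cvs _ _)
  | |- cont (fun t => bj (_ + 1) t) _ => exact (@cont_h R al c_gt0 _)
  | |- cont (fun t => bj _ t) _ => exact (@cont_v R al c_gt0 _)
  | |- cont (fun t => `|t| `^ _) _ => exact: apow_cont
  | _ => match goal with H : forall t, cont _ t |- _ => exact (H _) end end.
Local Ltac ct := cont_with leaf.

Section dilation.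
Variable k : nat.
Local Notation phi t := (v (r k * t)).

Let f s t := `|t| `^ c * (`|s| `^ (c + 1) * h (s * t) * phi t).
Let M s := RI 0 Q (f s).

Let cf s t : cont (f s) t.
Proof. by rewrite /f; ct. Qed.

Let der_f s t : 0 < s -> 0 <= t ->
  is_derive s 1 (f ^~ t) (`|t| `^ c * ((c + 1) * s `^ c * v (s * t) * phi t)).
Proof.
move=> s0; rewrite le_eqVlt => /predU1P[<-|t0].
  have -> : f ^~ 0 = fun=> 0 by apply/funext => x; rewrite /f normr0 powR0 ?mul0r// gt_eqF.
  by apply: der_eq (der_cst _ _) _; rewrite normr0 powR0 ?mul0r// gt_eqF.
have st0 : 0 < s * t by rewrite mulr_gt0.
have dh : is_derive s 1 (fun s => h (s * t)) (t * ((c + 1) * (v (s * t) - h (s * t)) / (s * t))).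
  have -> : (fun s => h (s * t)) = (fun s => h (t * s)) by apply/funext => x; rewrite mulrC.
  have ts0 : 0 < t * s by rewrite mulrC.
  by apply: der_eq (@der_scale R h t s _ (der_h c_gt0 ts0)) _; rewrite (mulrC t s).
apply: der_eq (derM (der_cst (`|t| `^ c) s) (derM (derM (der_apow (c + 1) s0) dh) (der_cst (phi t) s))) _.
rewrite addrK (gtr0_norm s0) (_ : s `^ (c + 1) = s * s `^ c); last by rewrite (powR_split _ s0) addrK.
by field; rewrite !gt_eqF.
Qed.

Let der_M s : 0 < s -> s < 2 ->
  is_derive s 1 M (W (fun t => (c + 1) * s `^ c * v (s * t) * phi t)).
Proof.
(* K dominates the derivative in s over 0 < s < 2, an interval with s = 1 in its interior. *)
move=> s0 s2; pose K := Q `^ c * ((c + 1) * 2 `^ c).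
have K0 : 0 <= K by rewrite mulr_ge0 ?powR_ge0// mulr_ge0 ?powR_ge0// ltW.
have mB : measurable (`[0, Q]%classic : set (measurableTypeR R)) by exact: measurable_itv.
have Is : `]0, 2[%classic s by rewrite /= in_itv/= s0.
have intf x : `]0, 2[%classic x -> mu.-integrable `[0, Q] (EFin \o f x).
  by move=> _; apply: cont_integrable => t _; exact: cf.
have derf x t : `]0, 2[%classic x -> `[0, Q]%classic t -> derivable (f ^~ t) x 1.
  by rewrite /= !in_itv/= => /andP[x0 _] /andP[t0 _]; have [] := der_f x0 t0.
have derfE x t : `]0, 2[%classic x -> `[0, Q]%classic t ->
    partial1of2 f x t = `|t| `^ c * ((c + 1) * x `^ c * v (x * t) * phi t).
  by rewrite /= !in_itv/= => /andP[x0 _] /andP[t0 _]; rewrite partial1of2E; have [_ ->] := der_f x0 t0.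
have intG : mu.-integrable `[0, Q] (EFin \o (fun=> K)).
  by apply: cont_integrable => t _; exact: cont_cst.
have G_ub x t : `]0, 2[%classic x -> `[0, Q]%classic t -> `|partial1of2 f x t| <= K.
  move=> xI tI; rewrite derfE//; move: xI tI; rewrite /= !in_itv/= => /andP[x0 x2] /andP[t0 tQ].
  rewrite !normrM (ger0_norm (powR_ge0 _ _)) (ger0_norm (powR_ge0 _ _)) (gtr0_norm c1_gt0) (ger0_norm t0).
  apply: ler_pM; rewrite ?powR_ge0 ?mulr_ge0 ?powR_ge0 ?(ltW c1_gt0)//.
    by rewrite ge0_ler_powR ?nnegrE ?(ltW c_gt0) ?(ltW Q0).
  have xc0 : 0 <= (c + 1) * x `^ c by rewrite mulr_ge0 ?powR_ge0// ltW.
  have y0 := mulr_ge0 xc0 (normr_ge0 (v (x * t))).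
  rewrite -[leRHS]mulr1; apply: (ler_pM y0) => //; last exact: phi_le1.
  rewrite -[leRHS]mulr1; apply: (ler_pM xc0) => //; last by apply: v_le1 => //; rewrite mulr_ge0// ltW.
  by rewrite ler_pM2l// ge0_ler_powR ?nnegrE ?(ltW c_gt0) ?(ltW x0) ?(ltW x2).
have D := @derivable_under_integral R _ _ mu f _ mB s 0 2 Is intf derf (fun=> K) (fun=> K0) intG G_ub.
have E := @differentiation_under_integral R _ _ mu f _ mB s 0 2 Is intf derf (fun=> K) (fun=> K0) intG G_ub.
split; first exact: D.
rewrite -derive1E [LHS]E; apply: eq_Rintegral => t; rewrite inE => tI; exact: derfE.
Qed.

(* M s = int t^c s^(c+1) h(s t) phi(t) vanishes at s = 0, and its derivative is
   explicit by [wI_vv]. *)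
Lemma wI_hphi_sign : v (q k) * W (fun t => h t * phi t) <= 0.
Proof.
have rQ := bessel_ratioM c_gt0 k.
have dM s : 0 < s -> s < 1 -> v (q k) * W (fun t => (c + 1) * s `^ c * v (s * t) * phi t) <= 0.
  move=> s0 s1.
  have cvv t : cont (fun t => v (s * t) * phi t) t by ct.
  have -> : W (fun t => (c + 1) * s `^ c * v (s * t) * phi t) = (c + 1) * s `^ c * W (fun t => v (s * t) * phi t).
    by rewrite -wIZ//; apply: eq_wI => t _; rewrite !mulrA.
  have g : 0 < r k ^+ 2 - s ^+ 2.
    rewrite subr_gt0 ltr_pXn2r ?nnegrE ?(ltW s0) ?(ltW (bessel_ratio_gt0 c_gt0 _))//.
    by apply: lt_le_trans s1 _; exact: bessel_ratio_ge1.
  have := wI_vv c_gt0 s0 (bessel_ratio_gt0 c_gt0 k); rewrite rQ h_bessel_zero// !mulr0 sub0r => E.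
  rewrite mulrCA pmulr_rle0; last by rewrite mulr_gt0// powR_gt0.
  rewrite -(pmulr_rle0 _ g) mulrCA E.
  have -> : v (q k) * (Q `^ (c + 1) * (- (s ^+ 2 * (v (q k) * h (s * Q))) / (c + 1))) =
    - (Q `^ (c + 1) * s ^+ 2 * v (q k) ^+ 2 * h (s * Q) / (c + 1)) by field.
  have hs : 0 <= h (s * Q) by rewrite ltW// h_gt0 ?mulr_ge0 ?(ltW s0) ?(ltW Q0)// gtr_pMl.
  have V2 : 0 <= v (q k) ^+ 2 := sqr_ge0 _.
  have s2 : 0 <= s ^+ 2 := sqr_ge0 _.
  rewrite oppr_le0; apply: divr_ge0 (ltW c1_gt0); apply: mulr_ge0 (hs).
  by apply: mulr_ge0 (V2); apply: mulr_ge0 (s2); exact: powR_ge0.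
have M1 : M 1 = W (fun t => h t * phi t).
  by apply: eq_RI => t _; rewrite /f normr1 powR1 mul1r mul1r.
rewrite -M1.
pose K := W (fun=> 1).
have K0 : 0 <= K by apply: wI_ge0.
have Mle e : 0 < e -> e <= 1 -> `|M e| <= e * K.
  move=> e0 e1; rewrite /K -wIZ//; last by move=> t; exact: cont_cst.
  have ce t : cont (fun t => `|t| `^ c * (e * 1)) t by ct.
  have pe : e `^ (c + 1) <= e.
    by rewrite -[leRHS]powRr1 ?(ltW e0)// ger_powR ?e0// lerDr ltW.
  have b t : 0 <= t <= Q -> `|f e t| <= `|t| `^ c * (e * 1).
    move=> /andP[t0 tQ]; rewrite /f normrM (ger0_norm (powR_ge0 _ _)) ler_wpM2l ?powR_ge0//.
    rewrite -mulrA normrM gtr0_norm ?powR_gt0 ?normr_gt0 ?gt_eqF// (gtr0_norm e0).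
    apply: ler_pM => //; first exact: powR_ge0.
    rewrite normrM -[leRHS]mulr1; apply: ler_pM => //; last exact: phi_le1.
    by apply: h_le1; rewrite mulr_ge0// ltW.
  rewrite ler_norml -[X in X <= _ <= _]mulN1r /wI -RIZ//; apply/andP; split; apply: RI_le => //.
  - by move=> t _; ct.
  - by move=> t tI; rewrite mulN1r; have := b t tI; rewrite ler_norml => /andP[].
  - by move=> t tI; have := b t tI; rewrite ler_norml => /andP[].
have mono e : 0 < e -> e <= 1 -> v (q k) * M 1 <= v (q k) * M e.
  move=> e0 e1; rewrite -lerN2.
  apply: (@der_mono R (fun s => - (v (q k) * M s))
    (fun s => - (v (q k) * W (fun t => (c + 1) * s `^ c * v (s * t) * phi t))) e 1 e1).
  - move=> s /andP[es s1]; have s0 : 0 < s by exact: lt_le_trans es.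
    have s2 : s < 2 by lra.
    exact: contN (contM (@cont_cst _ _ s) (der_cont (der_M s0 s2))).
  - move=> s /andP[es s1]; have s0 : 0 < s by exact: lt_trans es.
    have s2 : s < 2 by lra.
    apply: derN; apply: der_eq (derM (der_cst (v (q k)) s) (der_M s0 s2)) _.
    by rewrite mulr0 addr0.
  - by move=> s /andP[es s1]; rewrite oppr_ge0 dM// (lt_trans e0).
rewrite leNgt; apply/negP => d0.
(* If d were positive, monotonicity would give v(q_k) M(e) >= d for all e in (0, 1], whereas |M(e)|
   <= e K. The choice e = d / L satisfies e <= 1 and |v(q_k)| e K < d. *)
pose d := v (q k) * M 1; pose L := `|v (q k)| * K + d + 1.
have {}d0 : 0 < d by [].
have vK0 : 0 <= `|v (q k)| * K by rewrite mulr_ge0.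
have L0 : 0 < L by rewrite /L; lra.
have e0 : 0 < d / L by rewrite divr_gt0.
have e1 : d / L <= 1.
  by rewrite ler_pdivrMr// mul1r /L; lra.
have := mono _ e0 e1; apply/negP; rewrite -ltNge.
apply: le_lt_trans (ler_norm _) _; rewrite normrM.
apply: le_lt_trans (_ : `|v (q k)| * (d / L * K) < _).
  by apply: ler_wpM2l => //; exact: Mle.
rewrite -/d mulrCA mulrAC ltr_pdivrMr// ltr_pM2l// /L; lra.
Qed.

End dilation.

End coefficient_sign.

(** * Series dominated by a multiple of a convergent one *)

Section dominated_series.
Context (R : realType).
Implicit Types (u b : nat -> R) (K L : R).

Lemma dominated_series_diff u b K m n : (forall k, `|u k| <= K * b k) -> (n <= m)%N ->
  `|series u m - series u n| <= K * (series b m - series b n).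
Proof.
move=> ub nm; rewrite !sub_series_geq//; apply: le_trans (ler_norm_sum _ _ _) _.
by rewrite mulr_sumr; apply: ler_sum => k _; exact: ub.
Qed.

Lemma dominated_series_cvg u b K L : (forall k, `|u k| <= K * b k) ->
  series b @ \oo --> L -> cvgn [normed series u].
Proof.
move=> ub bL; apply: (@series_le_cvg _ _ (fun k => K * b k)).
- by move=> k; exact: normr_ge0.
- by move=> k; exact: le_trans (normr_ge0 _) (ub k).
- exact: ub.
rewrite (_ : series _ = fun n => K * series b n).
  by apply: is_cvgMr; apply/cvg_ex; exists L.
by apply/funext => n; rewrite /series /= mulr_sumr.
Qed.

Lemma dominated_series_tail u b K L n : (forall k, `|u k| <= K * b k) ->
  series b @ \oo --> L -> `|limn (series u) - series u n| <= K * (L - series b n).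
Proof.
move=> ub bL; have cu := normed_cvg (dominated_series_cvg ub bL).
have C1 : (fun m => `|series u m - series u n|) @ \oo --> `|limn (series u) - series u n|.
  by apply: cvg_norm; apply: cvgB => //; exact: cvg_cst.
have C2 : (fun m => K * (series b m - series b n)) @ \oo --> K * (L - series b n).
  by apply: cvgM; [exact: cvg_cst|apply: cvgB => //; exact: cvg_cst].
apply: (ler_cvg_to C1 C2).
by near=> m; apply: dominated_series_diff => //; near: m; exact: nbhs_infty_ge.
Unshelve. all: by end_near. Qed.

(** Telescoping: 1 / (y+1)^2 <= 1/y - 1/(y+1). *)
Lemma sum_inv_sqr_le (x : R) n : 0 < x ->
  \sum_(k < n) ((x + k%:R) ^+ 2)^-1 <= (x ^+ 2)^-1 + x^-1.
Proof.
move=> x0; suff H m : \sum_(k < m.+1) ((x + k%:R) ^+ 2)^-1 <= (x ^+ 2)^-1 + x^-1 - (x + m%:R)^-1.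
  case: n => [|n]; first by rewrite big_ord0 addr_ge0// invr_ge0 ?exprn_ge0// ltW.
  by apply: le_trans (H n) _; rewrite gerBl invr_ge0 addr_ge0// ltW.
elim: m => [|m ih]; first by rewrite big_ord_recl big_ord0 !addr0 addrK.
rewrite big_ord_recr /=; apply: le_trans (lerD ih (lexx _)) _.
have m0 : 0 < x + m%:R by rewrite ltr_wpDr.
rewrite -natr1 addrA; move: (x + m%:R) m0 => y y0.
have y1 : 0 < y + 1 by rewrite addr_gt0.
rewrite -addrA lerD2l; have -> : - y^-1 + ((y + 1) ^+ 2)^-1 = - (y + 1)^-1 - (y * (y + 1) ^+ 2)^-1.
  by field; rewrite !gt_eqF.
by rewrite gerBl invr_ge0 mulr_ge0 ?exprn_ge0 ?ltW.
Qed.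

End dominated_series.

(** * The expansion of h and its error on the whole half-line *)

Section extremal_function.
Context (R : realType) (al : R).
Hypothesis c_gt0 : 0 < 2 * al + 1.
Local Notation c := (2 * al + 1).
Local Notation v := (bj al).
Local Notation h := (bj (al + 1)).
Local Notation q := (bessel_zero (al + 1)).
Local Notation Q := (bessel_zero (al + 1) 0%N).
Local Notation r := (bessel_ratio al).
Local Notation W := (wI c Q).
Local Notation rho := (eigenfreq al).
Local Notation psi := (eigenfun al).
Local Notation A := (fourier_coef al h).
Local Notation g := (fourier_rem al h).
Implicit Types (s t x : R) (k : nat).

Let c1_gt0 : 0 < c + 1. Proof. by rewrite addr_gt0. Qed.
Let Q0 : 0 < Q. Proof. exact: q_gt0. Qed.
Let al11 : -1 < al + 1. Proof. by move: c_gt0; lra. Qed.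

Let dh t := - (t / (2 * (al + 1 + 1))) * bj (al + 1 + 1) t.

Let der_h t : is_derive t 1 h (dh t). Proof. exact: bj_der. Qed.

Let cont_dh t : cont dh t.
Proof.
have c1 : cont (bj (al + 1 + 1)) t by apply: der_cont (bj_der t _); move: c_gt0; lra.
exact: contM (contN (contM (@cont_id _ t) (@cont_cst _ _ t))) c1.
Qed.

Let a k := A k.+1.
Let b k := `|a k * v (q k)|.
Let H := A 0%N.

Lemma mean_coef : H = W h / W (fun=> 1).
Proof.
rewrite /H /fourier_coef; congr (_ / _); apply: eq_wI => t _;
  by rewrite /eigenfun /= mul0r bj0 ?mulr1 ?expr1n.
Qed.

(** Bessel's inequality for h' bounds the sum of (r_k a_k v(q_k))^2, while r_k Q >= Q + k bounds
    that of r_k^(-2); the termwise inequality 2 x y <= x^2 + y^2 combines them. *)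
Lemma series_b_bounded : exists B, forall n, series b n <= B.
Proof.
pose D := W (fun t => dh t ^+ 2).
exists ((2 * D / Q `^ (c + 1) + (1 + Q)) / 2) => n.
have /(_ n.+1) := fourier_bessel c_gt0 der_h cont_dh.
rewrite big_ord_recl /= expr0n /= !(mul0r, mulr0) add0r -/D.
under eq_bigr do rewrite (eigenfun_norm c_gt0).
have p0 : 0 < Q `^ (c + 1) by rewrite powR_gt0.
have -> : \sum_(i < n) A i.+1 ^+ 2 * (r i ^+ 2 * (Q `^ (c + 1) * (v (q i) ^+ 2 / 2))) =
   Q `^ (c + 1) / 2 * \sum_(i < n) (r i * (a i * v (q i))) ^+ 2.
  by rewrite mulr_sumr; apply: eq_bigr => i _; rewrite /a; field.
move=> B1; have {}B1 : \sum_(i < n) (r i * (a i * v (q i))) ^+ 2 <= 2 * D / Q `^ (c + 1).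
  by rewrite ler_pdivlMr// mulrC; move: B1; lra.
have B2 : \sum_(i < n) (r i ^+ 2)^-1 <= 1 + Q.
  apply: le_trans (_ : \sum_(i < n) Q ^+ 2 * ((Q + i%:R) ^+ 2)^-1 <= _).
    apply: ler_sum => i _; rewrite /bessel_ratio expr_div_n invf_div.
    rewrite ler_wpM2l ?sqr_ge0// lef_pV2 ?posrE ?exprn_gt0 ?q_gt0//; last first.
      by rewrite ltr_wpDr.
    by rewrite lerXn2r ?nnegrE ?addr_ge0 ?(ltW Q0) ?(ltW (q_gt0 c_gt0 _))// bessel_zero_growth.
  rewrite -mulr_sumr; apply: le_trans (ler_wpM2l (sqr_ge0 Q) (sum_inv_sqr_le n Q0)) _.
  by rewrite le_eqVlt; apply/orP; left; apply/eqP; field; rewrite gt_eqF.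
rewrite /series /= big_mkord.
apply: le_trans (_ : \sum_(i < n) ((r i * (a i * v (q i))) ^+ 2 + (r i ^+ 2)^-1) / 2 <= _).
  apply: ler_sum => i _; rewrite /b; have r0 := bessel_ratio_gt0 c_gt0 i.
  have := sqr_ge0 (r i * `|a i * v (q i)| - (r i)^-1).
  have -> : (r i * `|a i * v (q i)| - (r i)^-1) ^+ 2 =
    (r i * `|a i * v (q i)|) ^+ 2 + (r i ^+ 2)^-1 - 2 * `|a i * v (q i)|.
    by field; rewrite gt_eqF.
  rewrite [in X in 0 <= X -> _]exprMn real_normK ?num_real// -exprMn; lra.
rewrite -mulr_suml big_split /=; lra.
Qed.

Let b_nondec : nondecreasing_seq (series b).
Proof. by apply: nondecreasing_series => k _ _; rewrite /b. Qed.

Let L := limn (series b).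

Let b_cvg : series b @ \oo --> L.
Proof.
have [B Bn] := series_b_bounded.
apply: nondecreasing_is_cvgn b_nondec _.
by exists B => _ [n _ <-]; exact: Bn.
Qed.

(* Uniform away from the origin: near 0 only t^c phi_k(t)^2 is controlled. *)
Lemma phi_bound e : 0 < e -> exists2 K, 0 < K &
  forall k t, e <= t -> `|v (r k * t)| <= K * `|v (q k)|.
Proof.
move=> e0; have [C C0 amp] := amplitude_bound c_gt0.
(* 1 + x serves as an upper bound for the square root of x. *)
pose K := 1 + C * (Q / e) `^ c.
have p0 : 0 <= C * (Q / e) `^ c by rewrite mulr_ge0 ?powR_ge0// ltW.
have K1 : 1 <= K by rewrite lerDl.
have K0 : 0 < K by exact: lt_le_trans K1.
exists K => // k t et; have t0 : 0 < t by exact: lt_le_trans et.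
have := bessel_ratioM c_gt0 k; have := amp k; have := @v_le_q _ _ c_gt0 k; have := bessel_ratio_gt0 c_gt0 k.
move: (r k) (q k) => s y s0 vy {}amp sQ.
have [tQ|Qt] := leP t Q; last first.
  apply: le_trans (vy (s * t) _) _; first by rewrite -sQ ler_pM2l// ltW.
  by rewrite ler_peMl.
have st0 : 0 < s * t by rewrite mulr_gt0.
have := amp _ st0; rewrite -{1}sQ ler_pM2l// => /(_ tQ).
rewrite -{1}sQ !powRM ?(ltW s0) ?(ltW t0) ?(ltW Q0)// -!mulrA [C * _]mulrCA ler_pM2l ?powR_gt0// => B.
rewrite -ler_sqr ?nnegrE ?mulr_ge0 ?(ltW K0)// exprMn !real_normK ?num_real//.
have te : 0 < t `^ c by rewrite powR_gt0.
rewrite -(ler_pM2l te); apply: le_trans B _.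
rewrite [leLHS]mulrA [leRHS]mulrA; apply: ler_wpM2r; first exact: sqr_ge0.
have Qe : Q `^ c = e `^ c * (Q / e) `^ c.
  by rewrite -powRM ?divr_ge0 ?(ltW e0) ?(ltW Q0)// [e * _]mulrC divfK// gt_eqF.
rewrite Qe mulrCA; apply: ler_pM; rewrite ?powR_ge0//.
  by rewrite ge0_ler_powR ?nnegrE ?(ltW c_gt0) ?(ltW e0) ?(ltW t0).
rewrite expr2; apply: le_trans (_ : K <= _); first by rewrite /K lerDr.
by rewrite ler_peMr// ltW.
Qed.

Let u t k := a k * v (r k * t).
Let F t := limn (series (u t)).

Let u_bound e K : 0 < e -> (forall k t, e <= t -> `|v (r k * t)| <= K * `|v (q k)|) ->
  forall t k, e <= t -> `|u t k| <= K * b k.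
Proof.
move=> e0 Kb t k et; rewrite /u /b !normrM mulrCA; apply: ler_wpM2l => //; exact: Kb.
Qed.

Lemma extremal_normed_cvg t : 0 < t -> cvgn [normed series (u t)].
Proof.
move=> t0; have [K K0 Kb] := phi_bound t0.
have ub k : `|u t k| <= K * b k by apply: (u_bound t0 Kb).
exact: dominated_series_cvg ub b_cvg.
Qed.

Let remE n t : g n.+1 t = h t - H - series (u t) n.
Proof.
rewrite /fourier_rem /eigensum big_ord_recl /= /eigenfun /= mul0r bj0 mulr1.
by rewrite /series /= big_mkord opprD addrA.
Qed.

(* If the limit differed from h - H at t, all remainders would be bounded away
   from 0 on a common interval, contradicting their L^2 convergence to 0. *)
Lemma extremal_eq t : 0 < t -> t <= Q -> F t = h t - H.
Proof.
move=> t0 tQ; apply/eqP; rewrite -subr_eq0; apply/negPn/negP => FD.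
pose D := h t - H - F t.
have D0 : 0 < `|D| by rewrite normr_gt0 /D -opprB oppr_eq0.
pose d := `|D| / 3; have d0 : 0 < d by rewrite divr_gt0.
have e0 : 0 < t / 2 by rewrite divr_gt0.
have [K K0 Kb] := phi_bound e0.
have ub := u_bound e0 Kb.
have [n nB] : exists n, K * (L - series b n) <= d.
  have dK : 0 < d / K by rewrite divr_gt0.
  have /cvgrPdist_le/(_ _ dK)[n _ /(_ n (leqnn n))/= nB] := b_cvg.
  exists n; rewrite mulrC -ler_pdivlMr//; exact: le_trans (ler_norm _) nB.
have bL m : series b m <= L.
  by apply: nondecreasing_cvgn_le b_nondec _ _; exact: cvgP b_cvg.
have tail s : t / 2 <= s -> forall m, (n <= m)%N -> `|g m.+1 s - g n.+1 s| <= d.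
  move=> es m nm; rewrite !remE.
  have -> : h s - H - series (u s) m - (h s - H - series (u s) n) = - (series (u s) m - series (u s) n) by ring.
  rewrite normrN; apply: le_trans (dominated_series_diff (fun k => ub s k es) nm) _; apply: le_trans nB.
  by rewrite ler_pM2l// lerD2r.
have gt : 2 * d <= `|g n.+1 t|.
  have et : t / 2 <= t by lra.
  have := dominated_series_tail n (fun k => ub t k et) b_cvg; rewrite -/(F t) => T1.
  have {}T1 := le_trans T1 nB.
  have E : D = g n.+1 t - (F t - series (u t) n) by rewrite remE /D; ring.
  have : `|D| <= `|g n.+1 t| + `|F t - series (u t) n| by rewrite E ler_normB.
  by rewrite /d in T1 *; lra.
have cg m s : cont (g m) s by exact: (cont_fourier_rem c_gt0 der_h).
have [x x1 x2] : exists2 x, t / 2 <= x < t & forall s, x <= s <= t -> 3 / 2 * d <= `|g n.+1 s|.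
  have d2 : 0 < d / 2 by rewrite divr_gt0.
  have /cvgrPdist_lt/(_ _ d2) := contP (cg n.+1 t).
  move=> /nbhs_ballP[e /= e1 eb].
  exists (Num.max (t / 2) (t - e / 2)); first by rewrite le_max lexx/= gt_max; apply/andP; split; lra.
  move=> s /andP[xs st]; have : ball t e s.
    rewrite /ball /= ger0_norm ?subr_ge0//; move: xs; rewrite ge_max => /andP[_]; lra.
  move=> /eb /= E; have := ler_normD (g n.+1 s) (g n.+1 t - g n.+1 s).
  by rewrite [X in `|X|]addrC subrK; lra.
have /andP[ex xt] := x1; have x0 : 0 < x by exact: lt_le_trans ex.
pose m0 := x `^ c * (d / 2) ^+ 2 * (t - x).
have m00 : 0 < m0 by rewrite /m0 !mulr_gt0 ?powR_gt0 ?subr_gt0// exprn_gt0// divr_gt0.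
have low m : (n <= m)%N -> m0 <= W (fun s => g m.+1 s ^+ 2).
  move=> nm; apply: RI_ge_sub => //.
  - exact: ltW.
  - exact: ltW.
  - move=> s _; apply: contM; first exact: apow_cont.
    by apply: contX; exact: cg.
  - by move=> s _; rewrite mulr_ge0 ?powR_ge0 ?sqr_ge0.
  move=> s /andP[xs st]; have s0 : 0 < s by exact: lt_le_trans xs.
  rewrite gtr0_norm//; apply: ler_pM; rewrite ?powR_ge0 ?sqr_ge0//.
    by rewrite ge0_ler_powR ?nnegrE ?(ltW c_gt0) ?(ltW x0) ?(ltW s0).
  rewrite -[leRHS]real_normK ?num_real// ler_sqr ?nnegrE ?divr_ge0 ?(ltW d0)//.
  have := x2 s; rewrite xs st => /(_ isT) T2.
  have := tail s (le_trans ex xs) m nm => T1.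
  have := ler_normB (g m.+1 s) (g m.+1 s - g n.+1 s).
  by rewrite subKr; lra.
pose Dh := W (fun t => dh t ^+ 2).
have up m : (n <= m)%N -> r m * m0 <= Dh.
  move=> nm; apply: le_trans (fourier_rem_small c_gt0 der_h cont_dh m) => /=.
  have r1 := bessel_ratio_ge1 c_gt0 m; have r0 := bessel_ratio_gt0 c_gt0 m.
  apply: ler_pM; rewrite ?(ltW r0) ?(ltW m00)//; last exact: low.
  by rewrite expr2 ler_peMr// ltW.
(* By r_m Q >= Q + m, this index makes r_m m0 exceed Dh. *)
pose m := (n + (Num.truncn (Dh / m0 * Q)).+1)%N.
have := up m (leq_addr _ _); apply/negP; rewrite -ltNge -ltr_pdivrMr// /bessel_ratio ltr_pdivlMr//.
apply: lt_le_trans (bessel_zero_growth c_gt0 m).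
have := truncnS_gt (Dh / m0 * Q); rewrite /m natrD => T1.
apply: lt_le_trans T1 _; rewrite addrA lerDr addr_ge0// ltW//.
Qed.

Lemma sign_av k : a k * v (q k) <= 0.
Proof.
rewrite /a /fourier_coef mulrAC pmulr_lle0; last by rewrite invr_gt0 eigenfun_norm_gt0.
by rewrite mulrC wI_hphi_sign.
Qed.

Lemma lim_b : L = H.
Proof.
have EF : F Q = - H by rewrite extremal_eq// h_bessel_zero// sub0r.
apply/eqP; rewrite -eqr_opp -EF /F /L -limN; last exact: cvgP b_cvg.
apply/eqP; congr (limn _); apply/funext => n; rewrite -[LHS]/(- series b n) /series /= -sumrN.
apply: eq_bigr => k _; rewrite /b /u bessel_ratioM// ler0_norm ?opprK//; exact: sign_av.
Qed.

Lemma a0_acoef : a 0%N = acoef al.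
Proof.
rewrite /a /fourier_coef /acoef eigenfun_norm//.
have -> : W (fun t => h t * psi 1%N t) = W (fun t => h t * v t).
  by apply: eq_wI => t _; rewrite /eigenfun /= bessel_ratio0// mul1r.
rewrite wI_hv//; have p0 : Q `^ (c + 1) != 0 by rewrite gt_eqF// powR_gt0.
by field; rewrite v_q_neq0.
Qed.

(** Beyond Q, splitting off the first term leaves a tail of size at most H - a_1 |v(Q)|, since the
    terms |a_k v(q_k)| sum to H. It remains to see |h - a_1 v| <= a_1 |v(Q)|, which is
    [key_inequality]. *)
Lemma extremal_bound : - (272 / 1000) <= al ->
  forall t, 0 < t -> `|h t - F t| <= H.
Proof.
move=> hal t t0; have L0 : 0 <= L by apply: le_trans (nondecreasing_cvgn_le b_nondec (cvgP _ b_cvg) 0%N); rewrite /series /= big_geq.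
have [tQ|Qt] := leP t Q; first by rewrite extremal_eq// opprB addrC subrK -lim_b ger0_norm.
have ub k : `|u t k| <= 1 * b k.
  rewrite mul1r /u /b !normrM ler_wpM2l//; apply: v_le_q => //.
  by rewrite -(bessel_ratioM c_gt0 k) ler_pM2l ?bessel_ratio_gt0// ltW.
have := dominated_series_tail 1 ub b_cvg; rewrite -/(F t) mul1r lim_b.
have -> : series (u t) 1%N = acoef al * v t.
  by rewrite /series /= big_nat1 /u a0_acoef bessel_ratio0// mul1r.
have -> : series b 1%N = acoef al * - v Q.
  by rewrite /series /= big_nat1 /b a0_acoef normrM gtr0_norm ?acoef_gt0// ltr0_norm// v_q0_lt0.
have /andP[k1 k2] := key_inequality hal (ltW Qt).
rewrite !ler_norml => /andP[f1 f2]; rewrite !mulrDr in k1 k2.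
by apply/andP; split; lra.
Qed.

End extremal_function.

(** * The lower bound *)

Section bounded_convergence.
Context (R : realType).
Local Notation mu := (@lebesgue_measure R).
Implicit Types (f : R -> R) (t x Q K : R).

Lemma cont_abs f t : cont f t -> cont (fun t => `|f t|) t.
Proof. by move=> cf; exact: cvg_norm. Qed.

Lemma ae_imp (P P' : R -> Prop) : (forall t, P t -> P' t) ->
  {ae mu, forall t, P t} -> {ae mu, forall t, P' t}.
Proof. by move=> PP'; apply: negligibleS => t /= nP Pt; apply: nP; exact: PP'. Qed.

Lemma bounded_convergence0 (e : nat -> R -> R) Q K : (forall n t, cont (e n) t) ->
  (forall n t, 0 <= t <= Q -> `|e n t| <= K) ->
  {ae mu, forall t : R, 0 <= t <= Q -> e ^~ t @ \oo --> (0 : R)} ->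
  (fun n => RI 0 Q (e n)) @ \oo --> (0 : R).
Proof.
move=> ce eK e0.
have mD : measurable (`[0, Q]%classic : set (measurableTypeR R)) by exact: measurable_itv.
have itvE t : `[0, Q]%classic t -> 0 <= t <= Q by rewrite /= in_itv.
have H1 n : measurable_fun `[0, Q] (EFin \o e n : measurableTypeR R -> \bar R).
  by have /integrableP[] := @cont_integrable R 0 Q (e n) (fun t _ => ce n t).
have H2 : measurable_fun `[0, Q] (cst 0%E : measurableTypeR R -> \bar R) by exact: measurable_cst.
have H3 : {ae mu, forall t : measurableTypeR R, `[0, Q]%classic t -> (fun n => (EFin \o e n) t) @ \oo --> (cst 0%E t : \bar R)}.
  apply: ae_imp e0 => t H tI; apply: cvg_EFin; last exact: H (itvE _ tI).
  exact: nearW.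
have H4 : mu.-integrable `[0, Q] (cst K%:E : measurableTypeR R -> \bar R).
  by apply: (@cont_integrable R 0 Q (fun=> K)) => t _; exact: cont_cst.
have H5 : {ae mu, forall (t : measurableTypeR R) n, `[0, Q]%classic t -> (`|(EFin \o e n) t| <= (cst K%:E : measurableTypeR R -> \bar R) t)%E}.
  apply: aeW => t n tI; rewrite /= lee_fin; apply: eK; exact: itvE.
have [_ _] := dominated_convergence mD H1 H2 H3 H4 H5.
by rewrite integral0 => E; apply: (@fine_cvg R nat \oo _ _ 0); exact: E.
Qed.

Lemma ae_half_itv (P : R -> Prop) : {ae lebesgue_half R, forall t, P t} ->
  {ae mu, forall t : R, 0 <= t -> P t}.
Proof.
move=> [A [mA A0 PA]].
exists (A `&` `[0, +oo[%classic); split => //; first by apply: measurableI.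
move=> t /= H; split; first by apply: PA => /= Pt; apply: H.
rewrite /= in_itv /= andbT; rewrite leNgt; apply/negP => t0; apply: H => t0'.
by have := lt_le_trans t0 t0'; rewrite ltxx.
Qed.

Lemma ae_half_pos (P : R -> Prop) : (forall t, 0 < t -> P t) -> {ae lebesgue_half R, forall t, P t}.
Proof.
move=> H; exists `]-oo, 0]%classic; split => //.
  rewrite /lebesgue_half /= /mrestr (_ : _ `&` _ = [set 0 : R]) ?lebesgue_measure_set1//.
  apply/seteqP; split => t /=; rewrite !in_itv /= ?andbT.
    by move=> [t0 t1]; apply/eqP; rewrite eq_le t0.
  by move=> ->; rewrite lexx.
by move=> t /= nP; rewrite in_itv /= leNgt; apply/negP => /H.
Qed.

End bounded_convergence.

(** * Absolute convergence almost everywhere and the vanishing mean *)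

Section lower_bound.
Context (R : realType) (al : R).
Hypothesis c_gt0 : 0 < 2 * al + 1.
Local Notation c := (2 * al + 1).
Local Notation v := (bj al).
Local Notation h := (bj (al + 1)).
Local Notation q := (bessel_zero (al + 1)).
Local Notation Q := (bessel_zero (al + 1) 0%N).
Local Notation r := (bessel_ratio al).
Local Notation W := (wI c Q).
Local Notation mu := (@lebesgue_measure R).
Local Notation phi k t := (v (r k * t)).
Implicit Types (s t x : R) (k n : nat).

Let Q0 : 0 < Q. Proof. exact: q_gt0. Qed.
Let c20 : 0 < c / 2. Proof. by rewrite divr_gt0. Qed.

Let cphi k t : cont (fun t => phi k t) t.
Proof.
apply: (@cont_comp _ v (fun t => r k * t)); last exact: cont_v.
exact: contM (@cont_cst _ (r k) t) (@cont_id _ t).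
Qed.

Local Ltac leaf := idtac; lazymatch goal with
  | |- cont (fun t => `|t| `^ _) _ => exact: apow_cont
  | |- cont (fun t => bj (_ + 1) t) _ => exact (@cont_h R al c_gt0 _)
  | |- cont (fun t => bj _ (_ * t)) _ => exact (@cphi _ _)
  | |- cont (fun t => `|_|) _ => apply: cont_abs
  | _ => first [match goal with H : forall t, cont _ t |- _ => exact (H _) end
    | match goal with H : forall n t, cont _ t |- _ => exact (H _ _) end] end.
Local Ltac ct := cont_with leaf.

Let half_sqr t : `|t| `^ c = (`|t| `^ (c / 2)) ^+ 2.
Proof. by rewrite -powR_mulrn ?powR_ge0// -powRrM divfK. Qed.

(** The power t^(c/2) extends the bound of phi_k by |v(q_k)| down to t = 0, uniformly in k. *)
Let phi_amp : exists2 B, 0 < B & exists2 C, 0 < C & forall k t, 0 <= t <= Q ->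
  `|t| `^ c * phi k t ^+ 2 <= C * v (q k) ^+ 2 /\ `|t| `^ (c / 2) * `|phi k t| <= B * `|v (q k)|.
Proof.
have [C C0 amp] := amplitude_bound c_gt0.
pose C' := C * Q `^ c; have C'0 : 0 < C' by rewrite mulr_gt0 ?powR_gt0.
exists (1 + C'); first by rewrite addr_gt0.
exists C' => // k t /andP[t0 tQ].
have B1 : `|t| `^ c * phi k t ^+ 2 <= C' * v (q k) ^+ 2.
  move: t0; rewrite le_eqVlt => /predU1P[<-|t0].
    by rewrite normr0 powR0 ?gt_eqF// mul0r mulr_ge0 ?sqr_ge0// ltW.
  have := bessel_ratioM c_gt0 k; have := amp k; have := bessel_ratio_gt0 c_gt0 k.
  move: (r k) (q k) => s y s0 {}amp sQ.
  have := amp (s * t); rewrite mulr_gt0// => /(_ isT); rewrite -{1}sQ ler_pM2l// => /(_ tQ).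
  rewrite gtr0_norm// /C' -{1}sQ !powRM ?(ltW s0) ?(ltW t0) ?(ltW Q0)//.
  by rewrite -!mulrA [C * _]mulrCA ler_pM2l ?powR_gt0// mulrA.
split => //; have C1 : 0 <= 1 + C' by rewrite addr_ge0// ltW.
have B0 : 0 <= (1 + C') * `|v (q k)| by rewrite mulr_ge0.
rewrite -ler_sqr ?nnegrE ?mulr_ge0 ?powR_ge0//.
rewrite !exprMn !real_normK ?num_real// -half_sqr; apply: le_trans B1 _.
apply: ler_wpM2r; first exact: sqr_ge0.
by rewrite sqrrD expr1n mul1r; have := sqr_ge0 C'; lra.
Qed.

Section denjoy_luzin.
Variable a : nat -> R.
Let u k t : R := a k * phi k t.
Hypothesis ae_cvg : {ae mu, forall t, 0 <= t <= Q -> cvgn [normed series (u ^~ t)]}.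
Let w n t : R := \sum_(k < n) `|u k t|.

Let cw n t : cont (w n) t.
Proof.
apply: (@cont_sum R (fun k t => `|u k t|)) => k; apply: cont_abs.
exact: contM (@cont_cst _ (a k) t) (@cphi k t).
Qed.

Let w_ge0 n t : 0 <= w n t. Proof. by apply: sumr_ge0. Qed.

Let cfrac (M : R) n t : 0 < M -> cont (fun t => w n t / (M + w n t)) t.
Proof.
move=> M0; apply: contM (@cw n t) _; apply: contV.
  by apply: contD; [exact: cont_cst|exact: cw].
by rewrite gt_eqF// ltr_pwDl.
Qed.

Let frac01 (M : R) n t : 0 < M -> 0 <= w n t / (M + w n t) <= 1.
Proof.
move=> M0; have D : 0 < M + w n t by rewrite ltr_pwDl.
by rewrite divr_ge0 ?(ltW D)//= ler_pdivrMr// mul1r lerDr ltW.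
Qed.

(** Replaces the choice of a set of nearly full measure on which the sums are bounded. Otherwise
    each M = m + 1 has a bad n; but along these the fractions are at most S(t) / (m + 1), with S(t)
    the sum of the series, and bounded convergence applies. *)
Let frac_small (d : R) : 0 < d ->
  exists2 M : R, 0 < M & forall n, RI 0 Q (fun t => w n t / (M + w n t)) <= d.
Proof.
move=> d0; apply: contrapT => no.
have ex m : exists n, d < RI 0 Q (fun t => w n t / (m.+1%:R + w n t)).
  apply: contrapT => no'; apply: no; exists m.+1%:R => // n.
  by rewrite leNgt; apply/negP => lt; apply: no'; exists n.
have [n nP] := choice ex.
have m0 m : 0 < m.+1%:R :> R by [].
have H1 m t : cont (fun t => w (n m) t / (m.+1%:R + w (n m) t)) t by exact: (@cfrac m.+1%:R (n m) t (m0 m)).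
have H2 m t : 0 <= t <= Q -> `|w (n m) t / (m.+1%:R + w (n m) t)| <= 1.
  by move=> _; have /andP[f0 f1] := frac01 (n m) t (m0 m); rewrite ger0_norm.
have H3 : {ae mu, forall t : R, 0 <= t <= Q ->
    (fun m => w (n m) t / (m.+1%:R + w (n m) t)) @ \oo --> (0 : R)}.
  apply: ae_imp ae_cvg => t H tI; have {}H := H tI.
  have wL m : w m t <= limn [normed series (u ^~ t)].
    have -> : w m t = [normed series (u ^~ t)] m.
      by rewrite -[RHS]/(\sum_(0 <= k < m) `|u k t|) big_mkord.
    apply: nondecreasing_cvgn_le => //.
    by apply: nondecreasing_series => k _ _; exact: normr_ge0.
  apply: (@squeeze_seq0 R _ (fun m => limn [normed series (u ^~ t)] * (@harmonic R m))).
    move=> m; have /andP[f0 _] := frac01 (n m) t (m0 m); rewrite f0 /=.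
    apply: ler_pM => //; first by rewrite invr_ge0 addr_ge0.
    by rewrite lef_pV2 ?posrE ?ltr_wpDr// lerDl.
  by rewrite -[X in _ --> X](mulr0 (limn [normed series (u ^~ t)])); apply: cvgM; [exact: cvg_cst|exact: cvg_harmonic].
have := bounded_convergence0 H1 H2 H3.
move=> /cvgrPdist_lt/(_ _ d0)[N _ /(_ N (leqnn N))] /=.
rewrite sub0r normrN => lt; have := lt_trans (nP N) (le_lt_trans (ler_norm _) lt).
by rewrite ltxx.
Qed.

(* Integrate sum |a_k phi_k| against the weight M / (M + sum |a_k phi_k|), which
   is close to 1 in mean by [frac_small]. *)
Lemma denjoy_luzin : exists S, forall n, \sum_(k < n) `|a k * v (q k)| <= S.
Proof.
have [B B0 [C C0 amp]] := phi_amp.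
have p0 : 0 < Q `^ (c + 1) by rewrite powR_gt0.
(* The part lost to the weight, C v(q_k)^2 d, is then half of the squared norm Q^(c+1) v(q_k)^2 / 2
   of phi_k; the other half is [be] times v(q_k)^2. *)
pose d := Q `^ (c + 1) / (4 * C); have d0 : 0 < d by rewrite divr_gt0// mulr_gt0.
have [M M0 Md] := frac_small d0.
pose be := Q `^ (c + 1) / 4; have be0 : 0 < be by rewrite divr_gt0.
exists (B * RI 0 Q (fun t => `|t| `^ (c / 2) * M) / be) => n.
rewrite ler_pdivlMr//.
have cM t : cont (fun t => M / (M + w n t)) t.
  apply: contM; first exact: cont_cst.
  apply: contV; first by apply: contD; [exact: cont_cst|exact: cw].
  by rewrite gt_eqF// ltr_pwDl.
have cf t : cont (fun t => w n t / (M + w n t)) t by exact: (@cfrac M n t M0).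
have M01 t : 0 <= M / (M + w n t).
  by rewrite divr_ge0 ?(ltW M0)// addr_ge0 ?(ltW M0).
have each k : `|a k * v (q k)| * be <= B * RI 0 Q (fun t => `|t| `^ (c / 2) * `|u k t| * (M / (M + w n t))).
  have v0 : 0 < `|v (q k)| by rewrite normr_gt0 v_q_neq0.
  have c1 t : cont (fun t => `|t| `^ c * phi k t ^+ 2) t by ct.
  have c2 t : cont (fun t => `|t| `^ c * phi k t ^+ 2 * (w n t / (M + w n t))) t by exact: contM (c1 t) (cf t).
  have c3 t : cont (fun t => `|t| `^ c * phi k t ^+ 2 * (M / (M + w n t))) t by exact: contM (c1 t) (cM t).
  have c4 t : cont (fun t => `|t| `^ (c / 2) * `|phi k t|) t by ct.
  have c5 t : cont (fun t => `|t| `^ (c / 2) * `|phi k t| * (M / (M + w n t))) t by exact: contM (c4 t) (cM t).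
  have E : RI 0 Q (fun t => `|t| `^ c * phi k t ^+ 2 * (w n t / (M + w n t))) +
     RI 0 Q (fun t => `|t| `^ c * phi k t ^+ 2 * (M / (M + w n t))) = Q `^ (c + 1) * (v (q k) ^+ 2 / 2).
    rewrite -RID// -(wI_phi_sqr c_gt0 k); apply: eq_RI => t _.
    by rewrite -mulrDr -mulrDl [w n t + M]addrC divff ?mulr1// gt_eqF// ltr_pwDl.
  have I1 : RI 0 Q (fun t => `|t| `^ c * phi k t ^+ 2 * (w n t / (M + w n t))) <= C * v (q k) ^+ 2 * d.
    apply: le_trans (_ : RI 0 Q (fun t => C * v (q k) ^+ 2 * (w n t / (M + w n t))) <= _).
      apply: RI_le => //; first by move=> t _; exact: contM (@cont_cst _ _ t) (cf t).
      move=> t tI; have [a1 _] := amp k t tI; apply: ler_wpM2r => //.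
      by have /andP[] := frac01 n t M0.
    rewrite RIZ//; apply: ler_wpM2l; last exact: Md.
    by rewrite mulr_ge0 ?sqr_ge0// ltW.
  have I2 : RI 0 Q (fun t => `|t| `^ c * phi k t ^+ 2 * (M / (M + w n t))) <=
     B * `|v (q k)| * RI 0 Q (fun t => `|t| `^ (c / 2) * `|phi k t| * (M / (M + w n t))).
    rewrite -RIZ//; apply: RI_le => //; first by move=> t _; exact: contM (@cont_cst _ _ t) (c5 t).
    move=> t tI; have [_ a2] := amp k t tI; rewrite [leRHS]mulrA; apply: ler_wpM2r => //.
    have y0 : 0 <= `|t| `^ (c / 2) * `|phi k t| by rewrite mulr_ge0 ?powR_ge0.
    rewrite half_sqr -[X in _ * X]real_normK ?num_real// -exprMn expr2; exact: (ler_wpM2r y0 a2).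
  have I3 : `|v (q k)| * be <= B * RI 0 Q (fun t => `|t| `^ (c / 2) * `|phi k t| * (M / (M + w n t))).
    rewrite -(ler_pM2l v0) mulrA -expr2 real_normK ?num_real//.
    have Ed : C * v (q k) ^+ 2 * d = be * v (q k) ^+ 2 by rewrite /d /be; field; rewrite gt_eqF.
    rewrite Ed /be in I1; rewrite [leRHS]mulrCA [leRHS]mulrA; apply: le_trans _ I2.
    move: I1 E; rewrite /be; set X := RI _ _ _; set Y := RI _ _ _; lra.
  rewrite normrM -mulrA; apply: le_trans (ler_wpM2l (normr_ge0 (a k)) I3) _.
  rewrite mulrCA ler_pM2l// -RIZ// le_eqVlt; apply/orP; left; apply/eqP.
  by apply: eq_RI => t _; rewrite /u normrM; ring.
rewrite mulr_suml; apply: le_trans (_ : \sum_(k < n) B * RI 0 Q (fun t => `|t| `^ (c / 2) * `|u k t| * (M / (M + w n t))) <= _).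
  by apply: ler_sum => k _; exact: each.
rewrite -mulr_sumr ler_pM2l//.
have c6 k t : cont (fun t => `|t| `^ (c / 2) * `|u k t| * (M / (M + w n t))) t.
  by apply: contM (cM t); rewrite /u; ct.
rewrite -(RI_sum _ (F := fun k t => `|t| `^ (c / 2) * `|u k t| * (M / (M + w n t))))//.
apply: RI_le.
- by move=> t _; exact: (@cont_sum R (fun k t => `|t| `^ (c / 2) * `|u k t| * (M / (M + w n t)))).
- by move=> t _; ct.
- move=> t _; rewrite -mulr_suml -mulr_sumr -/(w n t) -mulrA ler_wpM2l ?powR_ge0//.
  rewrite mulrCA ler_piMr ?(ltW M0)//.
  by have /andP[] := frac01 n t M0.
Qed.

End denjoy_luzin.

(** F itself is never integrated. The functions e_n are the positive parts of t^c (h - S_n - N) for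
    the partial sums S_n; they are bounded through [denjoy_luzin] and tend to 0 almost everywhere,
    while W(S_n) = 0 for every n. *)
Lemma mean_lower_bound (a : nat -> R) (F : R -> R) (N : R) :
  {ae mu, forall t, 0 <= t -> [/\ cvgn [normed series (fun k => a k * phi k t)],
     series (fun k => a k * phi k t) @ \oo --> F t & `|h t - F t| <= N]} ->
  W h <= N * W (fun=> 1).
Proof.
move=> aeF.
have [S SP] : exists S, forall n, \sum_(k < n) `|a k * v (q k)| <= S.
  by apply: denjoy_luzin; apply: ae_imp aeF => t H /andP[t0 _]; have [] := H t0.
have [B B0 [C C0 amp]] := phi_amp.
pose y n t := `|t| `^ c * (h t - \sum_(k < n) a k * phi k t - N).
pose e n t := (y n t + `|y n t|) / 2.
have cS n t : cont (fun t => \sum_(k < n) a k * phi k t) t.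
  by apply: (@cont_sum R (fun k t => a k * phi k t)) => k; ct.
have cy n t : cont (y n) t by rewrite /y; ct.
have ce n t : cont (e n) t by rewrite /e; ct.
have e_ge n t : y n t <= e n t by rewrite /e; have := ler_norm (y n t); lra.
pose K := Q `^ c * (1 + `|N|) + Q `^ (c / 2) * (B * S).
have eK n t : 0 <= t <= Q -> `|e n t| <= K.
  move=> tI; have /andP[t0 tQ] := tI.
  apply: le_trans (_ : `|y n t| <= _).
    rewrite /e normrM [`|2^-1|]gtr0_norm// ler_pdivrMr//.
    by apply: le_trans (ler_normD _ _) _; rewrite normr_id; lra.
  rewrite /y -addrA [- _ + _]addrC addrA mulrDr mulrN; apply: le_trans (ler_normB _ _) _.
  apply: lerD.
    rewrite normrM ger0_norm ?powR_ge0//; apply: ler_pM; rewrite ?powR_ge0//.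
      by rewrite ge0_ler_powR ?nnegrE ?(ltW c_gt0) ?(ltW Q0)// ger0_norm.
    by apply: le_trans (ler_normB _ _) _; rewrite lerD2r h_le1.
  rewrite half_sqr expr2 -mulrA normrM; apply: ler_pM => //.
    rewrite ger0_norm ?powR_ge0// ge0_ler_powR ?nnegrE ?(ltW c20) ?(ltW Q0)// ger0_norm//.
  rewrite mulr_sumr; apply: le_trans (ler_norm_sum _ _ _) _.
  apply: le_trans (_ : B * \sum_(k < n) `|a k * v (q k)| <= _); last by rewrite ler_pM2l.
  rewrite mulr_sumr; apply: ler_sum => k _; rewrite mulrCA !normrM mulrCA.
  rewrite (ger0_norm (powR_ge0 _ _)) mulrCA [leRHS]mulrCA; apply: ler_wpM2l => //.
  by have [_] := amp k t tI.
have aee : {ae mu, forall t : R, 0 <= t <= Q -> e ^~ t @ \oo --> (0 : R)}.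
  apply: ae_imp aeF => t H /andP[t0 _]; have [_ SF hF] := H t0.
  pose z := `|t| `^ c * (h t - F t - N).
  have yz : y ^~ t @ \oo --> z.
    apply: cvgM; first exact: cvg_cst.
    apply: cvgB; last exact: cvg_cst.
    apply: cvgB; first exact: cvg_cst.
    by move: SF; rewrite /series /=; under eq_fun do rewrite big_mkord.
  have z0 : (z + `|z|) / 2 = 0.
    rewrite ler0_norm ?subrr ?mul0r// /z mulr_ge0_le0 ?powR_ge0// subr_le0.
    exact: le_trans (ler_norm _) hF.
  rewrite -z0; apply: cvgM; last exact: cvg_cst.
  by apply: cvgD => //; exact: cvg_norm.
have lim0 := bounded_convergence0 ce eK aee.
have low n : W h - N * W (fun=> 1) <= RI 0 Q (e n).
  apply: le_trans (_ : RI 0 Q (y n) <= _); last by apply: RI_le.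
  have ch t : cont h t by exact: cont_h.
  have c1 t : cont (fun t => - \sum_(k < n) a k * phi k t) t by ct.
  have c2 t : cont (fun t : R => - N) t by ct.
  rewrite -[RI 0 Q (y n)]/(W (fun t => h t + - \sum_(k < n) a k * phi k t + - N)).
  have c3 t : cont (fun t => h t + - \sum_(k < n) a k * phi k t) t by ct.
  rewrite !wID//.
  have -> : W (fun t => - \sum_(k < n) a k * phi k t) = 0.
    transitivity (W (fun t => \sum_(k < n) - a k * phi k t)).
      by apply: eq_wI => t _; rewrite -sumrN; apply: eq_bigr => k _; rewrite mulNr.
    rewrite (@wI_sum _ _ _ c_gt0 (fun k t => - a k * phi k t))//; last by move=> k t; ct.
    by apply: big1 => k _; rewrite wIZ// wI_phi// mulr0.
  have -> : W (fun=> - N) = - (N * W (fun=> 1)).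
    rewrite -mulNr -wIZ//; last by move=> t; exact: cont_cst.
    by apply: eq_wI => t _; rewrite mulr1.
  by rewrite addr0.
rewrite -subr_le0; apply: (ler_cvg_to _ lim0).
  exact: cvg_cst.
exact: nearW.
Qed.

End lower_bound.

(** * Conclusion *)

Section hypergeometric.
Context (R : realType) (al : R).
Hypothesis c_gt0 : 0 < 2 * al + 1.
Local Notation c := (2 * al + 1).
Local Notation nu := (al + 1).
Local Notation h := (bj (al + 1)).
Local Notation Q := (bessel_zero (al + 1) 0%N).
Local Notation W := (wI c Q).
Implicit Types (t x : R) (k : nat).

Let c1_gt0 : 0 < c + 1. Proof. by rewrite addr_gt0. Qed.
Let c1_neq0 : c + 1 != 0. Proof. by rewrite gt_eqF. Qed.
Let nu_gt0 : 0 < nu. Proof. by move: c_gt0; lra. Qed.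
Let nu1 : -1 < nu. Proof. by move: c_gt0; lra. Qed.
Let Q0 : 0 < Q. Proof. exact: q_gt0. Qed.

Let d k := nu / (k%:R + nu) * bcoef nu k.

Let nuk k : 0 < k%:R + nu. Proof. by rewrite ltr_wpDl. Qed.

Let d_dom : fact_dominated d.
Proof.
have [M HM] := bcoef_dom nu1; exists M => k; apply: le_trans (HM k).
rewrite /d normrM ler_piMl// gtr0_norm ?divr_gt0// ler_pdivrMr// mul1r lerDr//.
Qed.

(** Rests on (nu)_k / (nu+1)_k = nu / (nu+k). *)
Lemma hypergeometric_psum x :
  hypergeometric_1F2 nu (al + 2) (al + 2) (- x) = psum d x.
Proof.
rewrite /hypergeometric_1F2 /psum /pseries; congr (limn (series _)); apply/funext => k.
have -> : al + 2 = nu + 1 by ring.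
have p1 : pochhammer (nu + 1) k != 0 by rewrite gt_eqF// pochhammer_gt0// addr_gt0.
have : (k%:R + nu) * pochhammer nu k = nu * pochhammer (nu + 1) k.
  by rewrite -pochhammerS pochhammer_recr mulrC [nu + _]addrC.
move=> E; have {E} -> : pochhammer nu k = nu / (k%:R + nu) * pochhammer (nu + 1) k.
  by apply: (mulfI (lt0r_neq0 (nuk k))); rewrite E; field; rewrite gt_eqF.
have f0 : k`!%:R != 0 :> R by rewrite pnatr_eq0 -lt0n fact_gt0.
rewrite -[RHS]/(d k * x ^+ k) /d /bcoef -[- x]mulN1r exprMn; field.
by rewrite p1 f0 gt_eqF.
Qed.

Lemma wI1 : W (fun=> 1) = Q `^ (c + 1) * (c + 1)^-1.
Proof.
apply: (@wI_FTC _ _ _ c_gt0 Q0 _ (fun t => (c + 1)^-1)).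
- by move=> t; exact: cont_cst.
- by move=> t; exact: cont_cst.
- by move=> t t0; apply: der_eq (der_cst _ t) _; rewrite divff// subrr mul0r.
Qed.

(** On functions of x = t^2/4, t d/dt is 2 x d/dx. Since x d/dx + nu sends the series with
    coefficients d to nu h, the antiderivative of t^c h is t^(c+1) / (c+1) times that series. *)
Lemma wI_h : W h = Q `^ (c + 1) * (hypergeometric_1F2 nu (al + 2) (al + 2) (- (Q ^+ 2 / 4)) / (c + 1)).
Proof.
pose G t := psum d (t ^+ 2 / 4) / (c + 1).
have G' t : is_derive t 1 G ((psum (pseries_diffs d) (t ^+ 2 / 4) * (t / 2)) / (c + 1)).
  apply: der_eq (derM (@der_comp _ _ (fun t => t ^+ 2 / 4) t _ _ (psum_der _ d_dom) (der_sqr4 t)) (der_cst (c + 1)^-1 t)) _.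
  by rewrite mulr0 add0r mulrC.
rewrite hypergeometric_psum; apply: (@wI_FTC _ _ _ c_gt0 Q0 _ G).
- by move=> t; exact: cont_h.
- by move=> t; exact: der_cont (G' t).
- move=> t t0; apply: der_eq (G' t) _.
  have E := @psum_euler R d (fun k => nu * bcoef nu k) nu (t ^+ 2 / 4) d_dom.
  have {}E : nu * h t = t ^+ 2 / 4 * psum (pseries_diffs d) (t ^+ 2 / 4) + nu * psum d (t ^+ 2 / 4).
    rewrite -E => [|k]; first by rewrite psumZ//; exact: bcoef_dom.
    by rewrite /d; field; rewrite gt_eqF.
  have -> : h t = (t ^+ 2 / 4 * psum (pseries_diffs d) (t ^+ 2 / 4) + nu * psum d (t ^+ 2 / 4)) / nu.
    by rewrite -E mulrAC divff ?mul1r// gt_eqF.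
  rewrite /G; have c1E : c + 1 = 2 * nu by ring.
  by rewrite c1E; field; rewrite !gt_eqF.
Qed.

Lemma mean_hypergeometric :
  W h / W (fun=> 1) = hypergeometric_1F2 nu (al + 2) (al + 2) (- (Q ^+ 2 / 4)).
Proof.
rewrite wI_h wI1; have p0 : Q `^ (c + 1) != 0 by rewrite gt_eqF// powR_gt0.
by field; rewrite p0 c1_neq0.
Qed.

Lemma wI1_gt0 : 0 < W (fun=> 1).
Proof. by rewrite wI1 mulr_gt0 ?powR_gt0// invr_gt0. Qed.

End hypergeometric.

(** * Both bounds for the distance in the essential supremum norm *)

Section best_approximation.
Context (R : realType) (al : R).
Hypothesis hal : - (272 / 1000) <= al.
Local Notation c := (2 * al + 1).
Local Notation v := (bj al).
Local Notation h := (bj (al + 1)).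
Local Notation Q := (bessel_zero (al + 1) 0%N).
Local Notation r := (bessel_ratio al).
Local Notation W := (wI c Q).
Local Notation mu := (@lebesgue_half R).
Local Notation a k := (fourier_coef al h k.+1).
Implicit Types (t : R) (k n : nat).

Let c_gt0 : 0 < c. Proof. by move: hal; lra. Qed.
Let al1 : -1 < al. Proof. by move: hal; lra. Qed.
Let al11 : -1 < al + 1. Proof. by move: hal; lra. Qed.
Let H := fourier_coef al h 0.

(** The norm of exponent +oo unfolds to the essential supremum once the whole space has positive
    measure. *)
Let mu_gt0 : (0 < mu [set: R])%E.
Proof.
rewrite /lebesgue_half /= /mrestr setTI.
rewrite lebesgue_measure_itv /= ltry.
by rewrite addye.
Qed.

Let LnormE (f : R -> \bar R) : Lnorm mu +oo%E f = ess_sup mu (abse \o f).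
Proof. by rewrite unlock mu_gt0. Qed.

(** Cut off to t > 0, where convergence is known, so that it is everywhere a pointwise limit of
    measurable functions. *)
Let F0 t := \1_(`]0, +oo[%classic : set R) t *
  limn (series (fun k => a k * v (r k * t))).

Let F0E t : 0 < t -> F0 t = limn (series (fun k => a k * v (r k * t))).
Proof. by move=> t0; rewrite /F0 indicE mem_set ?mul1r//= in_itv /= t0. Qed.

Let F0_measurable : measurable_fun [set: R] F0.
Proof.
apply: (@measurable_fun_cvg _ _ R setT (fun n t => \1_(`]0, +oo[%classic : set R) t *
   series (fun k => a k * v (r k * t)) n)).
  move=> n; apply: measurable_funM; first exact: measurable_indic.
  apply: continuous_measurable_fun => t; apply: contP.
  rewrite /series /=; apply: eq_cont (fun t => esym (big_mkord _ _)).
  apply: (@cont_sum R (fun k t => a k * v (r k * t))) => k.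
  apply: contM; first exact: cont_cst.
  apply: (@cont_comp _ v (fun t => r k * t)); last exact: cont_v.
  exact: contM (@cont_cst _ (r k) t) (@cont_id _ t).
move=> t _; rewrite /F0 indicE; have [t0|t0] := boolP (t \in _); last first.
  by rewrite mul0r; under eq_fun do rewrite mul0r; exact: cvg_cst.
rewrite mul1r; under eq_fun do rewrite mul1r.
apply: normed_cvg; apply: (extremal_normed_cvg c_gt0).
by move: t0; rewrite inE /= in_itv /= andbT.
Qed.

Let F0_bound t : 0 < t -> `|h t - F0 t| <= H.
Proof. by move=> t0; rewrite F0E// extremal_bound. Qed.

Let F0_mem : bessel_space al F0.
Proof.
split.
  apply/andP; split; first by rewrite inE.
  rewrite inE /= /finite_norm LnormE; apply: (@le_lt_trans _ _ (1 + H)%:E); last exact: ltry.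
  apply/ess_supP; apply: ae_half_pos => t t0 /=; rewrite lee_fin.
  have -> : F0 t = h t - (h t - F0 t) by rewrite subKr.
  by apply: le_trans (ler_normB _ _) _; apply: lerD; [exact: h_le1 (ltW t0)|exact: F0_bound].
exists (fun k => a k); apply: ae_half_pos => t t0.
have E k : bessel_j al (r k * t) = v (r k * t).
  by rewrite bessel_jE// mulr_ge0 ?(ltW t0)// ltW// bessel_ratio_gt0.
under eq_fun do rewrite E; rewrite /=; split; first exact: extremal_normed_cvg.
by rewrite F0E//; apply: normed_cvg; exact: extremal_normed_cvg.
Qed.

Lemma best_approx_le : (bessel_best_approx al <= H%:E)%E.
Proof.
apply: le_trans (_ : Lnorm mu +oo%E (fun t => (bessel_j (al + 1) t - F0 t)%:E) <= _)%E.
  by apply: ereal_inf_lbound; exists F0.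
rewrite LnormE; apply/ess_supP; apply: ae_half_pos => t t0 /=; rewrite lee_fin.
by rewrite bessel_jE ?(ltW t0)// F0_bound.
Qed.

Lemma best_approx_ge : (H%:E <= bessel_best_approx al)%E.
Proof.
apply: le_ereal_inf_tmp => _ [F [_ [b bF]] <-].
have := ess_sup_ge mu (abse \o (fun t => (bessel_j (al + 1) t - F t)%:E)).
rewrite -LnormE; set N := Lnorm _ _ _ => NP.
have [N0|N0] := boolP (N == +oo%E); first by rewrite (eqP N0) leey.
have W1 := wI1_gt0 c_gt0.
have [N' NE] : exists N' : R, N = N'%:E.
  have N1 : (0 <= N)%E by exact: Lnorm_ge0.
  by case: N N0 NP N1 => // x _ _ _; exists x.
rewrite NE lee_fin /H mean_coef ler_pdivrMr//.
apply: (@mean_lower_bound R al c_gt0 b F).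
apply: (@ae_imp R (fun t => 0 <= t -> _ /\ _) _ _ (ae_half_itv (filterI NP bF))).
move=> t Ht t0; have [h1 h2] := Ht t0; move: h1 h2; rewrite NE /= lee_fin bessel_jE// => h1.
have E k : bessel_j al (r k * t) = v (r k * t).
  by rewrite bessel_jE// mulr_ge0// ltW// bessel_ratio_gt0.
by under eq_fun do rewrite E; move=> [].
Qed.

End best_approximation.

Theorem theorem1p3 (R : realType) (alpha : R)
    (halpha : - (272 / 1000) <= alpha) :
  let q1 := bessel_zero (alpha + 1) 0 in
  let H := hypergeometric_1F2 (alpha + 1) (alpha + 2) (alpha + 2)
             (- (q1 ^+ 2 / 4)) in
  bessel_best_approx alpha = H%:E /\
  H = (\int[@lebesgue_measure R]_(t in `[0, q1])
         (bessel_j (alpha + 1) t * t `^ (2 * alpha + 1)))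
      / (\int[@lebesgue_measure R]_(t in `[0, q1]) (t `^ (2 * alpha + 1))).
Proof.
move=> q1 H; have c_gt0 : 0 < 2 * alpha + 1 by move: halpha; lra.
have al11 : -1 < alpha + 1 by move: halpha; lra.
have HE : fourier_coef alpha (bj (alpha + 1)) 0 = H.
  by rewrite mean_coef// mean_hypergeometric.
split.
  by apply/eqP; rewrite eq_le -HE best_approx_le// best_approx_ge.
rewrite -[LHS](mean_hypergeometric c_gt0); congr (_ / _); apply: eq_Rintegral => t.
  rewrite inE /= in_itv /= => /andP[t0 _]; rewrite bessel_jE// ger0_norm// mulrC//.
by rewrite inE /= in_itv /= => /andP[t0 _]; rewrite ger0_norm// mulr1.
Qed.
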